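(* Let $K\subset\mathbf{C}$ be a finite union of pairwise disjoint, $C^2$ smooth Jordan arcs and let $z_0\in K$ be a fixed point which is not an endpoint of any of these arcs. Denote the two unit normals to $K$ at $z_0$ by $n_1(z_0)$ and $n_2(z_0)=-n_1(z_0)$. Then there exist a sequence of polynomials $P_n$ with $\deg P_n=n\to\infty$ and a sequence of real numbers $\varepsilon_n\to0$ such that $$|P_n'(z_0)|\ge n(1-\varepsilon_n)\,\|P_n\|_K\cdot\max\left(\frac{\partial}{\partial n_1(z_0)}g_{\mathbf{C}_\infty\setminus K}(z_0,\infty),\ \frac{\partial}{\partial n_2(z_0)}g_{\mathbf{C}_\infty\setminus K}(z_0,\infty)\right).$$
   Context: $\mathbf{C}_\infty=\mathbf{C}\cup\{\infty\}$ is the extended complex plane; $\|\cdot\|_K$ is the supremum norm over $K$. A $C^2$ smooth Jordan arc is the image of a compact interval under an injective $C^2$ map into $\mathbf{C}$ with nowhere vanishing derivative. For a domain $D\subset\mathbf{C}_\infty$ and $b\in D$, $g_D(z,b)$ denotes Green's function of $D$ with pole at $b$, extended by $0$ to the boundary. For a boundary point $z_0$ and a unit normal $n_j(z_0)$ (regarded as a complex number of modulus 1), the one-sided normal derivative is $$\frac{\partial}{\partial n_j(z_0)}g_D(z_0,b)=\lim_{t\to0+}\frac{g_D(z_0+t\,n_j(z_0),b)}{t}.$$ *)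

(* Defs.v *)
(* MathComp / MathComp-Analysis.  The complex plane is R[i]; its topology is
   carried by the alias R[i]^o, hence the casts to R[i]^o around limits. *)
From mathcomp Require Import all_boot all_order all_algebra.
From mathcomp Require Import complex.
From mathcomp Require Import all_classical all_reals all_analysis.
Set Implicit Arguments. Unset Strict Implicit. Unset Printing Implicit Defensive.
Import Order.TTheory GRing.Theory Num.Theory numFieldNormedType.Exports.
Local Open Scope classical_set_scope.
Local Open Scope ring_scope.

(* The R-valued modulus (the norm `|z| of R[i] is R[i]-valued). *)
Definition cmod (R : realType) (z : R[i]) : R := ComplexField.Normc.normc z.

(* One-sided at the endpoints when A is a segment. *)
Definition has_deriv_within (R : realType) (A : set R) (f : R -> R[i]) (t : R)
    (d : R[i]) : Prop :=
  ((f s - f t) / (s - t)%:C%C : R[i]^o) @[s --> within A t^'] --> (d : R[i]^o).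

Record C2_arc (R : realType) := C2Arc {
  arc_lo : R;
  arc_hi : R;
  arc_path : R -> R[i];
  arc_d1 : R -> R[i];
  arc_d2 : R -> R[i];
  arc_lo_hi : arc_lo < arc_hi;
  arc_inj : {in `[arc_lo, arc_hi] &, injective arc_path};
  arc_has_d1 : forall t, t \in `[arc_lo, arc_hi] ->
    has_deriv_within `[arc_lo, arc_hi] arc_path t (arc_d1 t);
  arc_has_d2 : forall t, t \in `[arc_lo, arc_hi] ->
    has_deriv_within `[arc_lo, arc_hi] arc_d1 t (arc_d2 t);
  arc_d2_continuous :
    {within `[arc_lo, arc_hi], continuous (arc_d2 : R -> R[i]^o)};
  arc_d1_neq0 : forall t, t \in `[arc_lo, arc_hi] -> arc_d1 t != 0 }.

Definition arc_set (R : realType) (G : C2_arc R) : set R[i] :=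
  arc_path G @` `[arc_lo G, arc_hi G].

Definition arc_endpoint (R : realType) (G : C2_arc R) (z : R[i]) : Prop :=
  z = arc_path G (arc_lo G) \/ z = arc_path G (arc_hi G).

(* Re (n * conj v) is the real inner product of n and v. *)
Definition arc_unit_normal (R : realType) (G : C2_arc R) (z n : R[i]) : Prop :=
  cmod n = 1 /\
  exists t : R, [/\ t \in `[arc_lo G, arc_hi G], arc_path G t = z
    & complex.Re (n * (arc_d1 G t)^*)%C = 0].

Definition sup_norm (R : realType) (K : set R[i]) (p : {poly R[i]}) : R :=
  sup [set cmod p.[z] | z in K].

Definition u_along_x (R : realType) (u : R[i] -> R) (z : R[i]) : R -> R :=
  fun x => u (x +i* complex.Im z)%C.

Definition u_along_y (R : realType) (u : R[i] -> R) (z : R[i]) : R -> R :=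
  fun y => u (complex.Re z +i* y)%C.

Definition partial_x (R : realType) (u : R[i] -> R) (z : R[i]) : R :=
  derive1 (u_along_x u z) (complex.Re z).

Definition partial_y (R : realType) (u : R[i] -> R) (z : R[i]) : R :=
  derive1 (u_along_y u z) (complex.Im z).

Definition C1_on (R : realType) (U : set R[i]) (u : R[i] -> R) : Prop :=
  forall z, U z ->
  [/\ derivable (u_along_x u z) (complex.Re z) 1,
      derivable (u_along_y u z) (complex.Im z) 1,
      {for z, continuous (partial_x u : R[i]^o -> R)}
    & {for z, continuous (partial_y u : R[i]^o -> R)}].

Definition C2_on (R : realType) (U : set R[i]) (u : R[i] -> R) : Prop :=
  [/\ C1_on U u, C1_on U (partial_x u) & C1_on U (partial_y u)].

(* Intended for open U. *)
Definition harmonic_on (R : realType) (U : set R[i]) (u : R[i] -> R) : Prop :=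
  C2_on U u /\
  forall z, U z -> partial_x (partial_x u) z + partial_y (partial_y u) z = 0.

(* g is Green's function, with pole at infinity, of the complement of the
   compact set K in the extended plane, extended by 0 to K.  The requirement
   that g tend to 0 at every point of K presupposes that the complement of K is
   a domain, regular for the Dirichlet problem; this is the case when K is a
   finite disjoint union of nondegenerate Jordan arcs.  By the maximum principle
   at most one g satisfies these conditions. *)
Definition is_green_infty (R : realType) (K : set R[i]) (g : R[i] -> R) : Prop :=
  [/\ harmonic_on (~` K) g,
      exists M r : R, forall z, r < cmod z -> `|g z - ln (cmod z)| <= M,
      forall z, K z -> g z = 0
    & forall z, K z -> {for z, continuous (g : R[i]^o -> R)}].

Definition normal_deriv (R : realType) (g : R[i] -> R) (z n : R[i]) : R :=
  lim (g (z + t%:C%C * n) / t @[t --> 0^'+]).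

(* Main.v *)
(* Let L > 0 be the normal derivative of g at z0 and put z0 at the origin.  With
   coordinates Y along the normal and X along the arc, K is confined near 0 to
   |Y| <= C0 X^2, and a sharp Harnack inequality in a half plane (with image
   charges) gives g >= (1 - e) L Y on cones at 0.  Hence near 0 the harmonic function
   h = (1 - e) L Y + c (Y^2 - X^2), c large, can be glued by a maximum with
   max (g - delta, - delta / 2) to a subharmonic function u of logarithmic growth:
   u <= 0 on K with equality only at 0, since c dominates the curvature of K.
   Discretizing the Riesz measure of u and rounding its masses to integers yields a
   polynomial T whose (1 / deg T) log |T| is uniformly close to u up to a constant
   and is harmonic near 0.  As the maximum of u on K at 0 is nondegenerate, after a
   small rotation |T| <= |T(0)| on K, while |T'(0)| >= deg T (1 - O(e)) L |T(0)|.
   Powers of T, times a factor close to 1 that adjusts the degree, give all n.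
   All Laplacians are five-point Laplacians on fine square lattices, so that only
   summation by parts is needed. *)
Require Import Defs.
From mathcomp Require Import all_boot all_order all_algebra.
From mathcomp Require Import complex.
From mathcomp Require Import all_classical all_reals all_analysis.
From mathcomp Require Import zify ring lra.
Set Implicit Arguments. Unset Strict Implicit. Unset Printing Implicit Defensive.
Import Order.TTheory GRing.Theory Num.Theory numFieldNormedType.Exports.
Local Open Scope classical_set_scope.
Local Open Scope ring_scope.

(** The hypothesis on g at z0 is one limit along one normal; no regularity of g up to K is
    available. The Harnack inequality spreads this limit to a cone, and only lower bounds for g are
    needed, since g enters u only where it must beat h. Two demands on c seem to conflict. It must
    exceed a multiple of the curvature bound C0, so that u has a strict maximum on K at 0; yet near
    the edge of the gluing box of half-width r, h must lie below g or below 0 by a fixed margin,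
    which limits c r to a small multiple of L. With c = e L / (8 r), of fixed product c r, both hold
    once r is small. Uniform closeness of log |T| to u controls T'(0) because u is a quadratic
    polynomial near 0 and T has no zeros there, so that the coefficients of the two expansions are
    close as well. The gradient of log |T| at 0 is then only nearly normal, and any tangential
    component would make |T| exceed |T(0)| on K; the rotation makes it exactly normal. Away from 0,
    u is bounded on K by a negative constant, which pays for the rotation. *)

Ltac nneg := repeat first [ done | by apply: ltW | apply: sqr_ge0 | apply: normr_ge0
  | match goal with |- is_true (_ <= _ - _) => rewrite subr_ge0; lra end
  | apply: exprn_ge0 | apply: addr_ge0 | apply: mulr_ge0 | rewrite invr_ge0 ].

(** Propositional hypotheses are discarded before the call, so that only the facts moved back into
    the goal reach the solver: each [move: ...; lra0] lists the inequalities that matter. *)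
Ltac lra0 := repeat match goal with H : ?T |- _ =>
  match type of T with Prop => clear H end end; lra.

Ltac lia0 := repeat match goal with H : ?T |- _ =>
  match type of T with Prop => clear H end end; lia.

Ltac nra0 := repeat match goal with H : ?T |- _ =>
  match type of T with Prop => clear H end end; nra.

(** * Discrete Laplacian and logarithmic kernel *)

Section LatticeSums.
Context {R : realType}.
Implicit Types (f : int -> R) (F G : int -> int -> R) (N M : nat) (a b c d : int).

Definition zsum N f : R := \sum_(i < N.*2.+1) f (i%:Z - N%:Z).

Lemma sum_window f M (lo : int) (len : nat) :
  (forall a, (M < `|a|)%N -> f a = 0) -> lo <= - M%:Z -> M%:Z < lo + len%:Z ->
  \sum_(i < len) f (lo + i%:Z) = zsum M f.
Proof.
move=> f0 hlo hhi.
have [k ek] : exists k : nat, lo = - M%:Z - k%:Z by exists `|- M%:Z - lo|%N; lia.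
have [l el] : exists l : nat, (len = k + (M.*2.+1 + l))%N.
  by exists (len - (k + M.*2.+1))%N; lia.
rewrite {len hhi}el big_split_ord /= [X in X + _]big1 ?add0r; last first.
  by move=> i _; apply: f0; have := ltn_ord i; lia.
rewrite big_split_ord /= [X in _ + X]big1 ?addr0; last first.
  by move=> i _; apply: f0; lia.
by apply: eq_bigr => i _; congr f; lia.
Qed.

Lemma zsum_shift f M N c :
  (forall a, (M < `|a|)%N -> f a = 0) -> (M + `|c| <= N)%N ->
  zsum N (fun a => f (a + c)) = zsum M f.
Proof.
move=> f0 h; rewrite /zsum -/(zsum M f) -(@sum_window f M (c - N%:Z) N.*2.+1) //; try lia.
by apply: eq_bigr => i _; congr f; lia.
Qed.

Lemma eq_zsum N f g : (forall a, (`|a| <= N)%N -> f a = g a) -> zsum N f = zsum N g.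
Proof. by move=> h; apply: eq_bigr => i _; apply: h; have := ltn_ord i; lia. Qed.

Lemma le_zsum N f g : (forall a, (`|a| <= N)%N -> f a <= g a) -> zsum N f <= zsum N g.
Proof. by move=> h; apply: ler_sum => i _; apply: h; have := ltn_ord i; lia. Qed.

Lemma zsumD N f g : zsum N (fun a => f a + g a) = zsum N f + zsum N g.
Proof. exact: big_split. Qed.

Lemma zsumZ N (k : R) f : zsum N (fun a => k * f a) = k * zsum N f.
Proof. by rewrite /zsum mulr_sumr. Qed.

Lemma zsum0 N f : (forall a, f a = 0) -> zsum N f = 0.
Proof. by move=> h; rewrite /zsum big1. Qed.

Lemma zsum_cst N (k : R) : zsum N (fun=> k) = N.*2.+1%:R * k.
Proof. by rewrite /zsum sumr_const card_ord mulr_natl. Qed.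

Definition bsum N F : R := zsum N (fun a => zsum N (F a)).

Definition vanish M F := forall a b, (M < `|a|)%N || (M < `|b|)%N -> F a b = 0.

Lemma bsum_shift F M N c d : vanish M F -> (M + `|c| <= N)%N -> (M + `|d| <= N)%N ->
  bsum N (fun a b => F (a + c) (b + d)) = bsum M F.
Proof.
move=> F0 hc hd; rewrite /bsum.
rewrite (@zsum_shift (fun a => zsum N (fun b => F a (b + d))) M N c) //.
  apply: eq_zsum => a _; apply: zsum_shift => // b hb.
  by apply: F0; rewrite hb orbT.
by move=> a ha; apply: zsum0 => b; apply: F0; rewrite ha.
Qed.

Lemma eq_bsum N F G :
  (forall a b, (`|a| <= N)%N -> (`|b| <= N)%N -> F a b = G a b) -> bsum N F = bsum N G.
Proof. by move=> h; apply: eq_zsum => a ha; apply: eq_zsum => b hb; exact: h. Qed.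

Lemma le_bsum N F G :
  (forall a b, (`|a| <= N)%N -> (`|b| <= N)%N -> F a b <= G a b) -> bsum N F <= bsum N G.
Proof. by move=> h; apply: le_zsum => a ha; apply: le_zsum => b hb; exact: h. Qed.

Lemma bsumD N F G : bsum N (fun a b => F a b + G a b) = bsum N F + bsum N G.
Proof. by rewrite /bsum -zsumD; apply: eq_zsum => a _; rewrite zsumD. Qed.

Lemma bsumZ N (k : R) F : bsum N (fun a b => k * F a b) = k * bsum N F.
Proof. by rewrite /bsum -zsumZ; apply: eq_zsum => a _; rewrite zsumZ. Qed.

Lemma bsumB N F G : bsum N (fun a b => F a b - G a b) = bsum N F - bsum N G.
Proof.
rewrite -[X in _ = _ - X]mul1r -mulNr -bsumZ -bsumD.
by apply: eq_bsum => a b _ _; rewrite mulN1r.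
Qed.

Lemma bsum_cst N (k : R) : bsum N (fun=> fun=> k) = N.*2.+1%:R ^+ 2 * k.
Proof. by rewrite /bsum !zsum_cst mulrA. Qed.

Lemma bsum_widen F M N : vanish M F -> (M <= N)%N -> bsum N F = bsum M F.
Proof.
move=> F0 h; rewrite -(@bsum_shift F M N 0 0) ?addn0 //.
by apply: eq_bsum => a b _ _; rewrite !addr0.
Qed.

Lemma bsum_ge0 N F :
  (forall a b, (`|a| <= N)%N -> (`|b| <= N)%N -> 0 <= F a b) -> 0 <= bsum N F.
Proof.
by move=> h; have := @le_bsum N (fun=> fun=> 0) F h; rewrite bsum_cst mulr0.
Qed.

Lemma ler_norm_bsum N F : `|bsum N F| <= bsum N (fun a b => `|F a b|).
Proof.
rewrite ler_norml; apply/andP; split.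
  rewrite -mulN1r -bsumZ; apply: le_bsum => a b _ _.
  by rewrite mulN1r lerNl -normrN ler_norm.
by apply: le_bsum => a b _ _; exact: ler_norm.
Qed.

Definition lap F a b : R :=
  F (a + 1) b + F (a - 1) b + F a (b + 1) + F a (b - 1) - 4 * F a b.

(** Summation by parts without boundary terms: [F] vanishes outside the box of half-width [N.-1], so
    a unit shift of indices moves nothing out of the box of half-width [N]. Nothing is asked of [G],
    which will be Green's function, a logarithmic kernel or the constant 1. *)
Lemma green F G N : (0 < N)%N -> vanish N.-1 F ->
  bsum N (fun a b => F a b * lap G a b) = bsum N (fun a b => G a b * lap F a b).
Proof.
move=> N0 F0.
have sh c d : (`|c| <= 1)%N -> (`|d| <= 1)%N ->
    bsum N (fun a b => F a b * G (a + c) (b + d)) =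
    bsum N (fun a b => G a b * F (a - c) (b - d)).
  move=> hc hd.
  pose H a b := F a b * G (a + c) (b + d).
  have H0 : vanish N.-1 H by move=> a b h; rewrite /H F0 // mul0r.
  rewrite -/H (bsum_widen H0) ?leq_pred // -(@bsum_shift H N.-1 N (- c) (- d)) //; try lia.
  by apply: eq_bsum => a b _ _; rewrite /H !subrK mulrC.
have e1 := sh 1 0 isT isT; have e2 := sh (-1) 0 isT isT.
have e3 := sh 0 1 isT isT; have e4 := sh 0 (-1) isT isT.
rewrite /lap.
transitivity (bsum N (fun a b => F a b * G (a + 1) (b + 0)) +
  bsum N (fun a b => F a b * G (a + -1) (b + 0)) +
  bsum N (fun a b => F a b * G (a + 0) (b + 1)) +
  bsum N (fun a b => F a b * G (a + 0) (b + -1)) -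
  4 * bsum N (fun a b => F a b * G a b)).
  rewrite -bsumZ -!bsumD -bsumB; apply: eq_bsum => a b _ _; rewrite !addr0; ring.
rewrite e1 e2 e3 e4 -bsumZ -!bsumD -bsumB; apply: eq_bsum => a b _ _.
by rewrite !subr0 !opprK; ring.
Qed.

End LatticeSums.

Section LogKernel.
Context {R : realType}.
Implicit Types (e h x y p q : R).

Lemma lnB_le p q : 0 < p -> 0 < q -> ln p - ln q <= (p - q) / q.
Proof.
move=> p0 q0; rewrite -ln_div //.
have pq : 0 < p / q by rewrite divr_gt0.
have epq : p / q = 1 + (p - q) / q by field; lra.
by rewrite epq; apply: le_ln1Dx; lra.
Qed.

Lemma lnB_ge p q : 0 < p -> 0 < q -> (p - q) / p <= ln p - ln q.
Proof.
move=> p0 q0; have := lnB_le q0 p0.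
by rewrite -lerN2 opprB -mulNr opprB.
Qed.

(** Not divided by [h ^+ 2]: being nearly harmonic reads [eta * h ^+ 2], and summing this over the
    lattice points of a bounded region, of order [h ^- 2] in number, gives a quantity of order
    [eta]. *)
Definition dlap h (f : R -> R -> R) x y :=
  f (x + h) y + f (x - h) y + f x (y + h) + f x (y - h) - 4 * f x y.

(* log |z| smoothed at scale sqrt e: its discrete Laplacian is nonnegative and
   concentrates at the origin as e tends to 0. *)
Definition kk e x y := ln (x ^+ 2 + y ^+ 2 + e) / 2.

Lemma kk_arg_gt0 e x y : 0 < e -> 0 < x ^+ 2 + y ^+ 2 + e.
Proof. by move=> e0; rewrite ltr_wpDl // addr_ge0 ?sqr_ge0. Qed.

(** The four neighbouring logarithms combine into the logarithm of one product, whose expansion is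
    [n ^+ 4] plus a correction. Its leading term [4 * h ^+ 2 * e * n ^+ 2] is positive and, once
    [h ^+ 2 <= e], dominates the only negative term [- 2 * n ^+ 2 * h ^+ 4]; hence that restriction
    on the mesh everywhere below. *)
Lemma dlap_kk e h x y : 0 < e -> let n := x ^+ 2 + y ^+ 2 + e in
  dlap h (kk e) x y = (ln (n ^+ 4 + (4 * h ^+ 2 * e * (n + h ^+ 2) ^+ 2
     - 2 * n ^+ 2 * h ^+ 4 + h ^+ 8 + 16 * h ^+ 4 * x ^+ 2 * y ^+ 2)) - ln (n ^+ 4)) / 2.
Proof.
move=> e0 n; rewrite /dlap /kk.
have n0 : 0 < n by exact: kk_arg_gt0.
have p1 := kk_arg_gt0 (x + h) y e0; have p2 := kk_arg_gt0 (x - h) y e0.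
have p3 := kk_arg_gt0 x (y + h) e0; have p4 := kk_arg_gt0 x (y - h) e0.
rewrite (lnXn 4) // -/n.
set a := _ + e in p1 *; set b := _ + e in p2 *; set c := _ + e in p3 *; set d := _ + e in p4 *.
have -> : n ^+ 4 + (4 * h ^+ 2 * e * (n + h ^+ 2) ^+ 2
     - 2 * n ^+ 2 * h ^+ 4 + h ^+ 8 + 16 * h ^+ 4 * x ^+ 2 * y ^+ 2) = a * b * c * d.
  by rewrite /a /b /c /d /n; ring.
rewrite !lnM ?posrE ?mulr_gt0 // -mulr_natl; lra.
Qed.

Lemma dlap_kk_ge e h x y : 0 < e -> h ^+ 2 <= e ->
  (h ^+ 2 * e) / ((x ^+ 2 + y ^+ 2 + e) ^+ 2 + 2 * h ^+ 2 * e) <= dlap h (kk e) x y.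
Proof.
move=> e0 he; rewrite dlap_kk //=; set n := _ + e.
have n0 : 0 < n by exact: kk_arg_gt0.
have h0 := sqr_ge0 h.
set H := h ^+ 2 in he h0 *.
have -> : h ^+ 4 = H ^+ 2 by rewrite /H; ring.
have -> : h ^+ 8 = H ^+ 4 by rewrite /H; ring.
set s := (X in n ^+ 4 + X).
have sn : 2 * H * e * n ^+ 2 <= s.
  rewrite /s.
  have t1 : 0 <= H ^+ 4 by nneg.
  have t2 : 0 <= 16 * H ^+ 2 * x ^+ 2 * y ^+ 2.
    nneg.
  have t3 : 2 * n ^+ 2 * H ^+ 2 <= 2 * H * e * n ^+ 2.
    have : 0 <= 2 * n ^+ 2 * H * (e - H) by nneg.
    lra.
  have t4 : 4 * H * e * n ^+ 2 <= 4 * H * e * (n + H) ^+ 2.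
    rewrite ler_wpM2l //; [nneg | rewrite ler_sqr ?nnegrE; lra].
  lra.
have n4 : 0 < n ^+ 4 by rewrite exprn_gt0.
have s0 : 0 <= s by apply: le_trans sn; nneg.
have := lnB_ge (ltr_wpDr s0 n4) n4.
rewrite addrAC subrr add0r => /(le_trans _) H1.
rewrite ler_pdivlMr //; apply: H1.
have d0 : 0 < n ^+ 2 + 2 * H * e by rewrite ltr_wpDr ?exprn_gt0 //; nneg.
have -> : H * e / (n ^+ 2 + 2 * H * e) * 2 = (2 * H * e) / (n ^+ 2 + 2 * H * e).
  by field; lra.
rewrite ler_pdivrMr // [leRHS]mulrAC ler_pdivlMr ?ltr_wpDr //.
have : 0 <= (s - 2 * H * e * n ^+ 2) * n ^+ 2 by nneg.
lra.
Qed.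

Lemma dlap_kk_ge0 e h x y : 0 < e -> h ^+ 2 <= e -> 0 <= dlap h (kk e) x y.
Proof.
move=> e0 he; apply: le_trans (dlap_kk_ge x y e0 he).
have h0 := sqr_ge0 h.
nneg.
Qed.

(** The continuous Laplacian of the smoothed logarithm is [2 * e / n ^+ 2] with
    [n = x ^+ 2 + y ^+ 2 + e]; the constant 11 leaves room for all discretization errors. *)
Lemma dlap_kk_le e h x y : 0 < e -> h ^+ 2 <= e ->
  dlap h (kk e) x y <= 11 * (e * h ^+ 2) / (x ^+ 2 + y ^+ 2 + e) ^+ 2.
Proof.
move=> e0 he; rewrite dlap_kk //=; set n := _ + e.
have n0 : 0 < n by exact: kk_arg_gt0.
have h0 := sqr_ge0 h.
have en : e <= n by rewrite lerDr addr_ge0 ?sqr_ge0.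
have xy : 4 * (x ^+ 2 * y ^+ 2) <= n ^+ 2.
  have := sqr_ge0 (x ^+ 2 - y ^+ 2).
  have : (x ^+ 2 + y ^+ 2) ^+ 2 <= n ^+ 2.
    by rewrite ler_sqr ?nnegrE ?(ltW n0) ?addr_ge0 ?sqr_ge0 // lerDl ltW.
  lra.
set H := h ^+ 2 in he h0 *.
have -> : h ^+ 4 = H ^+ 2 by rewrite /H; ring.
have -> : h ^+ 8 = H ^+ 4 by rewrite /H; ring.
set s := (X in n ^+ 4 + X).
have HH : H ^+ 2 <= H * e by rewrite expr2 ler_wpM2l.
have sn : s <= 21 * (e * H) * n ^+ 2.
  rewrite /s.
  have t1 : H ^+ 4 <= H * e * n ^+ 2.
    rewrite (_ : H ^+ 4 = H ^+ 2 * H ^+ 2); last ring.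
    apply: ler_pM; rewrite ?sqr_ge0 // ler_sqr ?nnegrE //; lra.
  have t2 : 16 * H ^+ 2 * x ^+ 2 * y ^+ 2 <= 4 * (H * e) * n ^+ 2.
    have := ler_pM (sqr_ge0 H) _ HH xy; move=> /(_ ltac:(nneg)); lra.
  have t3 : 0 <= 2 * n ^+ 2 * H ^+ 2 by nneg.
  have t4 : 4 * H * e * (n + H) ^+ 2 <= 4 * H * e * (2 * n) ^+ 2.
    rewrite ler_wpM2l //; [nneg | rewrite ler_sqr ?nnegrE; lra].
  lra.
have n4 : 0 < n ^+ 4 by rewrite exprn_gt0.
have s4 : 0 < n ^+ 4 + s.
  have a1 := kk_arg_gt0 (x + h) y e0; have a2 := kk_arg_gt0 (x - h) y e0.
  have a3 := kk_arg_gt0 x (y + h) e0; have a4 := kk_arg_gt0 x (y - h) e0.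
  have -> : n ^+ 4 + s = ((x + h) ^+ 2 + y ^+ 2 + e) * ((x - h) ^+ 2 + y ^+ 2 + e) *
     (x ^+ 2 + (y + h) ^+ 2 + e) * (x ^+ 2 + (y - h) ^+ 2 + e).
    by rewrite /s /n /H; ring.
  by rewrite !mulr_gt0.
have := lnB_le s4 n4; rewrite addrAC subrr add0r => H1.
rewrite ler_pdivrMr //; apply: le_trans H1 _.
rewrite ler_pdivrMr //.
have n2 : n ^+ 2 != 0 by rewrite gt_eqF // exprn_gt0.
have -> : 11 * (e * H) / n ^+ 2 * 2 * n ^+ 4 = 22 * (e * H) * n ^+ 2 by field; lra.
apply: le_trans sn _; rewrite ler_wpM2r ?sqr_ge0 //.
have : 0 <= e * H by rewrite mulr_ge0 // ltW.
lra.
Qed.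

Lemma kk_le_log (e x y B : R) : 0 < e -> x ^+ 2 + y ^+ 2 + e <= B ->
  kk e x y <= ln B / 2.
Proof.
move=> e0 hB; rewrite /kk ler_pM2r ?invr_gt0 // ler_ln // posrE ?kk_arg_gt0 //.
by apply: lt_le_trans hB; exact: kk_arg_gt0.
Qed.

Lemma kk_ge_log (e x y b : R) : 0 < e -> 0 < b -> b <= x ^+ 2 + y ^+ 2 + e ->
  ln b / 2 <= kk e x y.
Proof.
by move=> e0 b0 hB; rewrite /kk ler_pM2r ?invr_gt0 // ler_ln // posrE ?kk_arg_gt0.
Qed.

(** At scale [s] the kernel is Lipschitz with constant of order [1 / s] even at its pole. This
    carries potential estimates from lattice points to all points, at the price of a mesh much finer
    than [s]. *)
Lemma kk_lip_le (s h x y x' y' : R) : 0 < s -> `|x - x'| <= h -> `|y - y'| <= h ->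
  kk (s ^+ 2) x y - kk (s ^+ 2) x' y' <= h / s + (h / s) ^+ 2.
Proof.
move=> s0 hx hy; rewrite /kk -mulrBl ler_pdivrMr //.
have e0 : 0 < s ^+ 2 by rewrite exprn_gt0.
have p := kk_arg_gt0 x y e0; have p' := kk_arg_gt0 x' y' e0.
apply: le_trans (lnB_le p p') _; rewrite ler_pdivrMr //.
set q := h / s; have hq : h = q * s by rewrite /q; field; lra.
have q0 : 0 <= q by rewrite divr_ge0 ?(ltW s0) // (le_trans (normr_ge0 _) hx).
rewrite hq in hx hy.
have key (u u' : R) : `|u - u'| <= q * s ->
    u ^+ 2 - u' ^+ 2 <= q * (u' ^+ 2 + s ^+ 2) + q ^+ 2 * s ^+ 2.
  move=> hu.
  have h1 : (u - u') ^+ 2 <= q ^+ 2 * s ^+ 2.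
    rewrite -exprMn -[leLHS](real_normK (num_real _)) ler_sqr ?nnegrE //.
    by rewrite mulr_ge0 // ltW.
  have h2 : 2 * u' * (u - u') <= q * (u' ^+ 2 + s ^+ 2).
    have : `|2 * u' * (u - u')| <= 2 * `|u'| * (q * s).
      by rewrite !normrM ger0_norm // ler_wpM2l // mulr_ge0.
    move/(le_trans (ler_norm _)) => /le_trans; apply.
    have := mulr_ge0 q0 (sqr_ge0 (`|u'| - s)); rewrite sqrrB -[in X in _ -> X](real_normK (num_real u')).
    lra.
  by lra.
have := key _ _ hx; have := key _ _ hy.
have : 0 <= q ^+ 2 * (x' ^+ 2 + y' ^+ 2) by nneg.
have : 0 <= q * (x' ^+ 2 + y' ^+ 2) by nneg.
lra.
Qed.

Lemma kk_lip (s h x y x' y' : R) : 0 < s -> `|x - x'| <= h -> `|y - y'| <= h ->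
  `|kk (s ^+ 2) x y - kk (s ^+ 2) x' y'| <= h / s + (h / s) ^+ 2.
Proof.
move=> s0 hx hy; rewrite ler_norml kk_lip_le // andbT lerNl opprB.
by apply: kk_lip_le => //; rewrite distrC.
Qed.

End LogKernel.

(** * The Laplacian of the smoothed logarithm as an approximate identity *)

Section ApproximateIdentity.
Context {R : realType}.
Implicit Types (e h : R) (a b c d : int) (N : nat).

Definition kd e h a b := dlap h (kk e) (h * a%:~R) (h * b%:~R).

(** Close to 2 pi when [h] is far below the smoothing scale and the box far above it. The value is
    never computed: the mass stands on both sides of an inequality or cancels in a quotient, and
    only a positive lower bound is needed. *)
Definition mass e h N := bsum N (kd e h).

(** Within distance [sqrt r] of the centre [F] oscillates by at most [w]. Farther away the kernel is
    at most [11 * e * h ^+ 2 / r ^+ 2], and the number of lattice points times [h ^+ 2] is bounded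
    through [H], so that this part vanishes with [e]. Recentring at [(c, d)] enlarges the box from
    [N] to [N.*2]. *)
Lemma approx_id e h N (F : int -> int -> R) c d (B w r H : R) :
  0 < e -> 0 < h -> h <= 1 -> h ^+ 2 <= e -> h * N%:R <= H ->
  vanish N F -> (`|c| <= N)%N -> (`|d| <= N)%N -> 0 < r -> 0 <= w ->
  (forall a b, `|F a b| <= B) ->
  (forall a b, (h * (a - c)%:~R) ^+ 2 + (h * (b - d)%:~R) ^+ 2 < r ->
     `|F a b - F c d| <= w) ->
  `|bsum N (fun a b => F a b * kd e h (a - c) (b - d)) - mass e h N.*2 * F c d|
    <= w * mass e h N.*2 + 22 * B * e * (4 * H + 1) ^+ 2 / r ^+ 2.
Proof.
move=> e0 h0 h1 he hN F0 hc hd r0 w0 hB hw.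
have B0 : 0 <= B := le_trans (normr_ge0 _) (hB 0 0).
pose G a b := F a b * kd e h (a - c) (b - d).
have G0 : vanish N G by move=> a b ab; rewrite /G F0 // mul0r.
rewrite -/G -(@bsum_shift _ G N N.*2 c d) //; [|by rewrite -addnn leq_add2l..].
rewrite mulrC -bsumZ -bsumB; apply: le_trans (ler_norm_bsum _ _) _.
pose t : R := 11 * (e * h ^+ 2) / r ^+ 2.
have t0 : 0 <= t by rewrite /t; nneg.
apply: (@le_trans _ _ (bsum N.*2 (fun a b => w * kd e h a b + 2 * B * t))).
  apply: le_bsum => a b _ _; rewrite /G !addrK.
  have k0 : 0 <= kd e h a b by exact: dlap_kk_ge0.
  rewrite -mulrBl normrM (ger0_norm k0).
  have [lr|ge] := ltP ((h * a%:~R) ^+ 2 + (h * b%:~R) ^+ 2) r.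
    rewrite -[leLHS]addr0 lerD ?ler_wpM2r ?hw ?addrK //; nneg.
  rewrite -[leLHS]add0r lerD //; first by nneg.
  apply: ler_pM => //.
    apply: le_trans (ler_normB _ _) _.
    by have := hB (a + c) (b + d); have := hB c d; lra.
  apply: le_trans (dlap_kk_le _ _ e0 he) _.
  rewrite /t ler_wpM2l //; first by nneg.
  rewrite lef_pV2 ?posrE ?exprn_gt0 // ?kk_arg_gt0 //.
  rewrite ler_sqr ?nnegrE ?(ltW r0) ?(ltW (kk_arg_gt0 _ _ _)) //; lra.
rewrite bsumD bsumZ bsum_cst lerD //.
have -> : 22 * B * e * (4 * H + 1) ^+ 2 / r ^+ 2 =
  (2 * B * (11 * e / r ^+ 2)) * (4 * H + 1) ^+ 2 by field; lra.
have -> : N.*2.*2.+1%:R ^+ 2 * (2 * B * t) =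
  (2 * B * (11 * e / r ^+ 2)) * (h * N.*2.*2.+1%:R) ^+ 2 by rewrite /t; field; lra.
rewrite ler_wpM2l //; first by nneg.
have e4 : N.*2.*2.+1%:R = 4 * N%:R + 1 :> R.
  by rewrite -addn1 natrD -!muln2 !natrM; ring.
have N0 : 0 <= h * N%:R by nneg.
rewrite e4 ler_sqr ?nnegrE; try nneg; nra.
Qed.

(** On the square where both coordinates are at most [s] in modulus, [n <= 3 * s ^+ 2], so each term
    is at least [1 / (11 * q ^+ 2)]. There are more than [4 * q ^+ 2] such terms, and 4/11 exceeds
    1/3. *)
Lemma mass_ge (s : R) (q N : nat) : 0 < s -> (0 < q)%N -> (q <= N)%N ->
  3^-1 <= mass (s ^+ 2) (s / q%:R) N.
Proof.
move=> s0 q0 qN; set h := s / q%:R.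
have e0 : 0 < s ^+ 2 by rewrite exprn_gt0.
have qq : 0 < q%:R :> R by rewrite ltr0n.
have q1 : 1 <= q%:R :> R by rewrite ler1n.
have h0 : 0 < h by rewrite divr_gt0.
have hs : s = h * q%:R by rewrite /h; field; lra.
have he : h ^+ 2 <= s ^+ 2 by rewrite ler_sqr ?nnegrE; nra.
pose F a b := if (`|a| <= q)%N && (`|b| <= q)%N then kd (s ^+ 2) h a b else 0.
apply: (@le_trans _ _ (bsum N F)); last first.
  by apply: le_bsum => a b _ _; rewrite /F; case: ifP => // _; exact: dlap_kk_ge0.
rewrite (@bsum_widen _ F q) //; last first.
  move=> a b; rewrite /F; case: ifP => //; lia.
apply: (@le_trans _ _ (bsum q (fun=> fun=> (11 * q%:R ^+ 2)^-1))).
  rewrite bsum_cst.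
  have -> : q.*2.+1%:R = 2 * q%:R + 1 :> R by rewrite -addn1 natrD -muln2 natrM; ring.
  rewrite ler_pdivlMr; last by rewrite mulr_gt0 // exprn_gt0.
  nra.
apply: le_bsum => a b ha hb; rewrite /F ha hb /=.
apply: le_trans (dlap_kk_ge _ _ e0 he).
set x := h * a%:~R; set y := h * b%:~R.
have sq c : (`|c| <= q)%N -> (h * c%:~R) ^+ 2 <= s ^+ 2.
  move=> hc; rewrite -[leLHS](real_normK (num_real _)) ler_sqr ?nnegrE ?(ltW s0) //.
  rewrite normrM gtr0_norm // hs ler_pM2l // -intr_norm.
  by rewrite -[X in _ <= X]/((q%:Z)%:~R) ler_int; lia.
have hx : x ^+ 2 <= s ^+ 2 by exact: sq.
have hy : y ^+ 2 <= s ^+ 2 by exact: sq.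
have n0 := kk_arg_gt0 x y e0.
have d0 : 0 < (x ^+ 2 + y ^+ 2 + s ^+ 2) ^+ 2 + 2 * h ^+ 2 * s ^+ 2.
  by rewrite ltr_wpDr ?exprn_gt0 //; nneg.
have x0 := sqr_ge0 x; have y0 := sqr_ge0 y.
have n3 : (x ^+ 2 + y ^+ 2 + s ^+ 2) ^+ 2 <= (3 * s ^+ 2) ^+ 2 by rewrite ler_sqr ?nnegrE; lra.
rewrite -[leLHS]mul1r ler_pdivrMr ?mulr_gt0 ?exprn_gt0 // mulrAC ler_pdivlMr // mul1r.
have -> : h ^+ 2 * s ^+ 2 * (11 * q%:R ^+ 2) = 11 * s ^+ 2 * s ^+ 2.
  have <- : h ^+ 2 * q%:R ^+ 2 = s ^+ 2 by rewrite -exprMn -hs.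
  by ring.
have : h ^+ 2 * s ^+ 2 <= s ^+ 2 * s ^+ 2 by rewrite ler_wpM2r // sqr_ge0.
lra.
Qed.

End ApproximateIdentity.

(** * Sharp Harnack inequality in a half plane *)

Section Gluing.
Context {R : realType}.
Implicit Types (h x y : R) (f g : R -> R -> R).

Definition adj h (x y x' y' : R) := `|x - x'| <= h /\ `|y - y'| <= h.

Lemma adj_sym h x y x' y' : adj h x y x' y' -> adj h x' y' x y.
Proof. by rewrite /adj distrC [X in _ /\ X <= _]distrC. Qed.

(** The discrete form of the fact that a maximum of subharmonic functions is subharmonic: the centre
    carries the negative weight, so raising the neighbours alone can only raise the Laplacian. All
    gluings rest on it. *)
Lemma le_dlap h f g x y : 0 <= h -> f x y = g x y ->
  (forall x' y', adj h x y x' y' -> f x' y' <= g x' y') ->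
  dlap h f x y <= dlap h g x y.
Proof.
move=> h0 e le; rewrite /dlap e lerD2r.
have nn : `|h| <= h by rewrite ger0_norm.
by rewrite !lerD // le //; split; rewrite ?subrr ?normr0 // ?opprD ?opprK ?addrA ?subrr ?add0r ?normrN.
Qed.

Lemma dlap0 h x y : dlap h (fun=> fun=> 0) x y = 0 :> R.
Proof. by rewrite /dlap; ring. Qed.

(** On [Q] the function is kept as it is: a plain positive part would flatten the deep negative well
    of the test function at the reference point, whose mass carries the value of g there. The
    positive part is taken only in the collar between [Q] and [Q'], where it permits extension by
    0. *)
Definition collar (Q Q' : R -> R -> bool) f x y :=
  if Q x y then f x y else if Q' x y then Num.max (f x y) 0 else 0.

(** At each point the glued function agrees with [f] or with 0 and dominates that same function at
    the neighbours, so [le_dlap] applies. The two sign conditions, at the inner edges of [Q] and of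
    [Q'], are what domination across an edge requires. *)
Lemma dlap_collar h (Q Q' : R -> R -> bool) f :
  0 <= h ->
  (forall x y, Q x y -> Q' x y) ->
  (forall x y x' y', adj h x y x' y' -> Q x y -> ~~ Q x' y' -> 0 <= f x y) ->
  (forall x y x' y', adj h x y x' y' -> Q' x y -> ~~ Q' x' y' -> f x y <= 0) ->
  (forall x y x' y', adj h x y x' y' -> Q x y -> Q' x' y') ->
  forall x y,
  [/\ Q x y -> dlap h f x y <= dlap h (collar Q Q' f) x y,
      Q' x y -> 0 <= dlap h (collar Q Q' f) x y \/
                dlap h f x y <= dlap h (collar Q Q' f) x y
    & ~~ Q' x y -> 0 <= dlap h (collar Q Q' f) x y].
Proof.
move=> h0 QQ' posQ negQ' far x y.
have ge0 : ~~ Q x y -> collar Q Q' f x y = 0 -> 0 <= dlap h (collar Q Q' f) x y.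
  move=> nQ e; rewrite -(dlap0 h x y); apply: le_dlap => // x' y' a.
  rewrite /collar; case: ifPn => [q|_]; first exact: posQ (adj_sym a) q nQ.
  by case: ifP => // _; rewrite le_max lexx orbT.
have geQ : Q x y -> dlap h f x y <= dlap h (collar Q Q' f) x y.
  move=> q; apply: le_dlap => //; first by rewrite /collar q.
  move=> x' y' a; rewrite /collar (far _ _ _ _ a q); case: ifP => // _.
  by rewrite le_max lexx.
split=> //.
- move=> q'; have [/geQ|nQ] := boolP (Q x y); first by right.
  have [f0|f0] := leP (f x y) 0.
    by left; apply: ge0 => //; rewrite /collar (negbTE nQ) q' (max_r f0).
  right; apply: le_dlap => //.
    by rewrite /collar (negbTE nQ) q' (max_l (ltW f0)).
  move=> x' y' a; rewrite /collar; case: ifPn => // _.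
  case: ifPn => [_|nQ']; first by rewrite le_max lexx.
  by have := negQ' _ _ _ _ a q' nQ'; rewrite leNgt f0.
- move=> nQ'; have nQ : ~~ Q x y by apply: contra nQ'; exact: QQ'.
  by apply: ge0 => //; rewrite /collar (negbTE nQ) (negbTE nQ').
Qed.

End Gluing.

Section Image.
Context {R : realType}.
Implicit Types (x y e nx ny : R).

Definition nrm nx ny x y : R := x * nx + y * ny.

(* Green's function of the half plane [0 < nrm] with pole w, the opposite charge
   sitting at the mirror image of w. *)
Definition gr e nx ny wx wy x y : R :=
  kk e (x - (wx - 2 * nrm nx ny wx wy * nx)) (y - (wy - 2 * nrm nx ny wx wy * ny))
  - kk e (x - wx) (y - wy).

Lemma nrm_lip nx ny x y x' y' h : nx ^+ 2 + ny ^+ 2 = 1 -> adj h x y x' y' ->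
  `|nrm nx ny x y - nrm nx ny x' y'| <= 2 * h.
Proof.
move=> n1 [hx hy].
have n_le (u v : R) : u ^+ 2 + v ^+ 2 = 1 -> `|u| <= 1.
  move=> uv; rewrite -[leRHS](ger0_norm (ler01)) -ler_sqr ?nnegrE //.
  by rewrite !real_normK ?num_real //; have := sqr_ge0 v; lra.
have hnx := n_le _ _ n1.
have hny : `|ny| <= 1 by apply: (n_le ny nx); rewrite addrC.
have -> : nrm nx ny x y - nrm nx ny x' y' = (x - x') * nx + (y - y') * ny.
  by rewrite /nrm; ring.
apply: le_trans (ler_normD _ _) _; rewrite !normrM.
have := ler_pM (normr_ge0 _) (normr_ge0 _) hx hnx.
have := ler_pM (normr_ge0 _) (normr_ge0 _) hy hny.
lra.
Qed.

(** The identity behind the method of images: the squared distances to [w] and to its mirror image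
    differ by four times the product of the heights. Hence [gr] is half the logarithm of one plus an
    explicit quotient, and both bounds below follow from the elementary inequalities for [ln]. *)
Lemma image_sub nx ny wx wy x y : nx ^+ 2 + ny ^+ 2 = 1 ->
  (x - (wx - 2 * nrm nx ny wx wy * nx)) ^+ 2 + (y - (wy - 2 * nrm nx ny wx wy * ny)) ^+ 2
  = (x - wx) ^+ 2 + (y - wy) ^+ 2 + 4 * nrm nx ny x y * nrm nx ny wx wy.
Proof.
move=> n1; set Y := nrm nx ny wx wy.
rewrite [LHS](_ : _ = (x - wx) ^+ 2 + (y - wy) ^+ 2 +
  4 * Y * ((x - wx) * nx + (y - wy) * ny) + 4 * Y ^+ 2 * (nx ^+ 2 + ny ^+ 2)); last by ring.
by rewrite n1 /Y /nrm; ring.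
Qed.

Lemma gr_le e nx ny wx wy x y : nx ^+ 2 + ny ^+ 2 = 1 -> 0 < e ->
  gr e nx ny wx wy x y <=
  2 * nrm nx ny x y * nrm nx ny wx wy / ((x - wx) ^+ 2 + (y - wy) ^+ 2 + e).
Proof.
move=> n1 e0; rewrite /gr /kk -mulrBl ler_pdivrMr //.
apply: le_trans (lnB_le _ _) _; rewrite ?kk_arg_gt0 //.
by rewrite image_sub // le_eqVlt; apply/orP; left; apply/eqP; ring.
Qed.

Lemma gr_ge e nx ny wx wy x y : nx ^+ 2 + ny ^+ 2 = 1 -> 0 < e ->
  2 * nrm nx ny x y * nrm nx ny wx wy /
    ((x - (wx - 2 * nrm nx ny wx wy * nx)) ^+ 2
     + (y - (wy - 2 * nrm nx ny wx wy * ny)) ^+ 2 + e)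
  <= gr e nx ny wx wy x y.
Proof.
move=> n1 e0; rewrite /gr /kk -mulrBl ler_pdivlMr //.
apply: le_trans (lnB_ge _ _); rewrite ?kk_arg_gt0 //.
rewrite (image_sub wx wy x y n1) mulrAC le_eqVlt; apply/orP; left; apply/eqP.
by congr (_ / _); ring.
Qed.

End Image.

(** * The test function of the Harnack inequality and its sign *)

Section HarnackTest.
Context {R : realType}.
Variables (nx ny mu y0 : R).
Definition harnack_params := [/\ nx ^+ 2 + ny ^+ 2 = 1, 0 < mu, mu <= 1 & 0 < y0].
Implicit Type hp : harnack_params.
Local Notation Y := (nrm nx ny).

(** Beyond distance [4 / mu] the factor [1 - mu] alone decides the comparison of the two Green's
    functions. [Den] bounds the squared distances that occur in the box of half-width [Lam], and
    [slope] is half of the resulting gain per unit of height. *)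
Definition Lam : R := 4 / mu + 1.
Definition Den : R := 2 * (Lam + 1) ^+ 2 + 1.
Definition slope : R := (4 * Den ^+ 2)^-1.
Definition bot : R := y0 / 4.
(** The affine term [slope * Y + tilt] of [psi] is what permits truncation. The gain left in
    [psi_ge0] is [slope * Y], which beats [tilt] when [Y >= bot]. Below height [2 * bot'] the
    constant [tilt] wins: the squared distance [p] to [w] is at least [y0 ^+ 2 / 4] there, so
    [2 * Y / p] is at most [16 * bot' / y0 ^+ 2 = tilt]. When a coordinate has modulus at least
    [Lam' - 1], [p >= 2 / slope] and [slope * Y] wins. *)
Definition tilt : R := bot * slope.
Definition bot' : R := tilt * y0 ^+ 2 / 16.
Definition Lam' : R := 2 + 2 / slope.

Definition inQ x y := [&& bot < Y x y, `|x| < Lam & `|y| < Lam].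
Definition inQ' x y := [&& bot' < Y x y, `|x| < Lam' & `|y| < Lam'].

Lemma botE : bot = y0 / 4.
Proof. by []. Qed.

Lemma inQE x y : inQ x y = [&& bot < Y x y, `|x| < Lam & `|y| < Lam].
Proof. by []. Qed.

Lemma inQ'E x y : inQ' x y = [&& bot' < Y x y, `|x| < Lam' & `|y| < Lam'].
Proof. by []. Qed.

(* The normal n serves as reference point.  Near the origin the Green's functions
   with poles w and n have ratio about Y w, so this difference is positive except
   close to the line; summing it against the Laplacian of g compares g at w and
   at n, and the strict excess mu absorbs the truncation to a box. *)
Definition psi e wx wy x y : R :=
  gr e nx ny wx wy x y / Y wx wy - (1 - mu) * gr e nx ny nx ny x y
  - slope * Y x y - tilt.

Lemma Lam_ge hp : 5 <= Lam.
Proof. have [n1 mu0 mu1 y00] := hp.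
have : 4 <= 4 / mu by rewrite ler_pdivlMr //; lra.
rewrite /Lam; lra.
Qed.

Lemma Den_ge hp : Lam + 1 <= Den.
Proof. have [n1 mu0 mu1 y00] := hp.
rewrite /Den; have := (Lam_ge hp) => h.
have : (Lam + 1) * 1 <= (Lam + 1) * (Lam + 1) by rewrite ler_wpM2l; lra.
have : 0 <= (Lam + 1) * (Lam + 1) by nneg; lra.
lra.
Qed.

Lemma Den_sqr_gt0 hp : 0 < 4 * Den ^+ 2.
Proof. have [n1 mu0 mu1 y00] := hp; by rewrite mulr_gt0 // exprn_gt0 //; have := (Lam_ge hp); have := (Den_ge hp); lra. Qed.

Lemma Den_sqr_ge hp : Den <= Den ^+ 2.
Proof. have [n1 mu0 mu1 y00] := hp; by have := (Lam_ge hp); have := (Den_ge hp); nra. Qed.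

Lemma slope_gt0 hp : 0 < slope.
Proof. have [n1 mu0 mu1 y00] := hp; by rewrite /slope invr_gt0 (Den_sqr_gt0 hp). Qed.

Lemma slope_le hp : slope <= 1 / 4.
Proof. have [n1 mu0 mu1 y00] := hp.
rewrite /slope -div1r ler_pdivrMr ?(Den_sqr_gt0 hp) //.
by have := (Lam_ge hp); have := (Den_ge hp); have := (Den_sqr_ge hp); lra.
Qed.

Lemma bot_gt0 hp : 0 < bot. Proof. have [n1 mu0 mu1 y00] := hp; by rewrite /bot; lra. Qed.

Lemma shift_gt0 hp : 0 < tilt.
Proof. have [n1 mu0 mu1 y00] := hp; by rewrite /tilt mulr_gt0 ?(bot_gt0 hp) ?(slope_gt0 hp). Qed.

Lemma bot'_gt0 hp : 0 < bot'.
Proof. have [n1 mu0 mu1 y00] := hp; by rewrite /bot' divr_gt0 // mulr_gt0 ?exprn_gt0 ?(shift_gt0 hp). Qed.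

Lemma Lam'_ge hp : Lam + 3 <= Lam'.
Proof. have [n1 mu0 mu1 y00] := hp.
rewrite /Lam' /slope invrK.
by have := (Lam_ge hp); have := (Den_ge hp); have := (Den_sqr_ge hp); lra.
Qed.

Lemma nrm_sqr hp x y : Y x y ^+ 2 <= x ^+ 2 + y ^+ 2.
Proof. have [n1 mu0 mu1 y00] := hp.
have -> : x ^+ 2 + y ^+ 2 = (x ^+ 2 + y ^+ 2) * (nx ^+ 2 + ny ^+ 2) by rewrite n1 mulr1.
by have := sqr_ge0 (x * ny - y * nx); rewrite /nrm; nra.
Qed.

Lemma y0_le hp wx wy : wx ^+ 2 + wy ^+ 2 <= mu / 16 -> y0 <= Y wx wy -> y0 <= 1 / 4.
Proof. have [n1 mu0 mu1 y00] := hp; by move=> hw hY; have := (nrm_sqr hp) wx wy; nra. Qed.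

Lemma bot'_le hp wx wy : wx ^+ 2 + wy ^+ 2 <= mu / 16 -> y0 <= Y wx wy ->
  bot' <= bot / 16.
Proof. have [n1 mu0 mu1 y00] := hp.
move=> hw hY; have := y0_le hp hw hY => hy0.
rewrite /bot' /tilt ler_pM2r ?invr_gt0 //.
rewrite -mulrA ger_pMr ?(bot_gt0 hp) //.
by have := (slope_le hp); have := (slope_gt0 hp); nra.
Qed.

(** With [P] the squared distance to the mirror image of [w] and [q] that to [n] (both smoothed),
    everything reduces to [1 / 4 <= q - (1 - mu) * P]. For [S = x ^+ 2 + y ^+ 2] the right side is
    at least [mu / 2 * S - 2 * Y + 13 / 16]. This suffices when [Y <= 1 / 4], and also when a
    coordinate has modulus at least [4 / mu], because then [Y <= sqrt S <= mu * S / 4]. *)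
Lemma psi_ge0 hp e wx wy x y : 0 < e -> e <= 1 ->
  wx ^+ 2 + wy ^+ 2 <= mu / 16 -> y0 <= Y wx wy ->
  `|x| <= Lam -> `|y| <= Lam -> bot <= Y x y ->
  [\/ Y x y <= 1 / 4, 4 / mu <= `|x| | 4 / mu <= `|y|] ->
  0 <= psi e wx wy x y.
Proof. have [n1 mu0 mu1 y00] := hp.
move=> e0 e1 hw hY hx hy hb cases.
have Yw0 : 0 < Y wx wy := lt_le_trans y00 hY.
have Y0 : 0 < Y x y := lt_le_trans (bot_gt0 hp) hb.
pose ux := wx - 2 * Y wx wy * nx; pose uy := wy - 2 * Y wx wy * ny.
have hu : ux ^+ 2 + uy ^+ 2 = wx ^+ 2 + wy ^+ 2.
  rewrite [LHS](_ : _ = wx ^+ 2 + wy ^+ 2 - 4 * Y wx wy ^+ 2 +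
     4 * Y wx wy ^+ 2 * (nx ^+ 2 + ny ^+ 2)); first by rewrite n1; ring.
  by rewrite /ux /uy /nrm; ring.
pose P := (x - ux) ^+ 2 + (y - uy) ^+ 2 + e.
pose q := (x - nx) ^+ 2 + (y - ny) ^+ 2 + e.
have P0 : 0 < P by exact: kk_arg_gt0.
have q0 : 0 < q by exact: kk_arg_gt0.
have g1 : 2 * Y x y / P <= gr e nx ny wx wy x y / Y wx wy.
  rewrite ler_pdivlMr // mulrAC; exact: gr_ge.
have g2 : gr e nx ny nx ny x y <= 2 * Y x y / q.
  apply: le_trans (gr_le _ _ _ _ n1 e0) _.
  by rewrite /q (_ : Y nx ny = 1) ?mulr1 // /nrm -!expr2.
have bnd (a v : R) : `|a| <= Lam -> v ^+ 2 <= 1 -> (a - v) ^+ 2 <= (Lam + 1) ^+ 2.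
  move=> ha hv; have : `|v| <= 1.
    by rewrite -[leRHS]ger0_norm // -ler_sqr ?nnegrE // !real_normK ?num_real // expr1n.
  move: ha; rewrite !ler_norml => /andP[? ?] /andP[? ?].
  by have := (Lam_ge hp); nra.
have PD : P <= Den.
  have ux1 : ux ^+ 2 <= 1 by have := sqr_ge0 uy; move: hu hw mu1; lra0.
  have uy1 : uy ^+ 2 <= 1 by have := sqr_ge0 ux; move: hu hw mu1; lra0.
  by have := bnd x ux hx ux1; have := bnd y uy hy uy1; rewrite /P /Den; move: e1; lra0.
have qD : q <= Den.
  have nx1 : nx ^+ 2 <= 1 by have := sqr_ge0 ny; move: n1; lra0.
  have ny1 : ny ^+ 2 <= 1 by have := sqr_ge0 nx; move: n1; lra0.
  by have := bnd x nx hx nx1; have := bnd y ny hy ny1; rewrite /q /Den; move: e1; lra0.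
have E : 1 / 4 <= q - (1 - mu) * P.
  pose S := x ^+ 2 + y ^+ 2.
  have hP : P <= S * (1 + mu / 2) + 3 / 16 + e.
    (* Completing the square trades the cross term of [P] for [mu / 2 * S] plus [2 / mu] times the
       squared modulus of the image point, which is at most 1/8 since [w] is small compared with
       [sqrt mu]. *)
    have : 0 <= mu / 2 * ((x + 2 / mu * ux) ^+ 2 + (y + 2 / mu * uy) ^+ 2) by nneg.
    have -> : mu / 2 * ((x + 2 / mu * ux) ^+ 2 + (y + 2 / mu * uy) ^+ 2) =
      mu / 2 * S + 2 * (x * ux + y * uy) + 2 / mu * (ux ^+ 2 + uy ^+ 2).
      by rewrite /S; field; exact: lt0r_neq0.
    rewrite hu => h1.
    have h2 : 2 / mu * (wx ^+ 2 + wy ^+ 2) <= 1 / 8.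
      rewrite (_ : 1 / 8 = 2 / mu * (mu / 16)); last by field; exact: lt0r_neq0.
      by rewrite ler_wpM2l // divr_ge0 // ltW.
    have : P = S - 2 * (x * ux + y * uy) + (ux ^+ 2 + uy ^+ 2) + e.
      by rewrite /P /S; ring.
    by rewrite hu; move: h1 h2 hw mu1; lra0.
  have S0 : 0 <= S by apply: addr_ge0; exact: sqr_ge0.
  have hq : q = S - 2 * Y x y + 1 + e.
    rewrite [LHS](_ : _ = S - 2 * Y x y + (nx ^+ 2 + ny ^+ 2) + e); first by rewrite n1.
    by rewrite /q /S /nrm; ring.
  have : (1 - mu) * P <= (1 - mu) * (S * (1 + mu / 2) + 3 / 16 + e).
    by rewrite ler_wpM2l // subr_ge0.
  have : (1 - mu) * (S * (1 + mu / 2) + 3 / 16 + e) <= (1 - mu / 2) * S + 3 / 16 + e.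
    have : 0 <= mu * (3 / 16 + e) by nneg.
    have : 0 <= mu ^+ 2 * S by nneg.
    by nra.
  have muS : 0 <= mu / 2 * S by rewrite mulr_ge0 // divr_ge0 // ltW.
  move=> hS hP'; have big (a : R) : a ^+ 2 <= S -> 4 / mu <= `|a| -> 2 * Y x y <= mu / 2 * S.
    move=> aS ha.
    have : (4 / mu) ^+ 2 <= S.
      apply: le_trans aS; rewrite -[leRHS](real_normK (num_real _)) ler_sqr ?nnegrE //.
      by rewrite divr_ge0 // ltW.
    rewrite expr_div_n ler_pdivrMr ?exprn_gt0 // => hS'.
    rewrite -ler_sqr ?nnegrE; [|by rewrite mulr_ge0 ?ltW|exact: muS].
    by have := (nrm_sqr hp) x y; rewrite -/S; nra.
  have xS : x ^+ 2 <= S by rewrite lerDl sqr_ge0.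
  have yS : y ^+ 2 <= S by rewrite lerDr sqr_ge0.
  case: cases => hc; rewrite hq; first by move: hS hP' muS hc e0; lra0.
    by have := big x xS hc; move: hS hP' e0; lra0.
  by have := big y yS hc; move: hS hP' e0; lra0.
have key : 2 * slope * Y x y <= 2 * Y x y / P - (1 - mu) * (2 * Y x y / q).
  have -> : 2 * Y x y / P - (1 - mu) * (2 * Y x y / q) =
     2 * Y x y * ((q - (1 - mu) * P) / (P * q)) by field; rewrite !gt_eqF.
  rewrite mulrAC ler_wpM2l //; first by lra.
  rewrite ler_pdivlMr ?mulr_gt0 //; apply: le_trans E.
  have PqD : P * q <= Den ^+ 2 by rewrite expr2; apply: ler_pM => //; exact: ltW.
  rewrite /slope mulrC ler_pdivrMr ?(Den_sqr_gt0 hp) //.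
  by move: PqD; lra0.
have g2' : (1 - mu) * gr e nx ny nx ny x y <= (1 - mu) * (2 * Y x y / q).
  by rewrite ler_wpM2l // subr_ge0.
have : tilt <= slope * Y x y by rewrite /tilt mulrC ler_wpM2l // ltW ?(slope_gt0 hp).
by rewrite /psi; move: g1 g2' key; lra0.
Qed.

Lemma psi_le0 hp e wx wy x y : 0 < e ->
  wx ^+ 2 + wy ^+ 2 <= mu / 16 -> y0 <= Y wx wy -> 0 <= Y x y ->
  [\/ Y x y <= 2 * bot', Lam' - 1 <= `|x| | Lam' - 1 <= `|y|] ->
  psi e wx wy x y <= 0.
Proof. have [n1 mu0 mu1 y00] := hp.
move=> e0 hw hY Y0 cases.
have Yw0 : 0 < Y wx wy := lt_le_trans y00 hY.
have hy0 := y0_le hp hw hY.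
pose p := (x - wx) ^+ 2 + (y - wy) ^+ 2 + e.
have p0 : 0 < p by exact: kk_arg_gt0.
have g1 : gr e nx ny wx wy x y / Y wx wy <= 2 * Y x y / p.
  by rewrite ler_pdivrMr // mulrAC; exact: gr_le.
have g2 : 0 <= (1 - mu) * gr e nx ny nx ny x y.
  rewrite mulr_ge0 //; first by lra.
  apply: le_trans (gr_ge _ _ _ _ n1 e0).
  rewrite divr_ge0 ?(ltW (kk_arg_gt0 _ _ _)) //.
  have -> : Y nx ny = 1 by rewrite /nrm -!expr2.
  by rewrite mulr1; lra.
have sl := (slope_gt0 hp); have sh := (shift_gt0 hp); have sl1 := (slope_le hp).
have sY : 0 <= slope * Y x y by nneg.
have far (a v r : R) : (a - v) ^+ 2 <= p -> v ^+ 2 <= 1 -> Lam' - 1 <= `|a| ->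
    2 * Y x y / p <= slope * Y x y.
  move=> hav hv ha.
  have v1 : `|v| <= 1.
    by rewrite -[leRHS]ger0_norm // -ler_sqr ?nnegrE // !real_normK ?num_real // expr1n.
  have h1 : 2 / slope <= `|a - v|.
    by have := ler_normD (a - v) v; rewrite subrK; move: ha; rewrite /Lam'; lra.
  have h2 : 2 / slope <= p.
    apply: le_trans hav; rewrite -[leRHS](real_normK (num_real _)).
    have : 8 <= 2 / slope by rewrite ler_pdivlMr //; lra.
    by nra.
  rewrite ler_pdivrMr // mulrAC [leLHS]mulrC [leLHS]mulrC ler_wpM2r //.
  by rewrite ler_pdivrMr // in h2; rewrite mulrC.
rewrite /psi; case: cases => hc.
- have : 2 * Y x y / p <= tilt.
    have yp : y0 ^+ 2 / 4 <= p.
      have hb : bot' <= bot / 16 by exact: (bot'_le hp hw hY).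
      have : (Y wx wy - Y x y) ^+ 2 <= (x - wx) ^+ 2 + (y - wy) ^+ 2.
        by have := (nrm_sqr hp) (x - wx) (y - wy); rewrite /nrm; nra.
      by move: hb hc; rewrite /p /bot; nra.
    rewrite ler_pdivrMr //.
    have : 2 * (2 * bot') <= tilt * p.
      rewrite /bot'; have : 0 <= tilt * (p - y0 ^+ 2 / 4) by nneg.
      lra.
    lra.
  lra.
- have := far x wx 0 _ _ hc; rewrite /p; have := sqr_ge0 (y - wy); have := sqr_ge0 wy.
  by move=> ? ? /(_ ltac:(lra) ltac:(lra)); lra.
- have := far y wy 0 _ _ hc; rewrite /p; have := sqr_ge0 (x - wx); have := sqr_ge0 wx.
  by move=> ? ? /(_ ltac:(lra) ltac:(lra)); lra.
Qed.

End HarnackTest.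

Section HarnackCore.
Context {R : realType}.
Variables (nx ny mu y0 : R).
Implicit Type hp : harnack_params nx ny mu y0.
Local Notation Y := (nrm nx ny).
Local Notation inQ := (inQ nx ny mu y0).
Local Notation inQ' := (inQ' nx ny mu y0).
Local Notation psi := (psi nx ny mu y0).
Local Notation bot' := (bot' mu y0).
Local Notation Lam' := (Lam' mu).

(** The affine terms drop out. Four charges remain: a negative one at [w], a positive one at [n],
    and opposite ones at the mirror images; the image of [n] is [-n]. *)
Lemma dlap_psi hp e h wx wy x y :
  let ux := wx - 2 * Y wx wy * nx in let uy := wy - 2 * Y wx wy * ny in
  dlap h (psi e wx wy) x y =
  (dlap h (kk e) (x - ux) (y - uy) - dlap h (kk e) (x - wx) (y - wy)) / Y wx wy
  - (1 - mu) * (dlap h (kk e) (x + nx) (y + ny) - dlap h (kk e) (x - nx) (y - ny)).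
Proof.
have [n1 mu0 mu1 y00] := hp => ux uy; rewrite /dlap /psi /gr -/ux -/uy.
have -> : Y nx ny = 1 by rewrite /nrm -!expr2.
have ex (t a : R) : t + h - a = t - a + h by ring.
have ey (t a : R) : t - h - a = t - a - h by ring.
have em (t a : R) : t - (a - 2 * 1 * a) = t + a by ring.
rewrite !ex !ey !em /nrm ![x + nx + _]addrAC ![y + ny + _]addrAC.
by move: (_^-1) => i; ring.
Qed.

(** Crude, of the size of [ln e], but uniform in [w]: the tolerance on the Laplacian of g can be
    fixed before the mesh, hence before [w] is replaced by a lattice point. *)
Lemma psi_bounded hp e : 0 < e -> e <= 1 -> exists2 B, 0 <= B &
  forall wx wy x y, wx ^+ 2 + wy ^+ 2 <= mu / 16 -> y0 <= Y wx wy ->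
    `|x| <= Lam' -> `|y| <= Lam' -> `|psi e wx wy x y| <= B.
Proof.
have [n1 mu0 mu1 y00] := hp => e0 e1.
have sl := slope_gt0 hp; have sh := shift_gt0 hp; have L5 := Lam_ge hp; have L' := Lam'_ge hp.
pose big : R := 2 * (Lam' + 1) ^+ 2 + 1.
pose K : R := `|ln e| + `|ln big|.
have kkK a b : a ^+ 2 <= (Lam' + 1) ^+ 2 -> b ^+ 2 <= (Lam' + 1) ^+ 2 -> `|kk e a b| <= K.
  move=> ha hb; rewrite ler_norml; apply/andP; split.
    apply: (le_trans _ (kk_ge_log (b := e) e0 e0 _)).
      have := ler_norm (- ln e); rewrite normrN /K.
      have := normr_ge0 (ln e); have := normr_ge0 (ln big); lra.
    by have := sqr_ge0 a; have := sqr_ge0 b; lra.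
  apply: le_trans (kk_le_log (B := big) e0 _) _; first by rewrite /big; lra.
  have := ler_norm (ln big); rewrite /K.
  have := normr_ge0 (ln e); have := normr_ge0 (ln big); lra.
exists (2 * K / y0 + 2 * K + slope mu * (2 * Lam') + tilt mu y0).
  have K0 : 0 <= K by rewrite /K; nneg.
  have L0 : 0 <= Lam' by lra.
  by nneg.
move=> wx wy x y hw hY hx hy.
have Yw0 : 0 < Y wx wy := lt_le_trans y00 hY.
have le1 (v : R) : v ^+ 2 <= 1 -> `|v| <= 1.
  by move=> hv; rewrite -[leRHS]ger0_norm // -ler_sqr ?nnegrE // !real_normK ?num_real // expr1n.
have bnd (a v : R) : `|a| <= Lam' -> v ^+ 2 <= 1 -> (a - v) ^+ 2 <= (Lam' + 1) ^+ 2.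
  move=> ha /le1; move: ha; rewrite !ler_norml => /andP[? ?] /andP[? ?].
  by nra.
have hu : (wx - 2 * Y wx wy * nx) ^+ 2 + (wy - 2 * Y wx wy * ny) ^+ 2 = wx ^+ 2 + wy ^+ 2.
  rewrite [LHS](_ : _ = wx ^+ 2 + wy ^+ 2 - 4 * Y wx wy ^+ 2 +
     4 * Y wx wy ^+ 2 * (nx ^+ 2 + ny ^+ 2)); first by rewrite n1; ring.
  by rewrite /nrm; ring.
have grK vx vy : vx ^+ 2 + vy ^+ 2 <= 1 ->
    (vx - 2 * Y vx vy * nx) ^+ 2 + (vy - 2 * Y vx vy * ny) ^+ 2 <= 1 ->
    `|gr e nx ny vx vy x y| <= 2 * K.
  move=> h1 h2; rewrite /gr; apply: le_trans (ler_normB _ _) _.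
  set ux := vx - _ in h2 *; set uy := vy - _ in h2 *.
  have [ux1 uy1 vx1 vy1] : [/\ ux ^+ 2 <= 1, uy ^+ 2 <= 1, vx ^+ 2 <= 1 & vy ^+ 2 <= 1].
    have := sqr_ge0 ux; have := sqr_ge0 uy; have := sqr_ge0 vx; have := sqr_ge0 vy.
    move: (ux ^+ 2) (uy ^+ 2) (vx ^+ 2) (vy ^+ 2) h1 h2 => a1 a2 a3 a4 h1 h2 s1 s2 s3 s4.
    clear -h1 h2 s1 s2 s3 s4.
    by split; lra.
  have k1 := kkK _ _ (bnd _ _ hx ux1) (bnd _ _ hy uy1).
  have k2 := kkK _ _ (bnd _ _ hx vx1) (bnd _ _ hy vy1).
  by rewrite mulr2n mulrDl !mul1r lerD.
have hw1 : wx ^+ 2 + wy ^+ 2 <= 1 by lra.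
have g1 : `|gr e nx ny wx wy x y| <= 2 * K by apply: grK; rewrite ?hu.
have g2 : `|gr e nx ny nx ny x y| <= 2 * K.
  apply: grK; first by rewrite n1.
  have -> : Y nx ny = 1 by rewrite /nrm -!expr2.
  by rewrite (_ : _ + _ = nx ^+ 2 + ny ^+ 2); [rewrite n1 | ring].
rewrite /psi; apply: le_trans (ler_normB _ _) _.
rewrite (gtr0_norm sh) lerD2r; apply: le_trans (ler_normB _ _) _; apply: lerD.
  apply: le_trans (ler_normB _ _) _; apply: lerD.
    rewrite normrM normfV (gtr0_norm Yw0); apply: ler_pM; rewrite ?invr_ge0 ?(ltW Yw0) //.
    by rewrite lef_pV2.
  rewrite normrM; have : `|1 - mu| <= 1 by rewrite ger0_norm; lra.
  by have := normr_ge0 (1 - mu); have := normr_ge0 (gr e nx ny nx ny x y); nra.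
rewrite normrM (gtr0_norm sl) ler_wpM2l ?(ltW sl) // /nrm.
apply: le_trans (ler_normD _ _) _; rewrite !normrM.
have hnx : `|nx| <= 1 by apply: le1; have := sqr_ge0 ny; lra.
have hny : `|ny| <= 1 by apply: le1; have := sqr_ge0 nx; lra.
have := ler_pM (normr_ge0 _) (normr_ge0 _) hx hnx.
have := ler_pM (normr_ge0 _) (normr_ge0 _) hy hny.
lra.
Qed.

End HarnackCore.

Section Index.
Context {R : realType}.

Lemma normr_idx (h : R) (a : int) : 0 < h -> `|h * a%:~R| = h * (`|a|%N)%:R.
Proof.
by move=> h0; rewrite normrM gtr0_norm // natr_absz intr_norm.
Qed.

Lemma idx_le (h : R) (a : int) (N : nat) : 0 < h ->
  `|h * a%:~R| <= h * N%:R -> (`|a| <= N)%N.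
Proof. by move=> h0; rewrite normr_idx // ler_pM2l // ler_nat. Qed.

Lemma idx_ge (h : R) (a : int) (N : nat) : 0 < h ->
  (N <= `|a|)%N -> h * N%:R <= `|h * a%:~R|.
Proof. by move=> h0; rewrite normr_idx // ler_pM2l // ler_nat. Qed.

Lemma lap_lattice (h ox oy : R) f (a b : int) :
  lap (fun a b => f (ox + h * a%:~R) (oy + h * b%:~R)) a b =
  dlap h f (ox + h * a%:~R) (oy + h * b%:~R).
Proof. by rewrite /lap /dlap !(intrB, intrD) !(mulrBr, mulrDr) !mulr1z !mulr1 !addrA. Qed.

Lemma normr_le_sqr (a b : R) : 0 <= b -> a ^+ 2 <= b ^+ 2 -> `|a| <= b.
Proof. by move=> b0 h; rewrite -ler_sqr ?nnegrE // real_normK ?num_real. Qed.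

Lemma normr_lt_sqr (a b : R) : 0 <= b -> a ^+ 2 < b ^+ 2 -> `|a| < b.
Proof. by move=> b0 h; rewrite -ltr_sqr ?nnegrE // real_normK ?num_real. Qed.

End Index.

Section HarnackSum.
Context {R : realType}.
Variables (nx ny mu y0 : R).
Implicit Type hp : harnack_params nx ny mu y0.
Local Notation Y := (nrm nx ny).
Local Notation inQ := (inQ nx ny mu y0).
Local Notation inQ' := (inQ' nx ny mu y0).
Local Notation psi := (psi nx ny mu y0).
Local Notation bot' := (bot' mu y0).
Local Notation bot := (bot y0).
Local Notation Lam' := (Lam' mu).
Local Notation Lam := (Lam mu).

Lemma inQ_sub hp wx wy x y : wx ^+ 2 + wy ^+ 2 <= mu / 16 -> y0 <= Y wx wy ->
  inQ x y -> inQ' x y.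
Proof.
move=> hw hY; have bb := bot'_le hp hw hY; have b0 := bot_gt0 hp; have L' := Lam'_ge hp.
move=> /and3P[q1 q2 q3].
by apply/and3P; split; [move: bb b0 q1 | move: L' q2 | move: L' q3]; lra0.
Qed.

Lemma dlap_collar_psi hp e h wx wy : 0 < e -> e <= 1 -> 0 <= h -> h <= 1 -> 2 * h <= bot' ->
  wx ^+ 2 + wy ^+ 2 <= mu / 16 -> y0 <= Y wx wy -> forall x y,
  [/\ inQ x y -> dlap h (psi e wx wy) x y <= dlap h (collar inQ inQ' (psi e wx wy)) x y,
      inQ' x y -> 0 <= dlap h (collar inQ inQ' (psi e wx wy)) x y \/
        dlap h (psi e wx wy) x y <= dlap h (collar inQ inQ' (psi e wx wy)) x y
    & ~~ inQ' x y -> 0 <= dlap h (collar inQ inQ' (psi e wx wy)) x y].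
Proof.
move=> e0 e1 h0 h1 hb hw hY.
have [n1 _ _ _] := hp.
have y04 := y0_le hp hw hY; have bb := bot'_le hp hw hY; have b0 := bot_gt0 hp.
have b'0 := bot'_gt0 hp; have L5 := Lam_ge hp; have L' := Lam'_ge hp.
have edge (x x' l : R) : `|x - x'| <= h -> l <= `|x'| -> l - 1 <= `|x|.
  move=> a b; have := ler_normB x (x - x'); rewrite opprB addrC subrK.
  by move: a b h1; lra0.
apply: dlap_collar => //; first by move=> x y; exact: (inQ_sub hp hw hY).
- move=> x y x' y' a; have nl := nrm_lip n1 a; case: a => ax ay.
  move=> /and3P[q1 q2 q3] q; apply: (psi_ge0 hp) => //; try exact: ltW.
  have EL : Lam = 4 / mu + 1 by [].
  move: q; rewrite inQE !negb_and -!leNgt => /or3P[q|q|q].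
  + apply: Or31; move: nl; rewrite ler_norml => /andP[_ k].
    by move: k q bb b0 hb y04; rewrite botE; lra0.
  + by apply: Or32; have := edge _ _ _ ax q; rewrite EL addrK.
  + by apply: Or33; have := edge _ _ _ ay q; rewrite EL addrK.
- move=> x y x' y' a; have nl := nrm_lip n1 a; case: a => ax ay.
  move=> /and3P[q1 q2 q3] q; apply: (psi_le0 hp) => //; first exact: le_trans (ltW b'0) (ltW q1).
  move: q; rewrite inQ'E !negb_and -!leNgt => /or3P[q|q|q].
  + apply: Or31; move: nl; rewrite ler_norml => /andP[_ k].
    by move: k q hb; lra0.
  + by apply: Or32; exact: edge ax q.
  + by apply: Or33; exact: edge ay q.
- move=> x y x' y' a; have nl := nrm_lip n1 a; case: a => ax ay.
  move=> /and3P[q1 q2 q3]; apply/and3P; split.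
  + move: nl; rewrite ler_norml => /andP[_ k].
    by move: k q1 hb b0 bb b'0; lra0.
  + by have := ler_normD (x' - x) x; rewrite subrK distrC; move: q2 L' ax h1; lra0.
  + by have := ler_normD (y' - y) y; rewrite subrK distrC; move: q3 L' ay h1; lra0.
Qed.

(** Summation by parts of [g] against the truncated [psi]. On the side where g is differenced,
    near-harmonicity makes the sum small. On the other side, the charges at [w] and [n] evaluate g
    there; the image of [w] has a favourable sign and is dropped; the image [-n] is at distance at
    least 1 from [inQ'], so its smoothed charge contributes a quantity of order [e]. The lattice is
    anchored at [n], and [w] has to be one of its points. *)
Lemma harnack_sum hp e h (N : nat) H (c d : int) (g : R -> R -> R) eta Bg Bp r om wx wy T C :
  wx = nx + h * c%:~R -> wy = ny + h * d%:~R ->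
  T = 22 * Bg * e * (4 * H + 1) ^+ 2 / r ^+ 2 ->
  C = mass e h N.*2 ->
  0 < e -> e <= 1 -> 0 < h -> h <= 1 -> h ^+ 2 <= e -> 2 * h <= bot' ->
  Lam' + 3 <= h * N%:R -> h * N%:R <= H ->
  wx ^+ 2 + wy ^+ 2 <= mu / 16 -> y0 <= Y wx wy ->
  (forall x y, 0 <= g x y) -> 0 <= eta ->
  (forall x y, inQ' x y -> `|dlap h g x y| <= eta * h ^+ 2) ->
  (forall x y, inQ' x y -> g x y <= Bg) -> 0 <= Bg ->
  (forall x y, inQ' x y -> `|psi e wx wy x y| <= Bp) -> 0 <= Bp ->
  0 < r -> r <= (y0 / 2) ^+ 2 -> 0 <= om ->
  (forall x y, (x - wx) ^+ 2 + (y - wy) ^+ 2 < r -> `|g x y - g wx wy| <= om) ->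
  (forall x y, (x - nx) ^+ 2 + (y - ny) ^+ 2 < r -> `|g x y - g nx ny| <= om) ->
  (1 - mu) * (C * (g nx ny - om) - T) <=
  (C * (g wx wy + om) + T) / Y wx wy + (11 * e * Bg + eta * Bp) * (2 * H + 1) ^+ 2.
Proof.
have [n1 mu0 mu1 y00] := hp => ewx ewy eT eC e0 e1 h0 h1 he hb hN hNH hw hY g0 eta0
  harm gB Bg0 psiB Bp0 r0 ry om0 wm nm.
have Yw0 : 0 < Y wx wy := lt_le_trans y00 hY.
have y04 := y0_le hp hw hY.
have bb := bot'_le hp hw hY.
have b'0 := bot'_gt0 hp; have L5 := Lam_ge hp; have L' := Lam'_ge hp.
have sq1 (v w : R) : v ^+ 2 + w ^+ 2 <= 1 -> `|v| <= 1.
  by move=> hv; apply: normr_le_sqr => //; rewrite expr1n; have := sqr_ge0 w; move: hv; lra0.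
have nx1 : `|nx| <= 1 by apply: (sq1 _ ny); rewrite n1.
have ny1 : `|ny| <= 1 by apply: (sq1 _ nx); rewrite [leLHS]addrC n1.
have hw1 : wx ^+ 2 + wy ^+ 2 <= 1 by move: hw mu1; lra0.
have wx1 : `|wx| <= 1 by apply: (sq1 _ wy).
have wy1 : `|wy| <= 1 by apply: (sq1 _ wx); rewrite [leLHS]addrC.
pose pt (f : R -> R -> R) (a b : int) := f (nx + h * a%:~R) (ny + h * b%:~R).
have QQ' x y : inQ x y -> inQ' x y by exact: (inQ_sub hp hw hY).
have hh := ltW h0.
pose P := collar inQ inQ' (psi e wx wy).
have col := dlap_collar_psi hp e0 e1 hh h1 hb hw hY.
rewrite -/P in col.
have big (a : int) (v : R) : (N.-1 < `|a|)%N -> `|v| <= 1 -> Lam' + 2 <= `|v + h * a%:~R|.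
  move=> ha hv; have : h * N%:R <= `|h * a%:~R| by apply: idx_ge => //; move: ha; lia0.
  by have := ler_normB (v + h * a%:~R) v; rewrite addrAC subrr add0r; move: hv hN; lra0.
have outQ' a b : (N.-1 < `|a|)%N || (N.-1 < `|b|)%N ->
    ~~ inQ' (nx + h * a%:~R) (ny + h * b%:~R).
  move=> ab; apply/negP => /and3P[_ q1 q2].
  by case/orP: ab => [/big /(_ nx1)|/big /(_ ny1)]; [move: q1|move: q2]; lra0.
have N0 : (0 < N)%N.
  by rewrite lt0n; apply/eqP => NE; move: hN; rewrite NE mulr0; move: L5 L'; lra0.
have vP : vanish N.-1 (pt P).
  move=> a b /outQ' q; rewrite /pt /P /collar (negbTE q).
  by case: ifPn => // /QQ'; rewrite (negbTE q).
have gr := @green _ (pt P) (pt g) N N0 vP.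
(* Losses (the charges at [w] and at [-n]) are counted over all of [inQ'], the gain at [n] only over
   [inQ]: in the collar just the first of these is certain. *)
pose fQ' (a b : int) := if inQ' (nx + h * a%:~R) (ny + h * b%:~R) then pt g a b else 0.
pose fQ (a b : int) := if inQ (nx + h * a%:~R) (ny + h * b%:~R) then pt g a b else 0.
pose K3 (a b : int) := dlap h (kk e) (nx + h * a%:~R + nx) (ny + h * b%:~R + ny).
have K30 a b : 0 <= K3 a b by exact: dlap_kk_ge0.
have kd0 a b : 0 <= kd e h a b by exact: dlap_kk_ge0.
have fQ0 a b : 0 <= fQ a b by rewrite /fQ; case: ifP => // _; exact: g0.
have fQ'0 a b : 0 <= fQ' a b by rewrite /fQ'; case: ifP => // _; exact: g0.
have pw a b : - ((Y wx wy)^-1 * (fQ' a b * kd e h (a - c) (b - d))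
       + (1 - mu) * (fQ' a b * K3 a b)) + (1 - mu) * (fQ a b * kd e h (a - 0) (b - 0)) <=
    pt g a b * lap (pt P) a b.
  rewrite /pt lap_lattice -/(pt g a b).
  set x := nx + _; set y := ny + _.
  have [c1 c2 c3] := col x y.
  have kw : dlap h (kk e) (x - wx) (y - wy) = kd e h (a - c) (b - d).
    have -> : x - wx = h * (a - c)%:~R by rewrite /x ewx intrB; ring.
    by have -> : y - wy = h * (b - d)%:~R by rewrite /y ewy intrB; ring.
  have kn : dlap h (kk e) (x - nx) (y - ny) = kd e h (a - 0) (b - 0).
    have -> : x - nx = h * (a - 0)%:~R by rewrite /x subr0; ring.
    by have -> : y - ny = h * (b - 0)%:~R by rewrite /y subr0; ring.
  have dp : dlap h (psi e wx wy) x y >= - ((Y wx wy)^-1 * kd e h (a - c) (b - d)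
       + (1 - mu) * K3 a b) + (1 - mu) * kd e h (a - 0) (b - 0).
    rewrite (dlap_psi hp) kw kn -/(K3 a b).
    have : 0 <= dlap h (kk e) (x - (wx - 2 * Y wx wy * nx)) (y - (wy - 2 * Y wx wy * ny))
        / Y wx wy by rewrite divr_ge0 ?dlap_kk_ge0 // ltW.
    lra0.
  have pg : 0 <= pt g a b by exact: g0.
  have m1 : 0 <= 1 - mu by move: mu1; lra0.
  have i0 : 0 <= (Y wx wy)^-1 by rewrite invr_ge0 ltW.
  have A0 := mulr_ge0 i0 (kd0 (a - c) (b - d)); have B0 := mulr_ge0 m1 (K30 a b).
  have C0 := mulr_ge0 m1 (kd0 (a - 0) (b - 0)).
  rewrite /fQ /fQ' -/x -/y; have [q|q] := boolP (inQ x y).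
    rewrite (QQ' _ _ q); have := le_trans dp (c1 q).
    move/(ler_wpM2l pg); lra0.
  have [q'|q'] := boolP (inQ' x y); last first.
    by have := mulr_ge0 pg (c3 q'); rewrite !mul0r; lra0.
  have l0 : - ((Y wx wy)^-1 * kd e h (a - c) (b - d) + (1 - mu) * K3 a b) <= dlap h P x y.
    by case: (c2 q') => [|/(le_trans dp)]; move: A0 B0 C0; lra0.
  by have := ler_wpM2l pg l0; rewrite !mul0r; lra0.
have LE := le_bsum (fun a b (_ : (`|a| <= N)%N) (_ : (`|b| <= N)%N) => pw a b).
rewrite bsumD -[X in bsum N X](_ : (fun a b => -1 * ((Y wx wy)^-1 * (fQ' a b * kd e h (a - c) (b - d))
       + (1 - mu) * (fQ' a b * K3 a b))) = _) in LE; last first.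
  by apply/funext => a; apply/funext => b; rewrite mulN1r.
rewrite bsumZ bsumD !bsumZ mulN1r -gr in LE.
have two : N.*2.+1%:R = 2 * N%:R + 1 :> R by rewrite -addn1 natrD -muln2 natrM; ring.
have area (t : R) : 0 <= t -> bsum N (fun=> fun=> t * h ^+ 2) <= t * (2 * H + 1) ^+ 2.
  move=> t0; rewrite bsum_cst two.
  rewrite [leLHS](_ : _ = t * (h * (2 * N%:R + 1)) ^+ 2); last by ring.
  have hN0 : 0 <= h * N%:R by nneg.
  by rewrite ler_wpM2l // ler_sqr ?nnegrE; move: hNH hN0 h1 hh; lra0.
have UP : bsum N (fun a b => pt P a b * lap (pt g) a b) <= eta * Bp * (2 * H + 1) ^+ 2.
  apply: le_trans (area _ _); last by nneg.
  apply: le_bsum => a b _ _; rewrite {2}/pt lap_lattice.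
  set x := nx + _; set y := ny + _.
  have [q|q] := boolP (inQ' x y); last first.
    rewrite /pt /P /collar -/x -/y (negbTE q); case: ifPn => [/QQ'|_].
      by rewrite (negbTE q).
    by rewrite mul0r; nneg.
  apply: le_trans (ler_norm _) _; rewrite normrM.
  rewrite [leRHS](_ : _ = Bp * (eta * h ^+ 2)); last by ring.
  apply: ler_pM => //; last exact: harm.
  have pb := psiB _ _ q.
  rewrite /pt /P /collar -/x -/y q; case: ifP => _ //.
  by case: (leP (psi e wx wy x y) 0); rewrite ?normr0.
have S3 : bsum N (fun a b => fQ' a b * K3 a b) <= 11 * e * Bg * (2 * H + 1) ^+ 2.
  apply: le_trans (area _ _); last by nneg.
  apply: le_bsum => a b _ _; rewrite /fQ'; case: ifPn => q; last by rewrite mul0r; nneg.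
  rewrite [leRHS](_ : _ = Bg * (11 * (e * h ^+ 2))); last by ring.
  apply: ler_pM => //; first exact: g0; first exact: gB.
  apply: le_trans (dlap_kk_le _ _ e0 he) _.
  have u0 : 0 <= 11 * (e * h ^+ 2) by nneg.
  rewrite -[leRHS]mulr1 ler_wpM2l // invf_le1 ?exprn_gt0 ?kk_arg_gt0 //.
  move: q => /and3P[q _ _].
  set x := nx + _ in q *; set y := ny + _ in q *.
  have : 1 <= (x + nx) ^+ 2 + (y + ny) ^+ 2 + e.
    have : Y (x + nx) (y + ny) ^+ 2 <= (x + nx) ^+ 2 + (y + ny) ^+ 2 by exact: nrm_sqr hp _ _.
    have -> : Y (x + nx) (y + ny) = Y x y + (nx ^+ 2 + ny ^+ 2) by rewrite /nrm; ring.
    rewrite n1 => hs; have q0 : 0 < Y x y := lt_trans b'0 q.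
    by move: hs q0 e0; nra0.
  by move=> ?; rewrite exprn_ege1.
have cN (k : int) (v w : R) : `|v| <= 1 -> `|w| <= 1 -> w = v + h * k%:~R -> (`|k| <= N)%N.
  move=> hv hw1' ew; apply: (@idx_le _ h) => //.
  by have := ler_normB w v; rewrite {1}ew addrAC subrr add0r; move: hv hw1' hN L5 L'; lra0.
have hc : (`|c| <= N)%N by apply: (cN _ nx wx).
have hd : (`|d| <= N)%N by apply: (cN _ ny wy).
have vQ' : vanish N fQ'.
  move=> a b ab; rewrite /fQ' ifN //; apply: outQ'; move: ab; lia0.
have vQ : vanish N fQ.
  move=> a b ab; rewrite /fQ ifN //; apply/negP => /QQ'; apply/negP; apply: outQ'; move: ab; lia0.
have ry1 : r <= 1 by move: ry y04 y00; nra0.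
have near (v v' : R) x : `|v| <= 1 -> (x - v) ^+ 2 + v' ^+ 2 < r -> `|x| < Lam.
  move=> hv hx; have : `|x - v| < 1.
    by apply: normr_lt_sqr => //; rewrite expr1n; have := sqr_ge0 v'; move: hx ry1; lra0.
  by have := ler_normD (x - v) v; rewrite subrK; move: L5 hv; lra0.
have nearQ (v v' : R) x y : `|v| <= 1 -> `|v'| <= 1 -> y0 <= Y v v' ->
    (x - v) ^+ 2 + (y - v') ^+ 2 < r -> inQ x y.
  move=> hv hv' hYv hx; apply/and3P; split; [|exact: near hx|].
    have : `|Y (x - v) (y - v')| < y0 / 2.
      apply: normr_lt_sqr; first by move: y00; lra0.
      by have := nrm_sqr hp (x - v) (y - v'); move: hx ry; lra0.
    have -> : Y (x - v) (y - v') = Y x y - Y v v' by rewrite /nrm; ring.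
    by rewrite ltr_norml botE => /andP[+ _]; move: hYv y00; lra0.
  by apply: (near v' (x - v)) => //; rewrite addrC.
have zN : (`|0 : int| <= N)%N by [].
have ptc : pt g c d = g wx wy by rewrite ewx ewy.
have pt0 : pt g 0 0 = g nx ny by rewrite /pt mulr0 !addr0.
have SW : bsum N (fun a b => fQ' a b * kd e h (a - c) (b - d)) <= C * (g wx wy + om) + T.
  have Qw : inQ wx wy by apply: (nearQ wx wy); rewrite // !subrr expr0n addr0.
  have F0 : fQ' c d = g wx wy by rewrite /fQ' -ewx -ewy (QQ' _ _ Qw) ptc.
  have B1 a b : `|fQ' a b| <= Bg.
    by rewrite ger0_norm // /fQ'; case: ifP => // q; exact: gB.
  have B2 a b : (h * (a - c)%:~R) ^+ 2 + (h * (b - d)%:~R) ^+ 2 < r ->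
      `|fQ' a b - fQ' c d| <= om.
    rewrite !intrB => hab; rewrite F0 /fQ'.
    have hab' : (nx + h * a%:~R - wx) ^+ 2 + (ny + h * b%:~R - wy) ^+ 2 < r.
      by move: hab; rewrite ewx ewy; congr (_ < r); ring.
    by rewrite (QQ' _ _ (nearQ wx wy _ _ wx1 wy1 hY hab')); exact: wm.
  have := approx_id e0 h0 h1 he hNH vQ' hc hd r0 om0 B1 B2.
  rewrite F0 -eC -eT ler_norml => /andP[_]; lra0.
have SN : C * (g nx ny - om) - T <= bsum N (fun a b => fQ a b * kd e h (a - 0) (b - 0)).
  have Y1 : y0 <= Y nx ny by rewrite /nrm -!expr2 n1; move: y04; lra0.
  have Qn : inQ nx ny by apply: (nearQ nx ny); rewrite // !subrr expr0n addr0.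
  have F0 : fQ 0 0 = g nx ny by rewrite /fQ pt0 mulr0 !addr0 Qn.
  have B1 a b : `|fQ a b| <= Bg.
    by rewrite ger0_norm // /fQ; case: ifP => // q; apply/gB/QQ'.
  have B2 a b : (h * (a - 0)%:~R) ^+ 2 + (h * (b - 0)%:~R) ^+ 2 < r ->
      `|fQ a b - fQ 0 0| <= om.
    rewrite !subr0 => hab; rewrite F0 /fQ.
    have hab' : (nx + h * a%:~R - nx) ^+ 2 + (ny + h * b%:~R - ny) ^+ 2 < r.
      by move: hab; congr (_ < r); ring.
    by rewrite (nearQ nx ny _ _ nx1 ny1 Y1 hab'); exact: nm.
  have := approx_id e0 h0 h1 he hNH vQ zN zN r0 om0 B1 B2.
  rewrite F0 -eC -eT ler_norml => /andP[+ _]; lra0.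
have m1 : 0 <= 1 - mu by move: mu1; lra0.
have i0 : 0 <= (Y wx wy)^-1 by rewrite invr_ge0 ltW.
have f1 := ler_wpM2l m1 SN; have f2 := ler_wpM2l i0 SW.
have f3 : (1 - mu) * bsum N (fun a b => fQ' a b * K3 a b) <= 11 * e * Bg * (2 * H + 1) ^+ 2.
  apply: le_trans S3; rewrite -[leRHS]mul1r ler_wpM2r //; last by move: mu0; lra0.
  by apply: bsum_ge0 => a b _ _; rewrite mulr_ge0.
rewrite [X in _ <= X + _]mulrC; move: LE f1 f2 f3 UP; lra0.
Qed.

End HarnackSum.

Section Harnack.
Context {R : realType}.

Lemma lattice_near (h o t : R) : 0 < h -> exists c : int, `|t - (o + h * c%:~R)| <= h.
Proof.
move=> h0; exists (Num.floor ((t - o) / h)).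
have /andP[] := floor_itv ((t - o) / h).
rewrite ler_pdivlMr // ltr_pdivrMr // intrD => h1 h2.
by rewrite ler_norml; apply/andP; split; move: h0 h1 h2; lra0.
Qed.

Lemma fine_mesh (s t : R) : 0 < s -> 0 < t -> exists2 q : nat, (0 < q)%N & s / q%:R < t.
Proof.
move=> s0 t0; have st : 0 <= s / t by rewrite divr_ge0 // ltW.
have b0 := archi_boundP st; exists (Num.bound (s / t)).
  by rewrite -(ltr0n R); exact: le_lt_trans b0.
have q0 : 0 < (Num.bound (s / t))%:R :> R by exact: le_lt_trans b0.
by rewrite ltr_pdivrMr // mulrC -ltr_pdivrMr.
Qed.

Lemma cover_nat (s l : R) : 0 < s -> s <= 1 -> 0 <= l -> exists N : nat, l <= s * N%:R <= l + 1.
Proof.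
move=> s0 s1 l0; exists (`|Num.ceil (l / s)|)%N.
have ls : 0 <= l / s by rewrite divr_ge0 // ltW.
have c0 : 0 <= Num.ceil (l / s) by rewrite ceil_ge0 //; apply: lt_le_trans ls; lra.
rewrite natr_absz ger0_norm //.
have /andP[h1 h2] := ceil_itv (l / s).
rewrite ler_pdivrMr // in h2; rewrite ltr_pdivlMr // intrB in h1.
by apply/andP; split; move: h1 h2 s1; rewrite [_ * s]mulrC; lra0.
Qed.

(** The constant is sharp: [g = nrm nx ny] gives equality up to [mu]. Order of choice: the
    oscillation radius [r], then the smoothing [e], then the bound of [psi], then the tolerance
    [eta], finally the mesh. The hypotheses on [w] are stricter than in [harnack_sum] because [w] is
    first moved to a lattice point. *)
Theorem sharp_harnack (nx ny mu y0 : R) (g : R -> R -> R) (Bg : R) :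
  harnack_params nx ny mu y0 ->
  (forall x y, 0 <= g x y) ->
  (forall e, 0 < e -> exists2 d, 0 < d & forall x y x' y', `|x| <= 2 -> `|y| <= 2 ->
     `|x - x'| < d -> `|y - y'| < d -> `|g x y - g x' y'| <= e) ->
  (forall x y, inQ' nx ny mu y0 x y -> g x y <= Bg) ->
  (forall eta, 0 < eta -> exists2 h0, 0 < h0 & forall h, 0 < h -> h < h0 ->
     forall x y, inQ' nx ny mu y0 x y -> `|dlap h g x y| <= eta * h ^+ 2) ->
  forall wx wy, wx ^+ 2 + wy ^+ 2 <= mu / 64 -> 2 * y0 <= nrm nx ny wx wy ->
  (1 - mu) * g nx ny * nrm nx ny wx wy <= g wx wy.
Proof.
move=> hp g0 gc gB harm wx wy hw hY.
have [n1 mu0 mu1 y00] := hp.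
set Y := nrm nx ny wx wy in hY *.
have Bg0 : 0 <= `|Bg| by [].
have {}gB x y : inQ' nx ny mu y0 x y -> g x y <= `|Bg|.
  by move=> /gB /le_trans; apply; exact: ler_norm.
move: (`|Bg|) Bg0 gB => {}Bg Bg0 gB.
apply/ler_addgt0Pr => om7 om70.
(* Seven errors [om] add up: four in [step2] (three plus [om * Z]), two in [B2] and one in [B1]. *)
pose om := om7 / 7; have om0 : 0 < om by rewrite /om; move: om70; lra0.
have [d d0 hd] := gc om om0.
pose r := Num.min ((y0 / 2) ^+ 2) (d ^+ 2).
have r0 : 0 < r by rewrite lt_min !exprn_gt0 //; move: y00; lra0.
have ry : r <= (y0 / 2) ^+ 2 by rewrite ge_min lexx.
have rd (a b : R) : a ^+ 2 + b ^+ 2 < r -> `|a| < d /\ `|b| < d.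
  move=> h; have : a ^+ 2 + b ^+ 2 < d ^+ 2 by apply: lt_le_trans h _; rewrite ge_min lexx orbT.
  move=> h'; have := sqr_ge0 a; have := sqr_ge0 b => a2 b2.
  by split; apply: normr_lt_sqr; rewrite ?(ltW d0) //; move: h' a2 b2; lra0.
have L5 := Lam_ge hp; have L' := Lam'_ge hp; have b'0 := bot'_gt0 hp.
pose H := Lam' mu + 4.
have H0 : 0 <= H by rewrite /H; move: L5 L'; lra0.
pose K1 := 22 * Bg * (4 * H + 1) ^+ 2 / r ^+ 2 + 11 * Bg * (2 * H + 1) ^+ 2.
have K10 : 0 <= K1 by rewrite /K1; have := ltW r0 => ?; nneg.
pose s := Num.min 1 (om / (6 * (K1 + 1))).
have s0 : 0 < s by rewrite lt_min ltr01 divr_gt0 //; move: K10; lra0.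
have s1 : s <= 1 by rewrite ge_min lexx.
have sK : K1 * s ^+ 2 <= om / 6.
  have : s <= om / (6 * (K1 + 1)) by rewrite ge_min lexx orbT.
  rewrite ler_pdivlMr; last by move: K10; lra0.
  have : s ^+ 2 <= s by rewrite expr2 ger_pMr.
  by move: K10 s0; nra0.
pose e := s ^+ 2.
have e0 : 0 < e by rewrite exprn_gt0.
have e1 : e <= 1 by rewrite expr_le1 // ltW.
have [Bp Bp0 pB] := psi_bounded hp e0 e1.
pose eta := om / (6 * (Bp + 1) * (2 * H + 1) ^+ 2).
have eta0 : 0 < eta.
  rewrite divr_gt0 // mulr_gt0 ?exprn_gt0 //; first by move: Bp0; lra0.
  by move: H0; lra0.
have etaB : eta * Bp * (2 * H + 1) ^+ 2 <= om / 6.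
  have H1 : 2 * H + 1 != 0 by apply/eqP; move: H0; lra0.
  have Bp1 : Bp + 1 != 0 by apply/eqP; move: Bp0; lra0.
  have -> : eta * Bp * (2 * H + 1) ^+ 2 = om / 6 * (Bp / (Bp + 1)) by rewrite /eta; field; rewrite Bp1.
  rewrite -[leRHS]mulr1 ler_wpM2l //; first by rewrite divr_ge0 // ltW.
  by rewrite ler_pdivrMr; move: Bp0; lra0.
have [h0 h00 hh] := harm eta eta0.
pose G := g nx ny.
pose t := Num.min (Num.min h0 d) (Num.min (Num.min (bot' mu y0 / 2) (mu / 16))
   (Num.min (y0 / 2) (om / (2 * (G + 1))))).
have G0 : 0 <= G by exact: g0.
have t0 : 0 < t.
  have G1 : 0 < 2 * (G + 1) by move: G0; lra0.
  have bh : 0 < bot' mu y0 / 2 by apply: divr_gt0.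
  by rewrite !lt_min h00 d0 bh /= !divr_gt0.
have [q q0 hq] := fine_mesh s0 t0.
pose h := s / q%:R.
rewrite -/h !lt_min in hq.
case/andP: hq => /andP[hq1 hq2] /andP[/andP[hq3 hq4] /andP[hq5 hq6]].
have q1 : 1 <= q%:R :> R by rewrite ler1n.
have hpos : 0 < h by rewrite divr_gt0 // ltr0n.
have hs : h <= s by rewrite ler_pdivrMr ?ltr0n // ler_peMr // ltW.
have h1 : h <= 1 by exact: le_trans s1.
have he : h ^+ 2 <= e by rewrite ler_sqr ?nnegrE // ltW.
have l0 : 0 <= Lam' mu + 3 by move: L5 L'; lra0.
have [N /andP[N1 N2]] := cover_nat hpos h1 l0.
have [c hc] := lattice_near nx wx hpos; have [k hk] := lattice_near ny wy hpos.
pose vx := nx + h * c%:~R; pose vy := ny + h * k%:~R.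
rewrite -/vx -/vy in hc hk.
have sq2 (a b : R) : `|a - b| <= h -> b ^+ 2 <= 2 * a ^+ 2 + 2 * h ^+ 2.
  rewrite ler_norml => /andP[u1 u2].
  have p : 0 <= (h - (a - b)) * (h + (a - b)) by rewrite mulr_ge0 //; move: u1 u2; lra0.
  by have := sqr_ge0 (2 * a - b); move: p; lra0.
have hv : vx ^+ 2 + vy ^+ 2 <= mu / 16.
  have := sq2 _ _ hc; have := sq2 _ _ hk.
  have : h ^+ 2 <= mu / 256.
    have : h * h <= mu / 16 * (1 / 16) by apply: ler_pM; move: hq4 mu1 hpos; lra0.
    by rewrite -expr2; lra0.
  by move: hw mu0; lra0.
have hYv := nrm_lip n1 (conj hc hk).
rewrite -/Y in hYv.
set Z := nrm nx ny vx vy in hYv.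
have yZ : y0 <= Z by move: hYv hq5 hY; rewrite ler_norml => /andP[_]; lra0.
have Z1 : Z <= 1.
  have := nrm_sqr hp vx vy; rewrite -/Z; move: hv mu1 yZ y00; nra0.
have w2 : `|wx| <= 2 /\ `|wy| <= 2.
  have := sqr_ge0 wx; have := sqr_ge0 wy => a2 b2.
  by split; apply: normr_le_sqr => //; move: a2 b2 hw mu1; lra0.
have v1 : `|vx| <= 1 /\ `|vy| <= 1.
  have := sqr_ge0 vx; have := sqr_ge0 vy => a2 b2.
  by split; apply: normr_le_sqr => //; rewrite expr1n; move: a2 b2 hv mu1; lra0.
have n2 : `|nx| <= 1 /\ `|ny| <= 1.
  have := sqr_ge0 nx; have := sqr_ge0 ny => a2 b2.
  by split; apply: normr_le_sqr => //; rewrite expr1n; move: a2 b2 n1; lra0.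
have gv : `|g wx wy - g vx vy| <= om.
  by case: w2 => ? ?; apply: hd => //; [exact: le_lt_trans hc _|exact: le_lt_trans hk _].
have le12 (a : R) : `|a| <= 1 -> `|a| <= 2 by lra0.
have near (ax ay : R) : `|ax| <= 1 /\ `|ay| <= 1 -> forall x y,
   (x - ax) ^+ 2 + (y - ay) ^+ 2 < r -> `|g x y - g ax ay| <= om.
  move=> [/le12 a1 /le12 a2] x y /rd[b1 b2]; rewrite distrC; apply: hd => //; by rewrite distrC.
have core := @harnack_sum _ _ _ _ _ hp e h N H c k g eta Bg Bp r om vx vy _ _
  erefl erefl erefl erefl e0 e1 hpos h1 he.
have {core} := core ltac:(move: hq3; lra0) N1 ltac:(rewrite /H; move: N2; lra0) hv yZ g0
  (ltW eta0) (hh h hpos hq1) gB Bg0 _ Bp0 r0 ry (ltW om0) (near _ _ v1) (near _ _ n2).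
have pB' x y : inQ' nx ny mu y0 x y -> `|psi nx ny mu y0 e vx vy x y| <= Bp.
  by move=> /and3P[_ ? ?]; apply: pB => //; exact: ltW.
move=> /(_ pB').
rewrite -/Z -/G; set C := mass _ _ _; set T := (_ / r ^+ 2) => core.
have C3 : 3^-1 <= C.
  apply: mass_ge => //; rewrite -(ler_nat R) -(ler_pM2l hpos).
  have -> : h * q%:R = s by rewrite /h divfK // pnatr_eq0 -lt0n.
  rewrite -muln2 natrM mulrA; move: s1 N1 l0 L5 L'; lra0.
have T3 : T <= om / 6.
  apply: le_trans sK; rewrite /K1 mulrDl /T -/e.
  have : 0 <= 11 * Bg * (2 * H + 1) ^+ 2 * e by have := ltW e0 => ?; nneg.
  have -> : 22 * Bg * e * (4 * H + 1) ^+ 2 / r ^+ 2 =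
    22 * Bg * (4 * H + 1) ^+ 2 / r ^+ 2 * e by ring.
  by lra0.
have S3 : (11 * e * Bg + eta * Bp) * (2 * H + 1) ^+ 2 <= om / 3.
  have : 11 * e * Bg * (2 * H + 1) ^+ 2 <= om / 6.
    apply: le_trans sK; rewrite /K1 mulrDl -/e.
    have : 0 <= 22 * Bg * (4 * H + 1) ^+ 2 / r ^+ 2 * e.
      by have := ltW e0; have := ltW r0 => ? ?; nneg.
    by lra0.
  by move: etaB; lra0.
have Z0 : 0 < Z := lt_le_trans y00 yZ.
have iZ : 0 < Z^-1 by rewrite invr_gt0.
have gvv : g vx vy <= g wx wy + om by move: gv; rewrite ler_norml => /andP[+ _]; lra0.
have step : (1 - mu) * (G - 2 * om) <= (g wx wy + 3 * om) / Z + om.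
  have C0 : 0 < C by apply: lt_le_trans C3; rewrite invr_gt0.
  rewrite -(ler_pM2l C0).
  have TC : T <= om * C by move: T3 C3 om0; nra0.
  have SC : om / 3 <= om * C by move: C3 om0; nra0.
  have A1 : (1 - mu) * (C * (G - om) - om * C) <= (1 - mu) * (C * (G - om) - T).
    by rewrite ler_wpM2l //; [move: mu1|move: TC]; lra0.
  have A2 : (C * (g vx vy + om) + T) / Z <= (C * (g wx wy + 2 * om) + om * C) / Z.
    rewrite ler_wpM2r ?(ltW iZ) //.
    have : C * (g vx vy + om) <= C * (g wx wy + 2 * om).
      by rewrite ler_wpM2l ?(ltW C0) //; move: gvv; lra0.
    by move: TC; lra0.
  by move: core A1 A2 S3 SC; move: (Z^-1) => i; lra0.
have step2 : (1 - mu) * (G - 2 * om) * Z <= g wx wy + 3 * om + om * Z.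
  have := ler_wpM2r (ltW Z0) step; rewrite [leRHS]mulrDl divfK ?gt_eqF //.
have hG : 2 * h * G <= om.
  move: hq6; rewrite ltr_pdivlMr; last by move: G0; lra0.
  by move: hpos; lra0.
have Zlow : Y - 2 * h <= Z by move: hYv; rewrite ler_norml => /andP[_]; lra0.
have B1 : (1 - mu) * G * (Y - Z) <= om.
  have uG : (1 - mu) * G <= G by rewrite -[leRHS]mul1r ler_wpM2r //; move: mu0; lra0.
  have u0 : 0 <= (1 - mu) * G by rewrite mulr_ge0 //; move: mu1; lra0.
  have YZ : Y - Z <= 2 * h by move: Zlow; lra0.
  have h2 : 0 <= 2 * h by move: hpos; lra0.
  have := ler_wpM2l u0 YZ; have := ler_wpM2r h2 uG; move: hG; lra0.
have B2 : (1 - mu) * (2 * om) * Z <= 2 * om.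
  have uz : (1 - mu) * Z <= 1.
    by apply: mulr_ile1; rewrite ?(ltW Z0) //; move: mu0 mu1; lra0.
  rewrite mulrAC -[leRHS]mul1r ler_wpM2r //; move: om0; lra0.
have B3 : om * Z <= om by rewrite ler_piMr // ltW.
have -> : om7 = 7 * om by rewrite /om; field.
by rewrite -/G; move: step2 B1 B2 B3; lra0.
Qed.

End Harnack.

(** * Gluing subharmonic functions *)

Section KernelBounds.
Context {R : realType}.
Implicit Types (e x y t : R).

(** At horizontal distance at least 1 from the pole the variation is controlled independently of
    [e], unlike in [kk_lip]. This serves for the remote pole of [far]. *)
Lemma kk_var e x y dx dy t : 0 < e -> 1 <= `|x| -> `|dx| <= t -> `|dy| <= t ->
  t <= 1 / 12 -> `|kk e (x + dx) (y + dy) - kk e x y| <= 6 * t.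
Proof.
move=> e0 x1 hx hy t1; have t0 : 0 <= t := le_trans (normr_ge0 _) hx.
rewrite /kk; set A := x ^+ 2 + _ + e; set A' := (x + dx) ^+ 2 + _ + e.
have A0 : 0 < A by exact: kk_arg_gt0.
have A'0 : 0 < A' by exact: kk_arg_gt0.
have x2 : `|x| <= x ^+ 2 by rewrite -[leRHS](real_normK (num_real _)) expr2 ler_peMl.
have xA : x ^+ 2 + y ^+ 2 <= A by rewrite lerDl ltW.
have y2 := sqr_ge0 y.
have A1 : 1 <= A by move: x1 x2 xA y2; lra0.
have bx : `|2 * x * dx| <= 2 * (x ^+ 2) * t.
  have := ler_pM (normr_ge0 x) (normr_ge0 dx) x2 hx.
  by rewrite !normrM (ger0_norm (ler0n _ 2)); lra0.
have by_ : `|2 * y * dy| <= (1 + y ^+ 2) * t.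
  rewrite normrM; apply: ler_pM => //; rewrite normrM (ger0_norm (ler0n _ 2)).
  by have := sqr_ge0 (`|y| - 1); rewrite sqrrB real_normK ?num_real //; lra0.
have sq (d : R) : `|d| <= t -> d ^+ 2 <= t / 12.
  move=> hd; rewrite -[leLHS](real_normK (num_real _)) expr2.
  by apply: le_trans (ler_pM _ _ hd hd) _ => //; rewrite ler_wpM2l //; move: t1; lra0.
have dA : `|A' - A| <= 5 * t * A.
  have -> : A' - A = 2 * x * dx + 2 * y * dy + (dx ^+ 2 + dy ^+ 2) by rewrite /A /A'; ring.
  apply: le_trans (ler_normD _ _) _.
  have := ler_normD (2 * x * dx) (2 * y * dy).
  rewrite (ger0_norm (addr_ge0 (sqr_ge0 dx) (sqr_ge0 dy))).
  have p1 : x ^+ 2 * t + y ^+ 2 * t <= A * t by rewrite -mulrDl ler_wpM2r.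
  have p2 : t <= A * t by rewrite ler_peMl.
  have p3 : 0 <= x ^+ 2 * t by rewrite mulr_ge0 ?sqr_ge0.
  have p4 : 0 <= y ^+ 2 * t by rewrite mulr_ge0 ?sqr_ge0.
  by move: (sq _ hx) (sq _ hy) bx by_ p1 p2 p3 p4 t0; lra0.
have A'2 : A / 2 <= A'.
  have : 5 * t * A <= A / 2.
    by rewrite mulrC ler_wpM2l ?(ltW A0) //; move: t1; lra0.
  by move: dA; rewrite ler_norml => /andP[+ _]; lra0.
rewrite -mulrBl normrM (ger0_norm (x := 2^-1)) ?invr_ge0 // ler_pdivrMr //.
rewrite ler_norml; apply/andP; split.
  rewrite lerNl opprB; apply: le_trans (lnB_le A0 A'0) _.
  rewrite ler_pdivrMr //; have : A - A' <= 5 * t * A.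
    by move: dA; rewrite ler_norml => /andP[+ _]; lra0.
  move=> /le_trans; apply.
  have := ler_wpM2l t0 A'2.
  by have := mulr_ge0 t0 (ltW A'0); lra0.
apply: le_trans (lnB_le A'0 A0) _.
rewrite ler_pdivrMr //; move: dA; rewrite ler_norml => /andP[_ /le_trans]; apply.
by have := mulr_ge0 t0 (ltW A0); lra0.
Qed.

Lemma kk_bound e x y (D : R) : 0 < e -> e <= 1 -> `|x| <= D -> `|y| <= D ->
  `|kk e x y| <= `|ln e| + `|ln (2 * D ^+ 2 + 1)|.
Proof.
move=> e0 e1 hx hy.
have sq (a : R) : `|a| <= D -> a ^+ 2 <= D ^+ 2.
  by move=> ha; rewrite -[leLHS](real_normK (num_real _)) ler_sqr ?nnegrE // (le_trans _ ha).
have := sq _ hx; have := sq _ hy; have := sqr_ge0 x; have := sqr_ge0 y => x0 y0 yD xD.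
have n1 := normr_ge0 (ln e); have n2 := normr_ge0 (ln (2 * D ^+ 2 + 1)).
rewrite ler_norml; apply/andP; split.
  apply: (le_trans _ (kk_ge_log (b := e) e0 e0 _)); last by move: x0 y0; lra0.
  by have := ler_norm (- ln e); rewrite normrN; move: n1 n2; lra0.
apply: le_trans (kk_le_log (B := 2 * D ^+ 2 + 1) e0 _) _.
  by move: xD yD e1; lra0.
by have := ler_norm (ln (2 * D ^+ 2 + 1)); move: n1 n2; lra0.
Qed.

(** The kernel at scale [s] reaches the size of [ln (s ^+ 2)], while the tail in [approx_id] carries
    the factor [s ^+ 2]; the product still tends to 0. *)
Lemma sqr_ln_le (s : R) : 0 < s -> s <= 1 -> s ^+ 2 * `|ln (s ^+ 2)| <= 2 * s.
Proof.
move=> s0 s1; have l0 : ln (s ^+ 2) <= 0 by rewrite ln_le0 // expr_le1 // ltW.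
have is0 : 0 < s^-1 by rewrite invr_gt0.
rewrite ler0_norm // lnXn // mulr2n.
have h : - ln s <= s^-1 by rewrite -lnV ?posrE // ltW // ln_sublinear.
have := ler_wpM2l (sqr_ge0 s) h.
have -> : s ^+ 2 * s^-1 = s by field; rewrite gt_eqF.
by lra0.
Qed.

Definition glue (D : R -> R -> bool) (a b : R -> R -> R) x y :=
  if D x y then Num.max (a x y) (b x y) else b x y.

(** The edge condition says that [b] has taken over before [a] is dropped, so the glued function
    dominates at the neighbours whichever branch is active at the centre. *)
Lemma dlap_glue (h : R) (D : R -> R -> bool) (a b : R -> R -> R) : 0 <= h ->
  (forall x y x' y', adj h x y x' y' -> D x y -> ~~ D x' y' -> a x y <= b x y) ->
  forall x y, [/\ D x y, b x y <= a x y & dlap h a x y <= dlap h (glue D a b) x y]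
    \/ dlap h b x y <= dlap h (glue D a b) x y.
Proof.
move=> h0 edge x y.
have geb : glue D a b x y = b x y -> dlap h b x y <= dlap h (glue D a b) x y.
  move=> e; apply: le_dlap => // x' y' _; rewrite /glue; case: ifP => // _.
  by rewrite le_max lexx orbT.
have [d|nd] := boolP (D x y); last by right; apply: geb; rewrite /glue (negbTE nd).
have [ab|ba] := leP (a x y) (b x y).
  by right; apply: geb; rewrite /glue d max_r.
left; split; [by []|exact: ltW|].
apply: le_dlap => //; first by rewrite /glue d max_l // ltW.
move=> x' y' A; rewrite /glue; case: ifPn => [_|nd]; first by rewrite le_max lexx.
by have := edge _ _ _ _ A d nd; rewrite leNgt ba.
Qed.

Lemma max_near (a b a' b' w : R) : `|a - a'| <= w -> `|b - b'| <= w ->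
  `|Num.max a b - Num.max a' b'| <= w.
Proof.
move=> h1 h2; move: h1 h2; rewrite !ler_norml => /andP[h1 h2] /andP[h3 h4].
apply/andP; split; case: (leP a b) => h5; case: (leP a' b') => h6;
  by move: h1 h2 h3 h4 h5 h6; lra0.
Qed.

End KernelBounds.

Section Subharmonic.
Context {R : realType}.
Implicit Types (x y h e s P B tau delta kappa rho M : R) (g hq : R -> R -> R).

Definition box rho x y := (`|x| < rho) && (`|y| < rho).

Definition ucont_on rho g := forall w, 0 < w -> exists2 d, 0 < d &
  forall x y x' y', `|x| <= rho -> `|y| <= rho -> `|x - x'| < d -> `|y - y'| < d ->
    `|g x y - g x' y'| <= w.

(** Where the first branch is active g is bounded below, hence the point is away from K and g is
    harmonic up to [eta * h ^+ 2]. The paraboloid, of Laplacian [4 * s * h ^+ 2], absorbs this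
    defect. Near K the constant takes over, so nothing is asked of g there. *)
Definition mid g s delta x y := Num.max (g x y + s * (x ^+ 2 + y ^+ 2) - delta) (- (delta / 2)).

Definition uloc g hq r s delta := glue (box r) hq (mid g s delta).

(** A single logarithm that grows slightly faster than g. Replacing g by it at a distance makes the
    Riesz measure explicit there, of total weight [1 + tau]. Its pole [(P, 0)] lies outside the
    region of interest, where [B] pushes it below [mid]. *)
Definition far e P tau B x y := (1 + tau) * kk e (x - P) y - B.

Definition ug g hq r s delta R2 e P tau B :=
  glue (box r) hq (glue (box R2) (mid g s delta) (far e P tau B)).

(* Guarantees that the glued maximum of hq and mid equals mid near the edge of the
   box, hence is subharmonic across it. *)
Definition barrier g hq r kappa := forall x y, `|x| < r -> `|y| < r ->
  (r / 2 <= `|x|) || (r / 2 <= `|y|) -> hq x y <= - kappa \/ hq x y <= g x y - kappa.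

Lemma sqr_le_norm (a b : R) : `|a| <= b -> a ^+ 2 <= b ^+ 2.
Proof.
by move=> ab; rewrite -[leLHS](real_normK (num_real _)) ler_sqr ?nnegrE // (le_trans _ ab).
Qed.

Lemma le_norm_sqr (a b : R) : 0 <= b -> b <= `|a| -> b ^+ 2 <= a ^+ 2.
Proof. by move=> b0 ab; rewrite -[leRHS](real_normK (num_real _)) ler_sqr ?nnegrE. Qed.

Lemma far_field g M r1 R0 tau delta : 0 < tau -> tau <= 1 -> 0 < delta -> delta <= 1 ->
  0 <= R0 -> (forall x y, 0 <= g x y) ->
  (forall x y, r1 <= x ^+ 2 + y ^+ 2 -> g x y <= ln (x ^+ 2 + y ^+ 2) / 2 + M) ->
  exists P : nat, exists B R2 s : R,
  [/\ R0 + 2 <= P%:R, R0 + 2 <= R2, 0 < s & s * (2 * R2 ^+ 2) <= delta / 8] /\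
  forall e, 0 < e -> e <= 1 ->
   (forall x y, `|x| <= R0 + 1 -> `|y| <= R0 + 1 -> far e P%:R tau B x y <= - (delta / 2)) /\
   (forall x y, (R2 - 1 <= `|x|) || (R2 - 1 <= `|y|) ->
       g x y <= far e P%:R tau B x y).
Proof.
move=> tau0 tau1 d0 d1 R00 g0 gg.
have [P hP] : exists P : nat, R0 + 2 <= P%:R.
  by exists (Num.bound (R0 + 2)); apply/ltW/archi_boundP; move: R00; lra0.
pose S := 2 * (R0 + 1 + P%:R) ^+ 2 + 1.
pose B := (1 + tau) * `|ln S| + 1.
have B0 : 1 <= B by rewrite lerDr mulr_ge0 // addr_ge0 // ltW.
(* Once the squared modulus exceeds [Ex], the excess [tau / 2] times its logarithm pays for [M], for
   [B] and for the displacement of the pole. *)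
pose Ex := expR (2 * (`|M| + B + 3) / tau).
have Ex1 : 1 <= Ex by rewrite -expR0 ler_expR divr_ge0 ?(ltW tau0) //; have := normr_ge0 M; move: B0; lra0.
pose R2 := 2 * P%:R + `|r1| + Ex + R0 + 2.
have P0 : 0 <= P%:R :> R by [].
have n1 := normr_ge0 r1.
have R21 : 1 <= R2 by rewrite /R2; move: Ex1 P0 n1 R00; lra0.
exists P, B, R2, (delta / 16 / R2 ^+ 2).
have R2sq : 0 < R2 ^+ 2 by rewrite exprn_gt0 //; apply: lt_le_trans R21.
split; first split => //.
- by rewrite /R2; move: Ex1 P0 n1; lra0.
- by rewrite !divr_gt0.
- by rewrite le_eqVlt; apply/orP; left; apply/eqP; field; rewrite gt_eqF // (lt_le_trans _ R21).
move=> e e0 e1; split=> x y.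
  move=> hx hy; rewrite /far.
  have S0 : x - P%:R ^+ 1 = x - P%:R by rewrite expr1.
  have : kk e (x - P%:R) y <= `|ln S| / 2.
    apply: (le_trans (kk_le_log (B := S) e0 _)); last first.
      by rewrite ler_pM2r ?invr_gt0 // ler_norm.
    have h1 : (x - P%:R) ^+ 2 <= (R0 + 1 + P%:R) ^+ 2.
      apply: sqr_le_norm; apply: le_trans (ler_normB _ _) _.
      by rewrite (ger0_norm P0) lerD2r.
    have h2 : y ^+ 2 <= (R0 + 1 + P%:R) ^+ 2.
      by apply: sqr_le_norm; apply: le_trans hy _; rewrite lerDl.
    by rewrite /S; move: h1 h2 e1; lra0.
  move=> hk; have t1 : 0 <= 1 + tau by move: tau0; lra0.
  have := ler_wpM2l t1 hk; rewrite /B; have := mulr_ge0 t1 (normr_ge0 (ln S)).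
  by move: d1; lra0.
move=> hR.
set Z := x ^+ 2 + y ^+ 2.
have ZR : (R2 - 1) ^+ 2 <= Z.
  have R20 : 0 <= R2 - 1 by move: R21; lra0.
  have := sqr_ge0 x; have := sqr_ge0 y; rewrite /Z.
  by case/orP: hR => /(le_norm_sqr R20); lra0.
have E : R2 - 1 = 2 * P%:R + `|r1| + Ex + R0 + 1 by rewrite /R2; ring.
have Q1 : R2 - 1 <= (R2 - 1) ^+ 2.
  by rewrite expr2 ler_peMl // E; move: Ex1 P0 n1 R00; lra0.
have Zr : r1 <= Z.
  apply: le_trans ZR; apply: le_trans Q1; rewrite E.
  by have := ler_norm r1; move: Ex1 P0 R00; lra0.
have ZE : Ex <= Z by apply: le_trans ZR; apply: le_trans Q1; rewrite E; move: P0 R00 n1; lra0.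
have Z0 : 0 < Z by apply: lt_le_trans ZE; exact: expR_gt0.
have ZP : (2 * P%:R) ^+ 2 <= Z.
  have P2 : 0 <= 2 * P%:R :> R by move: P0; lra0.
  apply: le_trans ZR; rewrite E ler_sqr ?nnegrE //; move: Ex1 P0 R00 n1; lra0.
apply: le_trans (gg _ _ Zr) _; rewrite -/Z /far.
have lnZ : 2 * (`|M| + B + 3) / tau <= ln Z.
  by rewrite -[leLHS]expRK ler_ln // posrE // expR_gt0.
have lk : ln Z / 2 - 1 <= kk e (x - P%:R) y.
  have Z40 : 0 < Z / 4 by rewrite divr_gt0.
  have low : Z / 4 <= (x - P%:R) ^+ 2 + y ^+ 2 + e.
    have := sqr_ge0 (x - 2 * P%:R); have := sqr_ge0 y; move: ZP e0; rewrite /Z.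
    by rewrite !exprMn; lra0.
  apply: le_trans (kk_ge_log e0 Z40 low).
  rewrite ln_div ?posrE //.
  have : ln 4 <= 2 :> R.
    have e4 : (4 : R) = 2 ^+ 2 by ring.
    by rewrite e4 lnXn // mulr2n; have := @le_ln1Dx R 1; rewrite (_ : 1 + 1 = 2) // => h; have := h ltac:(lra0); lra0.
  by lra0.
have t1 : 0 <= 1 + tau by move: tau0; lra0.
have := ler_wpM2l t1 lk.
rewrite ler_pdivrMr // in lnZ.
by have := ler_norm M; move: lnZ tau1 tau0; lra0.
Qed.

Lemma mid_ge g s delta x y : 0 <= s -> g x y - delta <= mid g s delta x y /\
  - (delta / 2) <= mid g s delta x y.
Proof.
move=> s0; rewrite /mid !le_max lexx orbT; split=> //.
have : 0 <= s * (x ^+ 2 + y ^+ 2) by rewrite mulr_ge0 // addr_ge0 ?sqr_ge0.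
by move=> h; apply/orP; left; move: h; lra0.
Qed.

Lemma barrier_mid g hq r kappa s delta x y : barrier g hq r kappa ->
  0 <= s -> 0 < delta -> delta <= kappa ->
  `|x| < r -> `|y| < r -> (r / 2 <= `|x|) || (r / 2 <= `|y|) -> hq x y <= mid g s delta x y.
Proof.
move=> br s0 d0 dk hx hy hr; have [m1 m2] := mid_ge g delta x y s0.
by case: (br x y hx hy hr); move: m1 m2 d0 dk; lra0.
Qed.

Lemma edge_box h rho x y x' y' : adj h x y x' y' -> ~~ box rho x' y' ->
  (rho - h <= `|x|) || (rho - h <= `|y|).
Proof.
move=> [a1 a2]; rewrite /box negb_and -!leNgt => /orP[b|b]; apply/orP; [left|right].
  by have := ler_normB x (x - x'); rewrite opprB addrC subrK; move: a1 b; lra0.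
by have := ler_normB y (y - y'); rewrite opprB addrC subrK; move: a2 b; lra0.
Qed.

(** Two gluings, each with the outer function on top near the edge: [far] beats [mid] at the edge of
    the box of half-width [R2], and by [barrier] [mid] beats [hq] at that of half-width [r]. The
    threshold on [h] does not depend on [e]. *)
Lemma ug_subharmonic g hq r kappa s delta R0 R2 P tau B :
  barrier g hq r kappa -> 0 < s -> 0 < delta -> delta <= kappa -> 0 < r -> r <= R0 ->
  R0 + 2 <= R2 -> s * (2 * R2 ^+ 2) <= delta / 8 -> 0 < tau ->
  (forall x y, 0 <= g x y) ->
  (forall h x y, dlap h hq x y = 0) ->
  (forall rho d eta, 0 < d -> 0 < eta -> exists2 h0, 0 < h0 & forall h, 0 < h -> h < h0 ->
     forall x y, `|x| <= rho -> `|y| <= rho -> d <= g x y -> `|dlap h g x y| <= eta * h ^+ 2) ->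
  exists2 h0, 0 < h0 & forall h e, 0 < h -> h < h0 -> 0 < e -> h ^+ 2 <= e ->
   (forall x y, (R2 - 1 <= `|x|) || (R2 - 1 <= `|y|) -> g x y <= far e P tau B x y) ->
   forall x y, 0 <= dlap h (ug g hq r s delta R2 e P tau B) x y.
Proof.
move=> br s0 d0 dk r0 rR R2R sR tau0 g0 hq0 gh.
have d4 : 0 < delta / 4 by rewrite divr_gt0.
have s4 : 0 < 4 * s by rewrite mulr_gt0.
have [h1 h10 hh] := gh R2 _ _ d4 s4.
have r2 : 0 < r / 2 by rewrite divr_gt0.
exists (Num.min h1 (Num.min 1 (r / 2))); first by rewrite !lt_min h10 ltr01 r2.
move=> h e h0; rewrite !lt_min => /andP[hh1 /andP[hh2 hh3]] e0 he farR x y.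
have hge := ltW h0.
have sle a b : box R2 a b -> s * (a ^+ 2 + b ^+ 2) <= delta / 8.
  case/andP => /ltW /sqr_le_norm a2 /ltW /sqr_le_norm b2; apply: le_trans sR.
  by rewrite ler_wpM2l ?(ltW s0) //; move: a2 b2; lra0.
have midsub a b : box R2 a b -> 0 <= dlap h (mid g s delta) a b.
  move=> ab; pose gam x y := g x y + s * (x ^+ 2 + y ^+ 2) - delta.
  have [c1|c2] := leP (- (delta / 2)) (gam a b).
    have gd : delta / 4 <= g a b.
      by have := sle _ _ ab; move: c1 d0; rewrite /gam; lra0.
    case/andP: (ab) => /ltW ha /ltW hb.
    have := hh h h0 hh1 a b ha hb gd; rewrite ler_norml => /andP[+ _].
    have : dlap h gam a b <= dlap h (mid g s delta) a b.
      apply: le_dlap => //; first by rewrite /mid -/(gam a b) max_l.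
      by move=> x' y' _; rewrite /mid le_max lexx.
    have -> : dlap h gam a b = dlap h g a b + 4 * s * h ^+ 2 by rewrite /dlap /gam; ring.
    by lra0.
  rewrite -(dlap0 h a b).
  have -> : dlap h (fun=> fun=> 0) a b = dlap h (fun=> fun=> - (delta / 2)) a b.
    by rewrite /dlap; ring.
  apply: le_dlap => //; first by rewrite /mid -/(gam a b) max_r // ltW.
  by move=> x' y' _; rewrite /mid le_max lexx orbT.
have farsub a b : 0 <= dlap h (far e P tau B) a b.
  have -> : dlap h (far e P tau B) a b = (1 + tau) * dlap h (kk e) (a - P) b.
    rewrite /dlap /far ![a + h - P]addrAC ![a - h - P]addrAC; ring.
  by rewrite mulr_ge0 ?dlap_kk_ge0 // addr_ge0 // ltW.
set u1 := glue (box R2) (mid g s delta) (far e P tau B).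
have u1sub a b : 0 <= dlap h u1 a b.
  have [|[q _]|] := @dlap_glue _ h (box R2) (mid g s delta) (far e P tau B) hge _ a b.
  - move=> {}x {}y x' y' A ab nab.
    have ed : (R2 - 1 <= `|x|) || (R2 - 1 <= `|y|).
      by case/orP: (edge_box A nab) => k; apply/orP; [left|right]; move: k hh2; lra0.
    have g1 := farR _ _ ed; have g2 := g0 x y.
    rewrite /mid ge_max; apply/andP; split; last by move: g1 g2 d0; lra0.
    by have := sle _ _ ab; move: g1 d0; lra0.
  - exact: le_trans (midsub _ _ q).
  - by move=> h'; apply: le_trans (farsub a b) h'.
have [|[q _]|] := @dlap_glue _ h (box r) hq u1 hge _ x y.
- move=> {}x {}y x' y' A ab nab.
  have ed : (r / 2 <= `|x|) || (r / 2 <= `|y|).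
    by case/orP: (edge_box A nab) => k; apply/orP; [left|right]; move: k hh3; lra0.
  case/andP: ab => ax ay.
  have := barrier_mid br (ltW s0) d0 dk ax ay ed.
  have bR : box R2 x y by apply/andP; split; [move: ax|move: ay]; move: rR R2R; lra0.
  by move=> /le_trans; apply; rewrite /u1 /glue bR le_max lexx.
- by rewrite hq0.
- by move=> h'; apply: le_trans (u1sub x y) h'.
Qed.

Lemma ug_uloc g hq r s delta R0 R2 e P tau B x y : 0 <= s ->
  R0 + 2 <= R2 -> (forall x y, `|x| <= R0 + 1 -> `|y| <= R0 + 1 -> far e P tau B x y <= - (delta / 2)) ->
  `|x| <= R0 + 1 -> `|y| <= R0 + 1 ->
  ug g hq r s delta R2 e P tau B x y = uloc g hq r s delta x y.
Proof.
move=> s0 R2R fl hx hy; have [_ m2] := mid_ge g delta x y s0.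
have bR : box R2 x y by apply/andP; split; [move: hx|move: hy]; move: R2R; lra0.
have e1 : Num.max (mid g s delta x y) (far e P tau B x y) = mid g s delta x y.
  by rewrite max_l // (le_trans (fl _ _ hx hy) m2).
by rewrite /ug /uloc /glue bR e1.
Qed.

Lemma ug_far g hq r s delta R0 R2 e P tau B x y : r <= R0 -> R0 + 2 <= R2 ->
  ~~ box R2 x y -> ug g hq r s delta R2 e P tau B x y = far e P tau B x y.
Proof.
move=> rR R2R nb; rewrite /ug /glue (negbTE nb) ifN //.
apply: contra nb => /andP[hx hy].
by apply/andP; split; [move: hx|move: hy]; move: rR R2R; lra0.
Qed.

(** The only possible jump is at the edge of the small box; within [r / 2] of it the maximum already
    equals [mid], so both sides agree. *)
Lemma uloc_ucont g hq r kappa s delta rho : barrier g hq r kappa -> 0 < r ->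
  0 <= s -> 0 < delta -> delta <= kappa -> 0 <= rho ->
  ucont_on rho g -> ucont_on rho hq -> ucont_on rho (uloc g hq r s delta).
Proof.
move=> br r0 s0 d0 dk rho0 gc hc w w0.
have w2 : 0 < w / 2 by rewrite divr_gt0.
have [d1 d10 h1] := gc _ w2; have [d2 d20 h2] := hc _ w0.
pose K := s * (4 * rho + 2).
have K0 : 0 <= K by rewrite /K mulr_ge0 //; move: rho0; lra0.
pose d3 := w / 2 / (K + 1).
have K1 : 0 < K + 1 by move: K0; lra0.
have d30 : 0 < d3 by rewrite !divr_gt0.
exists (Num.min (Num.min d1 d2) (Num.min (Num.min d3 1) (r / 2))).
  by rewrite !lt_min d10 d20 d30 ltr01 divr_gt0.
move=> x y x' y' hx hy; rewrite !lt_min.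
move=> /andP[/andP[x1 x2] /andP[/andP[x3 x4] x5]] /andP[/andP[y1 y2] /andP[/andP[y3 y4] y5]].
have sq (a b : R) : `|a| <= rho -> `|a - b| < 1 -> `|a - b| < d3 ->
    `|a ^+ 2 - b ^+ 2| <= (2 * rho + 1) * d3.
  move=> ha hb1 hb3; have -> : a ^+ 2 - b ^+ 2 = (2 * a - (a - b)) * (a - b) by ring.
  rewrite normrM ler_pM ?(ltW hb3) //.
  apply: le_trans (ler_normB _ _) _; rewrite normrM (ger0_norm (ler0n _ 2)).
  by move: ha hb1; lra0.
have mm : `|mid g s delta x y - mid g s delta x' y'| <= w.
  apply: max_near; last by rewrite subrr normr0 ltW.
  have -> : g x y + s * (x ^+ 2 + y ^+ 2) - delta - (g x' y' + s * (x' ^+ 2 + y' ^+ 2) - delta)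
    = (g x y - g x' y') + s * ((x ^+ 2 - x' ^+ 2) + (y ^+ 2 - y' ^+ 2)) by ring.
  apply: le_trans (ler_normD _ _) _.
  have -> : w = w / 2 + w / 2 by field.
  apply: lerD; first exact: h1.
  rewrite normrM (ger0_norm s0).
  apply: (@le_trans _ _ (s * ((2 * rho + 1) * d3 + (2 * rho + 1) * d3))).
    by rewrite ler_wpM2l // (le_trans (ler_normD _ _)) // lerD // sq.
  have -> : s * ((2 * rho + 1) * d3 + (2 * rho + 1) * d3) = w / 2 * (K / (K + 1)).
    by rewrite /d3 /K; field; rewrite gt_eqF.
  rewrite -[leRHS]mulr1 ler_wpM2l ?(ltW w2) // ler_pdivrMr // mul1r.
  by rewrite lerDl.
have out (a b a' b' : R) : box r a b -> ~~ box r a' b' -> `|a - a'| < r / 2 -> `|b - b'| < r / 2 ->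
    uloc g hq r s delta a b = mid g s delta a b.
  move=> bb nb ha hb; rewrite /uloc /glue bb max_r //.
  have ed : (r / 2 <= `|a|) || (r / 2 <= `|b|).
    have A : adj (r / 2) a b a' b' by split; exact: ltW.
    by case/orP: (edge_box A nb) => k; apply/orP; [left|right]; move: k; lra0.
  by case/andP: bb => ? ?; apply: barrier_mid br _ _ _ _ _ ed.
have [b1|b1] := boolP (box r x y); have [b2|b2] := boolP (box r x' y').
- by rewrite /uloc /glue b1 b2; apply: max_near => //; exact: h2.
- by rewrite (out _ _ _ _ b1 b2) // /uloc /glue (negbTE b2).
- rewrite distrC in x5; rewrite distrC in y5.
  by rewrite (out _ _ _ _ b2 b1 x5 y5) /uloc /glue (negbTE b1).
- by rewrite /uloc /glue (negbTE b1) (negbTE b2).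
Qed.

End Subharmonic.

(** * Discrete Riesz representation of the glued function *)

Section Potential.
Context {R : realType}.
Implicit Types (x y h e s P B tau delta kappa rho M : R) (g hq : R -> R -> R).

Definition bounded_on rho g := exists2 B, 0 <= B & forall x y, `|x| <= rho -> `|y| <= rho -> `|g x y| <= B.

Lemma lap_at h f (a b : int) :
  lap (fun a b => f (h * a%:~R) (h * b%:~R)) a b = dlap h f (h * a%:~R) (h * b%:~R) :> R.
Proof.
have := lap_lattice h 0 0 f a b; rewrite !add0r => <-.
by rewrite /lap !add0r.
Qed.

(** Potential and total mass are both known only up to the unevaluated mass [C] of the kernel; their
    quotient is free of it. *)
Lemma quotient_near (V W C A tau e1 Ab : R) : 0 < C -> 0 < tau -> 0 < e1 -> e1 <= 1 / 4 ->
  `|V - C * A| <= e1 * C -> `|W - (1 + tau) * C| <= e1 * C -> `|A| <= Ab ->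
  0 < W /\ `|V / W - A / (1 + tau)| <= 2 * e1 * (1 + Ab).
Proof.
move=> C0 t0 e0 e4 hV hW hA.
have e4C : e1 * C <= 1 / 4 * C by rewrite ler_wpM2r // ltW.
have tC : 0 <= tau * C by rewrite mulr_ge0 // ltW.
have W3 : 3 / 4 * C <= W.
  by move: hW e4C tC; rewrite ler_norml => /andP[+ _]; rewrite mulrDl mul1r; lra0.
have W0 : 0 < W by apply: lt_le_trans W3; rewrite mulr_gt0 // divr_gt0.
split=> //; have Wn := gt_eqF W0; have tn : 1 + tau != 0 by rewrite gt_eqF //; move: t0; lra0.
have -> : V / W - A / (1 + tau) = ((V - C * A) + A / (1 + tau) * ((1 + tau) * C - W)) / W.
  by field; rewrite tn Wn.
rewrite normrM (gtr0_norm (x := W^-1)) ?invr_gt0 // ler_pdivrMr //.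
apply: le_trans (ler_normD _ _) _.
have h1 : `|A / (1 + tau)| <= Ab.
  rewrite normrM normfV (gtr0_norm (x := 1 + tau)) ?ler_pdivrMr; try by move: t0; lra0.
  apply: (le_trans hA); rewrite ler_peMr; try by move: t0; lra0.
  exact: (le_trans (normr_ge0 _) hA).
have h2 : `|A / (1 + tau) * ((1 + tau) * C - W)| <= Ab * (e1 * C).
  by rewrite normrM ler_pM // distrC.
have Ab0 : 0 <= Ab := le_trans (normr_ge0 _) hA.
have h3 : e1 * (1 + Ab) * C <= e1 * (1 + Ab) * (2 * W).
  by rewrite ler_wpM2l //; [rewrite mulr_ge0 ?(ltW e0) // addr_ge0 | move: W3 W0; lra0].
by move: hV h2 h3; lra0.
Qed.

(** The weights [m] are the Laplacian of the glued function [u]. Since [F = u - far] has bounded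
    support, summation by parts against a kernel centred at [(c, d)] gives on one side about
    [C * F c d], on the other the potential of [m] minus that of the remote pole. The latter is
    evaluated by [approx_id] as well and cancels the logarithm in [F], leaving [C * (u + B)]. Near 0
    [u] equals [hq], of zero Laplacian, so [m] vanishes there. *)
Lemma potential g hq r kappa delta tau R0 rho1 M r1 :
  barrier g hq r kappa -> 0 < r -> r <= R0 -> 0 < delta -> delta <= 1 -> delta <= kappa ->
  0 < tau -> tau <= 1 -> 0 < rho1 -> rho1 <= r ->
  (forall x y, 0 <= g x y) ->
  (forall rho, ucont_on rho g) -> (forall rho, ucont_on rho hq) ->
  (forall rho, bounded_on rho g) -> (forall rho, bounded_on rho hq) ->
  (forall h x y, dlap h hq x y = 0) ->
  (forall rho d eta, 0 < d -> 0 < eta -> exists2 h0, 0 < h0 & forall h, 0 < h -> h < h0 ->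
     forall x y, `|x| <= rho -> `|y| <= rho -> d <= g x y -> `|dlap h g x y| <= eta * h ^+ 2) ->
  (forall x y, r1 <= x ^+ 2 + y ^+ 2 -> g x y <= ln (x ^+ 2 + y ^+ 2) / 2 + M) ->
  (forall x y, `|x| < rho1 -> `|y| < rho1 -> g x y <= delta / 4 /\ - (delta / 4) <= hq x y) ->
  exists s B, [/\ 0 < s, s * (2 * (R0 + 2) ^+ 2) <= delta / 8 & forall w, 0 < w ->
   exists (se h : R) (N : nat) (m : int -> int -> R),
    [/\ 0 < se, se <= w, 0 < h, forall a b, 0 <= m a b & 0 < bsum N m] /\
    [/\ forall x y, `|x| <= R0 -> `|y| <= R0 ->
       `|bsum N (fun a b => m a b * kk (se ^+ 2) (h * a%:~R - x) (h * b%:~R - y)) / bsum N m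
         - (uloc g hq r s delta x y + B) / (1 + tau)| <= w
     & forall a b, `|h * a%:~R| < rho1 / 2 -> `|h * b%:~R| < rho1 / 2 -> m a b = 0]].
Proof.
move=> br r0 rR d0 d1 dk t0 t1 p0 pr g0 gc hc gb hb hq0 gh gg near0.
have R00 : 0 <= R0 := le_trans (ltW r0) rR.
have [P [B [R2 [s [[PR R2R s0 sR] ff]]]]] := far_field t0 t1 d0 d1 R00 g0 gg.
exists s, B; split=> //.
  apply: le_trans sR; rewrite ler_wpM2l ?(ltW s0) // ler_wpM2l // ler_sqr ?nnegrE //; move: R00 R2R; lra0.
move=> w w0.
have [h1 h10 sub] := ug_subharmonic P%:R B br s0 d0 dk r0 rR R2R sR t0 g0 hq0 gh.
have R01 : 0 <= R0 + 1 by move: R00; lra0.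
have uc := uloc_ucont br r0 (ltW s0) d0 dk R01 (gc _) (hc _).
have [Hb Hb0 hHb] := hb R0.
have [Gb Gb0 hGb] := gb R2.
have ulocB x y : `|x| <= R0 + 1 -> `|y| <= R0 + 1 -> `|uloc g hq r s delta x y| <= Hb + (Gb + 3).
  move=> hx hy; have mB : `|mid g s delta x y| <= Gb + 3.
    have hx2 : `|x| <= R2 by move: hx R2R; lra0.
    have hy2 : `|y| <= R2 by move: hy R2R; lra0.
    have gB := hGb x y hx2 hy2.
    have sz : 0 <= s * (x ^+ 2 + y ^+ 2) <= delta / 8.
      rewrite mulr_ge0 ?(ltW s0) ?addr_ge0 ?sqr_ge0 //=; apply: le_trans sR.
      rewrite ler_wpM2l ?(ltW s0) //; move: (sqr_le_norm hx2) (sqr_le_norm hy2); lra0.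
    case/andP: sz => sz1 sz2; move: gB; rewrite ler_norml => /andP[g1 g2].
    rewrite ler_norml /mid; apply/andP; split.
      by rewrite le_max; apply/orP; left; move: g1 sz1 d1; lra0.
    by rewrite ge_max; apply/andP; split; move: g2 sz2 d0 d1 Gb0; lra0.
  rewrite /uloc /glue; case: ifP => [/andP[bx by']|_]; last first.
    by apply: le_trans mB _; move: Hb0; lra0.
  have hB : `|hq x y| <= Hb by apply: hHb; [move: bx|move: by']; move: rR; lra0.
  by case: (leP (hq x y)) => _; move: hB mB Hb0 Gb0; lra0.
pose Ab := Hb + (Gb + 3) + `|B|.
have Ab0 : 0 <= Ab by rewrite /Ab; nneg.
pose e1 := Num.min (1 / 4) (w / (8 * (1 + Ab))).
have A1 : 0 < 8 * (1 + Ab) by move: Ab0; lra0.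
have e10 : 0 < e1 by rewrite lt_min !divr_gt0.
have e14 : e1 <= 1 / 4 by rewrite ge_min lexx.
have e1w : e1 * (1 + Ab) <= w / 8.
  have : e1 <= w / (8 * (1 + Ab)) by rewrite ge_min lexx orbT.
  by rewrite ler_pdivlMr //; lra0.
have e18 : 0 < e1 / 8 by rewrite divr_gt0.
have [du du0 hdu] := uc _ e18.
pose t := Num.min (e1 / 96) (Num.min (du / 2) (1 / 12)).
have tt0 : 0 < t by rewrite !lt_min !divr_gt0.
have te : t <= e1 / 96 by rewrite ge_min lexx.
have tu : t < du.
  have : t <= du / 2 by rewrite !ge_min lexx !orbT.
  by move: du0; lra0.
have t12 : t <= 1 / 12 by rewrite !ge_min lexx !orbT.
pose r' := t ^+ 2; have r'0 : 0 < r' by rewrite exprn_gt0.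
have P0 : 0 <= P%:R :> R by [].
pose l0 := R2 + P%:R + 3; have l00 : 0 <= l0 by rewrite /l0; move: R00 R2R P0; lra0.
pose H := l0 + 1.
have H1 : 1 <= H by rewrite /H; move: l00; lra0.
pose L := `|ln (2 * (2 * H) ^+ 2 + 1)|.
pose A2 := Hb + Gb + 4 + 2 * `|B| + 6 * L.
have L0 : 0 <= L by exact: normr_ge0.
have A20 : 0 <= A2 by rewrite /A2; move: Hb0 Gb0 L0 (normr_ge0 B); lra0.
pose K := 22 * (4 * H + 1) ^+ 2 / r' ^+ 2.
have K0 : 0 < K.
  by rewrite divr_gt0 ?exprn_gt0 // mulr_gt0 // exprn_gt0 //; move: H1; lra0.
have A212 : 0 < A2 + 12 by move: A20; lra0.
have KA : 0 < 24 * K * (A2 + 12) by apply: mulr_gt0 => //; apply: mulr_gt0.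
have st0 : 0 < Num.min (Num.min 1 w) (e1 / (24 * K * (A2 + 12))).
  by rewrite !lt_min ltr01 w0 /= divr_gt0.
have [E E0 hE] := fine_mesh (ltr01 : 0 < (1:R)) st0.
(* Taking [se = 1 / E] and then [h = se / q] with integers [E] and [q] makes the natural number [P]
   a lattice abscissa, of index [P * E * q]. *)
pose se := 1 / E%:R : R; rewrite -/se in hE.
have Er : 0 < E%:R :> R by rewrite ltr0n.
have se0 : 0 < se by rewrite divr_gt0.
move: hE; rewrite !lt_min => /andP[/andP[/ltW se1 /ltW sw] seK].
pose e := se ^+ 2.
have e0 : 0 < e by rewrite exprn_gt0.
have ee1 : e <= 1 by rewrite expr_le1 // ltW.
have [ff1 ff2] := ff e e0 ee1.
pose Bm := A2 + 6 * `|ln e|.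
have TB : K * (Bm * e) <= e1 / 24.
  have h : Bm * e <= (A2 + 12) * se.
    have := sqr_ln_le se0 se1; rewrite -/e.
    have : e <= se by rewrite /e expr2 ger_pMr.
    move=> /(ler_wpM2l A20); rewrite /Bm; lra0.
  have hK : se * (24 * K * (A2 + 12)) <= e1.
    by move: seK; rewrite ltr_pdivlMr // => /ltW.
  by have := ler_wpM2l (ltW K0) h; move: hK; lra0.
pose hm := Num.min (Num.min h1 (e1 / 2 * se)) (Num.min (Num.min (rho1 / 4) du) (1 / 2)).
have hm0 : 0 < hm by rewrite !lt_min h10 du0 !divr_gt0 //= !mulr_gt0 // invr_gt0.
have [q qn hq'] := fine_mesh se0 hm0.
pose h := se / q%:R; rewrite -/h in hq'.
move: hq'; rewrite !lt_min => /andP[/andP[hh1 hh2] /andP[/andP[hh3 hh4] /ltW hh5]].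
have q1 : 1 <= q%:R :> R by rewrite ler1n.
have qr : 0 < q%:R :> R by rewrite ltr0n.
have hpos : 0 < h by rewrite divr_gt0.
have hs : h <= se by rewrite ler_pdivrMr // ler_peMr // ltW.
have hle1 : h <= 1 by exact: le_trans se1.
have he : h ^+ 2 <= e by rewrite ler_sqr ?nnegrE // ltW.
have [N /andP[N1 N2]] := cover_nat hpos hle1 l00.
rewrite -/H in N2.
pose cp : int := (P * E * q)%N.
have hcp : h * cp%:~R = P%:R.
  by rewrite /cp /h /se -pmulrn !natrM; field; rewrite !gt_eqF.
pose u := ug g hq r s delta R2 e P%:R tau B.
pose fa := far e P%:R tau B.
pose pt (f : R -> R -> R) (a b : int) := f (h * a%:~R) (h * b%:~R).
have usub x y : 0 <= dlap h u x y by exact: (sub h e hpos hh1 e0 he ff2).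
pose m := lap (pt u).
have mE a b : m a b = dlap h u (h * a%:~R) (h * b%:~R) by exact: lap_at.
have m0 a b : 0 <= m a b by rewrite mE.
have out a : (N.-1 < `|a|)%N -> R2 <= `|h * a%:~R|.
  move=> ha; have : h * N%:R <= `|h * a%:~R| by apply: idx_ge => //; move: ha; lia0.
  by move: N1 P0; rewrite /l0; lra0.
pose F a b := pt u a b - pt fa a b.
have F0 : vanish N.-1 F.
  move=> a b ab; rewrite /F /pt /u (@ug_far _ g hq r s delta R0) ?subrr //.
  by rewrite /box negb_and -!leNgt; case/orP: ab => /out ->; rewrite ?orbT.
have N0 : (0 < N)%N.
  by rewrite lt0n; apply/eqP => NE; move: N1 R00 R2R P0; rewrite NE mulr0 /l0; lra0.
have F0' : vanish N F by move=> a b ab; apply: F0; move: ab; lia0.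
pose C := mass e h N.*2.
have C3 : 3^-1 <= C.
  apply: mass_ge => //; rewrite -(ler_nat R) -(ler_pM2l hpos).
  have -> : h * q%:R = se by rewrite /h divfK // gt_eqF.
  by rewrite -muln2 natrM mulrA; move: se1 N1 P0 R00 R2R; rewrite /l0; lra0.
have C0 : 0 < C by apply: lt_le_trans C3; rewrite invr_gt0.
pose T X := 22 * X * e * (4 * H + 1) ^+ 2 / r' ^+ 2.
have TC X : X <= Bm -> T X <= e1 / 8 * C.
  move=> XB; have -> : T X = K * (X * e) by rewrite /T /K; field; rewrite gt_eqF.
  apply: (@le_trans _ _ (e1 / 24)).
    by apply: le_trans TB; rewrite ler_wpM2l ?(ltW K0) // ler_wpM2r // ltW.
  by have := ler_wpM2l (ltW e18) C3; lra0.
pose Kb := `|ln e| + L.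
have Kb0 : 0 <= Kb by rewrite /Kb addr_ge0.
have kkB x y : `|x| <= 2 * H -> `|y| <= 2 * H -> `|kk e x y| <= Kb by exact: kk_bound.
have in_r (a b : R) : a ^+ 2 + b ^+ 2 < r' -> `|a| <= t /\ `|b| <= t.
  move=> k; have := sqr_ge0 a; have := sqr_ge0 b => b2 a2.
  by split; apply: normr_le_sqr; rewrite ?(ltW tt0) //; move: k b2 a2; rewrite /r'; lra0.
have R2H : R2 + P%:R <= H by rewrite /H /l0; lra0.
have far_var x y x' y' : `|x| <= R0 + 1 -> `|x' - x| <= t -> `|y' - y| <= t ->
    `|kk e (x' - P%:R) y' - kk e (x - P%:R) y| <= 6 * t.
  move=> hx dx dy.
  have -> : x' - P%:R = (x - P%:R) + (x' - x) by ring.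
  have -> : kk e ((x - P%:R) + (x' - x)) y' = kk e ((x - P%:R) + (x' - x)) (y + (y' - y)).
    by congr kk; ring.
  apply: kk_var => //; rewrite distrC.
  by have := ler_normB P%:R x; have := lerB_dist P%:R x; rewrite (ger0_norm P0); move: hx PR; lra0.
have FB a b : `|F a b| <= Bm.
  rewrite /F /pt; set x := h * _; set y := h * _.
  have [bx|nb] := boolP (box R2 x y); last first.
    rewrite /u (@ug_far _ g hq r s delta R0) // subrr normr0 /Bm.
    by move: A20 (normr_ge0 (ln e)); lra0.
  have bx' := bx; case/andP: bx' => xR yR.
  have kB : `|kk e (x - P%:R) y| <= Kb.
    apply: kkB; first by apply: le_trans (ler_normB _ _) _; rewrite (ger0_norm P0);
      move: xR R2H H1; lra0.
    by move: yR R2H H1 P0; lra0.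
  have fB : `|fa x y| <= 2 * Kb + `|B|.
    rewrite /fa /far; apply: le_trans (ler_normB _ _) _; rewrite lerD2r normrM.
    by rewrite ler_pM // ger0_norm; move: t0 t1; lra0.
  have gB := hGb x y (ltW xR) (ltW yR).
  have mB : `|mid g s delta x y| <= Gb + 3.
    have sz : 0 <= s * (x ^+ 2 + y ^+ 2) <= delta / 8.
      rewrite mulr_ge0 ?(ltW s0) ?addr_ge0 ?sqr_ge0 //=; apply: le_trans sR.
      rewrite ler_wpM2l ?(ltW s0) //; move: (sqr_le_norm (ltW xR)) (sqr_le_norm (ltW yR)); lra0.
    case/andP: sz => sz1 sz2; move: gB; rewrite ler_norml => /andP[g1 g2].
    rewrite ler_norml /mid; apply/andP; split.
      by rewrite le_max; apply/orP; left; move: g1 sz1 d1; lra0.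
    by rewrite ge_max; apply/andP; split; move: g2 sz2 d0 d1 Gb0; lra0.
  have uB : `|u x y| <= Hb + (Gb + 3) + (2 * Kb + `|B|).
    have vB : `|Num.max (mid g s delta x y) (fa x y)| <= Gb + 3 + (2 * Kb + `|B|).
      by case: (leP (mid g s delta x y)) => _; move: mB fB Gb0 Kb0 (normr_ge0 B); lra0.
    rewrite /u /ug /glue bx -/fa; case: ifP => [/andP[rx ry]|_]; last by move: vB Hb0; lra0.
    have hB : `|hq x y| <= Hb by apply: hHb; [move: rx|move: ry]; move: rR; lra0.
    case: (leP (hq x y)) => _; first by move: vB Hb0; lra0.
    by move: hB Gb0 Kb0 (normr_ge0 B); lra0.
  apply: le_trans (ler_normB _ _) _; move: uB fB; rewrite /Bm /A2 /Kb.
  by move: L0 (normr_ge0 (ln e)); lra0.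
have LAT c d : `|h * c%:~R| <= R0 + 1 / 2 -> `|h * d%:~R| <= R0 + 1 / 2 ->
    `|bsum N (fun a b => m a b * kk e (h * (a - c)%:~R) (h * (b - d)%:~R))
      - C * (uloc g hq r s delta (h * c%:~R) (h * d%:~R) + B)| <= e1 * C.
  move=> hc' hd'.
  have cN : (`|c| <= N)%N.
    by apply: (@idx_le _ h) => //; move: hc' N1 R2R P0; rewrite /l0; lra0.
  have dN : (`|d| <= N)%N.
    by apply: (@idx_le _ h) => //; move: hd' N1 R2R P0; rewrite /l0; lra0.
  have hc1 : `|h * c%:~R| <= R0 + 1 by move: hc'; lra0.
  have hd1 : `|h * d%:~R| <= R0 + 1 by move: hd'; lra0.
  pose Gz a b := kk e (h * (a - c)%:~R) (h * (b - d)%:~R).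
  have lapG a b : lap Gz a b = kd e h (a - c) (b - d).
    rewrite /kd /dlap /lap /Gz !(addrAC _ _ (- c)) !(addrAC _ _ (- d)).
    by rewrite !(intrB, intrD) !mulr1z !mulrDr !mulrN1 !mulr1.
  have cpN : (`|cp| <= N)%N.
    apply: (@idx_le _ h) => //; rewrite hcp (ger0_norm P0).
    by move: N1 R2R R00; rewrite /l0; lra0.
  have lapfa a b : lap (pt fa) a b = (1 + tau) * kd e h (a - cp) (b - 0).
    rewrite /pt lap_at /kd /dlap /fa /far !intrB !mulrBr hcp mulr0 subr0.
    by rewrite ![_ + h - P%:R]addrAC ![_ - h - P%:R]addrAC; ring.
  have lapF a b : lap F a b = m a b - (1 + tau) * kd e h (a - cp) (b - 0).
    by rewrite -lapfa /m /F /lap; ring.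
  (* [approx_id] needs finite support, which a logarithm lacks; cutting it off outside the box
     leaves the sum over the box unchanged. *)
  pose G1 a b := if (`|a| <= N)%N && (`|b| <= N)%N then Gz a b else 0.
  have gr : bsum N (fun a b => F a b * kd e h (a - c) (b - d)) =
      bsum N (fun a b => m a b * Gz a b) - (1 + tau) * bsum N (fun a b => G1 a b * kd e h (a - cp) (b - 0)).
    rewrite -bsumZ -bsumB (_ : bsum N _ = bsum N (fun a b => F a b * lap Gz a b)); last first.
      by apply: eq_bsum => a b _ _; rewrite lapG.
    rewrite green //; apply: eq_bsum => a b ha hb'; rewrite lapF /G1 ha hb' /=; ring.
  have S1 : `|bsum N (fun a b => F a b * kd e h (a - c) (b - d)) - C * F c d| <= (e1 / 4 * C) + e1 / 8 * C.
    apply: le_trans (_ : _ <= e1 / 4 * C + T Bm) _; last by rewrite lerD2l TC.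
    apply: approx_id => //; first by rewrite divr_ge0 // ltW.
    move=> a b; rewrite !intrB !mulrBr => /in_r[da db].
    have ha1 : `|h * a%:~R| <= R0 + 1.
      by have := ler_normD (h * a%:~R - h * c%:~R) (h * c%:~R); rewrite subrK; move: da t12 hc'; lra0.
    have hb1 : `|h * b%:~R| <= R0 + 1.
      by have := ler_normD (h * b%:~R - h * d%:~R) (h * d%:~R); rewrite subrK; move: db t12 hd'; lra0.
    rewrite /F /pt /u !(@ug_uloc _ g hq r s delta R0) ?(ltW s0) //.
    have -> : forall p q v v' : R, p - v - (q - v') = (p - q) - (v - v') by move=> *; ring.
    apply: le_trans (ler_normB _ _) _.
    have U : `|uloc g hq r s delta (h * a%:~R) (h * b%:~R) -
       uloc g hq r s delta (h * c%:~R) (h * d%:~R)| <= e1 / 8.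
      by apply: hdu => //; [exact: le_lt_trans da tu | exact: le_lt_trans db tu].
    have -> : fa (h * a%:~R) (h * b%:~R) - fa (h * c%:~R) (h * d%:~R) =
       (1 + tau) * (kk e (h * a%:~R - P%:R) (h * b%:~R) - kk e (h * c%:~R - P%:R) (h * d%:~R)).
      by rewrite /fa /far; ring.
    have fv := far_var _ _ _ _ hc1 da db.
    have : `|(1 + tau) * (kk e (h * a%:~R - P%:R) (h * b%:~R) -
        kk e (h * c%:~R - P%:R) (h * d%:~R))| <= 2 * (6 * t).
      by rewrite normrM ler_pM // ger0_norm; move: t0 t1; lra0.
    by move: U te; lra0.
  have G1B a b : `|G1 a b| <= Bm.
    rewrite /G1; case: ifPn => [/andP[ha hb']|_]; last first.
      by rewrite normr0 /Bm; move: A20 (normr_ge0 (ln e)); lra0.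
    have sz k l v : (`|k| <= N)%N -> `|h * l%:~R| <= R0 + v -> v <= 1 -> `|h * (k - l)%:~R| <= 2 * H.
      move=> kN lb v1; rewrite intrB mulrBr; apply: le_trans (ler_normB _ _) _.
      have : `|h * k%:~R| <= h * N%:R by rewrite normr_idx // ler_pM2l // ler_nat.
      by move: lb v1 N2 R2H R2R P0; lra0.
    apply: le_trans (kkB _ _ _ _) _.
    - by apply: (sz _ _ (1 / 2) ha hc'); lra0.
    - by apply: (sz _ _ (1 / 2) hb' hd'); lra0.
    by rewrite /Kb /Bm /A2; move: Hb0 Gb0 L0 (normr_ge0 B) (normr_ge0 (ln e)); lra0.
  have zN : (`|0 : int| <= N)%N by [].
  have S2 : `|bsum N (fun a b => G1 a b * kd e h (a - cp) (b - 0)) - C * G1 cp 0| <= (e1 / 16 * C) + e1 / 8 * C.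
    apply: le_trans (_ : _ <= e1 / 16 * C + T Bm) _; last by rewrite lerD2l TC.
    apply: approx_id => //; first by move=> a b ab; rewrite /G1 ifN //; move: ab; lia0.
    - by rewrite divr_ge0 // ltW.
    move=> a b /in_r[da db].
    have aN : (`|a| <= N)%N.
      apply: (@idx_le _ h) => //; have := ler_normD (h * (a - cp)%:~R) (h * cp%:~R).
      rewrite -mulrDr -intrD subrK hcp (ger0_norm P0).
      by move: da t12 N1 R2R R00; rewrite /l0; lra0.
    have bN : (`|b| <= N)%N.
      apply: (@idx_le _ h) => //; move: db; rewrite subr0.
      by move: t12 N1 R2R R00 P0; rewrite /l0; lra0.
    rewrite /G1 aN bN cpN zN /= /Gz.
    have -> : h * (a - c)%:~R = h * (cp - c)%:~R + h * (a - cp)%:~R by rewrite !intrB; ring.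
    have -> : h * (b - d)%:~R = h * (0 - d)%:~R + h * (b - 0)%:~R by rewrite !intrB; ring.
    apply: le_trans (kk_var _ e0 _ da db t12) _; last by move: te; lra0.
    rewrite intrB mulrBr hcp.
    by have := lerB_dist P%:R (h * c%:~R); rewrite (ger0_norm P0); move: hc' PR; lra0.
  have FE : F c d = uloc g hq r s delta (h * c%:~R) (h * d%:~R) + B - (1 + tau) * G1 cp 0.
    rewrite /F /pt /u (@ug_uloc _ g hq r s delta R0) ?(ltW s0) // /fa /far /G1 cpN zN /= /Gz.
    rewrite !intrB !mulrBr hcp mulr0 sub0r.
    have -> : kk e (P%:R - h * c%:~R) (- (h * d%:~R)) = kk e (h * c%:~R - P%:R) (h * d%:~R).
      by rewrite /kk sqrrN -opprB sqrrN.
    by ring.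
  move: S1 S2; rewrite FE; rewrite gr.
  set v2 := bsum N (fun a b => G1 a b * _); set v1 := bsum N (fun a b => m a b * Gz a b).
  rewrite -/v1; move: v1 v2 (G1 cp 0) (uloc g hq r s delta _ _) => v1 v2 k ul S1 S2.
  have -> : v1 - C * (ul + B) = (v1 - (1 + tau) * v2 - C * (ul + B - (1 + tau) * k))
     + (1 + tau) * (v2 - C * k) by ring.
  apply: le_trans (ler_normD _ _) _.
  have S3 : `|(1 + tau) * (v2 - C * k)| <= 2 * (e1 / 16 * C + e1 / 8 * C).
    by rewrite normrM ler_pM // ger0_norm; move: t0 t1; lra0.
  by have := mulr_gt0 e10 C0; move: S1 S3; lra0.
have cpN : (`|cp| <= N)%N.
  apply: (@idx_le _ h) => //; rewrite hcp (ger0_norm P0).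
  by move: N1 R2R R00; rewrite /l0; lra0.
have zN : (`|0 : int| <= N)%N by [].
have WE : `|bsum N m - (1 + tau) * C| <= e1 * C.
  pose I1 (a b : int) : R := if (`|a| <= N)%N && (`|b| <= N)%N then 1 else 0.
  have -> : bsum N m = (1 + tau) * bsum N (fun a b => I1 a b * kd e h (a - cp) (b - 0)).
    have lapfa a b : lap (pt fa) a b = (1 + tau) * kd e h (a - cp) (b - 0).
      rewrite /pt lap_at /kd /dlap /fa /far !intrB !mulrBr hcp mulr0 subr0.
      by rewrite ![_ + h - P%:R]addrAC ![_ - h - P%:R]addrAC; ring.
    (* Tested against the constant 1, the Laplacian of [F] sums to 0, so [m] has the same total as
       the Laplacian of [far]. *)
    have := @green _ F (fun=> fun=> 1) N N0 F0.
    rewrite [X in X = _](_ : _ = 0); last first.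
      rewrite -(mulr0 (N.*2.+1%:R ^+ 2)) -bsum_cst; apply: eq_bsum => a b _ _.
      by rewrite /lap; ring.
    move=> /esym z0; apply/eqP; rewrite -subr_eq0 -bsumZ -bsumB -z0; apply/eqP/eq_bsum => a b ha hb'.
    by rewrite /I1 ha hb' /= mul1r -lapfa /m mul1r /F /lap; ring.
  rewrite -mulrBr normrM (ger0_norm (x := 1 + tau)); last by move: t0; lra0.
  have S : `|bsum N (fun a b => I1 a b * kd e h (a - cp) (b - 0)) - C * I1 cp 0| <= 0 * C + T 1.
    apply: approx_id => //; first by move=> a b ab; rewrite /I1 ifN //; move: ab; lia0.
      by move=> a b; rewrite /I1; case: ifP; rewrite ?normr1 ?normr0.
    move=> a b /in_r[da db].
    have aN : (`|a| <= N)%N.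
      apply: (@idx_le _ h) => //; have := ler_normD (h * (a - cp)%:~R) (h * cp%:~R).
      rewrite -mulrDr -intrD subrK hcp (ger0_norm P0).
      by move: da t12 N1 R2R R00; rewrite /l0; lra0.
    have bN : (`|b| <= N)%N.
      apply: (@idx_le _ h) => //; move: db; rewrite subr0.
      by move: t12 N1 R2R R00 P0; rewrite /l0; lra0.
    by rewrite /I1 aN bN cpN zN subrr normr0.
  have I11 : I1 cp 0 = 1 by rewrite /I1 cpN zN.
  have B1 : 1 <= Bm.
    by rewrite /Bm /A2; move: Hb0 Gb0 L0 (normr_ge0 B) (normr_ge0 (ln e)); lra0.
  rewrite I11 mulr1 mul0r add0r in S; have := le_trans S (TC _ B1).
  have t2 : 1 + tau <= 2 by move: t1; lra0.
  have t3 : 0 <= 1 + tau by move: t0; lra0.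
  move=> /(ler_pM t3 (normr_ge0 _) t2) /le_trans; apply.
  by have := mulr_gt0 e10 C0; lra0.
have W0 : 0 < bsum N m.
  have := @quotient_near 0 (bsum N m) C 0 tau e1 0 C0 t0 e10 e14.
  rewrite mulr0 subrr normr0 lexx => K1.
  have [] := K1 _ WE isT => //; by rewrite mulr_ge0 ?ltW.
exists se, h, N, m; split; split => //.
- move=> x y hx hy.
  have [c hc'] := lattice_near 0 x hpos; have [d hd'] := lattice_near 0 y hpos.
  rewrite add0r in hc'; rewrite add0r in hd'.
  have zc : `|h * c%:~R| <= R0 + 1 / 2.
    have := ler_normB x (x - h * c%:~R); rewrite opprB addrC subrK; move: hx hc' hh5; lra0.
  have zd : `|h * d%:~R| <= R0 + 1 / 2.
    have := ler_normB y (y - h * d%:~R); rewrite opprB addrC subrK; move: hy hd' hh5; lra0.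
  have AB : `|uloc g hq r s delta (h * c%:~R) (h * d%:~R) + B| <= Ab.
    by apply: le_trans (ler_normD _ _) _; rewrite lerD2r; apply: ulocB; [move: zc|move: zd]; lra0.
  have [_ QN] := quotient_near C0 t0 e10 e14 (LAT c d zc zd) WE AB.
  have ud : `|uloc g hq r s delta x y - uloc g hq r s delta (h * c%:~R) (h * d%:~R)| <= e1 / 8.
    by apply: hdu; [move: hx|move: hy|move: hc'|move: hd']; move: hh4; lra0.
  have hse : h / se <= e1 / 2 by rewrite ler_pdivrMr // ltW.
  have hse0 : 0 <= h / se by rewrite divr_ge0 // ltW.
  have VD : `|bsum N (fun a b => m a b * kk e (h * a%:~R - x) (h * b%:~R - y)) -
     bsum N (fun a b => m a b * kk e (h * (a - c)%:~R) (h * (b - d)%:~R))| <= e1 * bsum N m.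
    rewrite -bsumB -bsumZ; apply: le_trans (ler_norm_bsum _ _) _.
    apply: le_bsum => a b _ _; rewrite -mulrBr normrM (ger0_norm (m0 a b)) mulrC.
    rewrite ler_wpM2r // !intrB !mulrBr.
    apply: le_trans (kk_lip (h := h) se0 _ _) _.
    - have -> : h * a%:~R - x - (h * a%:~R - h * c%:~R) = - (x - h * c%:~R) by ring.
      by rewrite normrN.
    - have -> : h * b%:~R - y - (h * b%:~R - h * d%:~R) = - (y - h * d%:~R) by ring.
      by rewrite normrN.
    have : (h / se) ^+ 2 <= e1 / 2.
      rewrite expr2 -[leRHS]mulr1; apply: ler_pM => //.
      by move: hse e14; lra0.
    by move: hse; lra0.
  move: QN VD AB ud; rewrite -/e.
  set v1 := bsum N (fun a b => m a b * kk e (h * a%:~R - x) (h * b%:~R - y)).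
  set v2 := bsum N (fun a b => m a b * kk e (h * (a - c)%:~R) (h * (b - d)%:~R)).
  set ua := uloc _ _ _ _ _ x y; set ub := uloc _ _ _ _ _ (h * c%:~R) (h * d%:~R).
  move=> QN VD AB ud.
  have -> : v1 / bsum N m - (ua + B) / (1 + tau) = (v1 - v2) / bsum N m +
    (v2 / bsum N m - (ub + B) / (1 + tau)) - (ua - ub) / (1 + tau) by ring.
  apply: le_trans (ler_normB _ _) _.
  have q3 : `|(ua - ub) / (1 + tau)| <= e1 / 8.
    rewrite normrM normfV (gtr0_norm (x := 1 + tau)); last by move: t0; lra0.
    rewrite ler_pdivrMr; last by move: t0; lra0.
    apply: le_trans ud _; rewrite ler_peMr ?(ltW e18) //; move: t0; lra0.
  have q1' : `|(v1 - v2) / bsum N m| <= e1.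
    by rewrite normrM normfV (gtr0_norm W0) ler_pdivrMr.
  have := ler_normD ((v1 - v2) / bsum N m) (v2 / bsum N m - (ub + B) / (1 + tau)).
  by have := mulr_ge0 (ltW e10) Ab0; move: QN q1' q3 e1w w0 e10; lra0.
- move=> a b ha hb'; rewrite mE.
  have uq x y : `|x| < rho1 -> `|y| < rho1 -> u x y = hq x y.
    move=> hx hy; have rx : `|x| < r by move: hx pr; lra0.
    have ry : `|y| < r by move: hy pr; lra0.
    have Rx : `|x| <= R0 + 1 by move: rx rR; lra0.
    have Ry : `|y| <= R0 + 1 by move: ry rR; lra0.
    rewrite /u (@ug_uloc _ g hq r s delta R0) ?(ltW s0) // /uloc /glue /box rx ry /= max_l //.
    have [n1 n2] := near0 _ _ hx hy.
    rewrite /mid ge_max; apply/andP; split; last by move: n2 d0; lra0.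
    have : s * (x ^+ 2 + y ^+ 2) <= delta / 8.
      apply: le_trans sR; rewrite ler_wpM2l ?(ltW s0) //.
      have xR2 : `|x| <= R2 by move: Rx R2R; lra0.
      have yR2 : `|y| <= R2 by move: Ry R2R; lra0.
      by move: (sqr_le_norm xR2) (sqr_le_norm yR2); lra0.
    by move: n1 n2 d0; lra0.
  have hn : `|h| <= h by rewrite ger0_norm // ltW.
  have sh x v : `|x| < rho1 / 2 -> `|v| <= h -> `|x + v| < rho1.
    by move=> hx hv; apply: le_lt_trans (ler_normD _ _) _; move: hx hv hh3 p0; lra0.
  have z0 : `|0 : R| <= h by rewrite normr0 ltW.
  have hn' : `|- h| <= h by rewrite normrN.
  have e1' x : x = x + 0 :> R by rewrite addr0.
  rewrite -(hq0 h (h * a%:~R) (h * b%:~R)) /dlap !uq //; try exact: sh;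
    by rewrite [X in `|X|]e1'; exact: sh.
Qed.

End Potential.

(** * From potentials to polynomials *)

Section LogExpansion.
Context {R : realType}.

Lemma lipschitz_of_derive (f df : R -> R) (a b K : R) :
  (forall x, Num.min a b <= x <= Num.max a b -> is_derive x 1 f (df x)) ->
  (forall x, Num.min a b <= x <= Num.max a b -> `|df x| <= K) ->
  `|f b - f a| <= K * `|b - a|.
Proof.
have main (c d : R) : c <= d -> (forall x, c <= x <= d -> is_derive x 1 f (df x)) ->
    (forall x, c <= x <= d -> `|df x| <= K) -> `|f d - f c| <= K * `|d - c|.
  move=> cd hd hK.
  have [x|x|x] := @MVT_segment R f df c d cd.
  - by rewrite in_itv /= => /andP[x1 x2]; apply: hd; rewrite !ltW.
  - by apply: derivable_within_continuous => y; rewrite in_itv /= => y1; have [] := hd y y1.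
  rewrite in_itv /= => hx ->; rewrite normrM ler_wpM2r //; exact: hK.
case: (leP a b) => ab hd hK; first exact: main.
by rewrite distrC [`|b - a|]distrC; apply: main => //; exact: ltW.
Qed.

(** The remainder, as a function of [y = 1 + t], has derivative [(y - 1) ^+ 2 / y]. The bound -3/4
    keeps [y >= 1 / 4], which is the squared modulus of [1 - z] at worst when [z] has modulus at
    most 1/2. *)
Lemma ln_taylor2 (t : R) : - (3 / 4) <= t -> `|ln (1 + t) - t + t ^+ 2 / 2| <= 4 * `|t| ^+ 3.
Proof.
move=> ht.
pose f (y : R) := ln y - (y - 1) + (y - 1) ^+ 2 / 2.
have := @lipschitz_of_derive f (fun y => y^-1 - 1 + (y - 1)) 1 (1 + t) (4 * `|t| ^+ 2).
have e1 : f 1 = 0 by rewrite /f ln1 !subrr expr0n /= mul0r !addr0.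
have e2 : f (1 + t) = ln (1 + t) - t + t ^+ 2 / 2 by rewrite /f [1 + t - 1]addrAC subrr add0r.
rewrite e1 e2 subr0 [1 + t - 1]addrAC subrr add0r.
rewrite (_ : 4 * `|t| ^+ 3 = 4 * `|t| ^+ 2 * `|t|); last by ring.
apply.
  move=> x hx; have x0 : 0 < x.
    by case/andP: hx; rewrite ge_min => /orP[] h _; move: h ht; lra0.
  have := is_derive1_ln x0 => dl.
  rewrite /f; apply: is_derive_eq.
  by rewrite /= !scaler0 add0r subr0 /GRing.scale /= mulr1; field; rewrite gt_eqF.
move=> x hx; have x4 : 1 / 4 <= x.
  by case/andP: hx; rewrite ge_min => /orP[] h _; move: h ht; lra0.
have x0 : 0 < x by move: x4; lra0.
have xt : `|x - 1| <= `|t|.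
  move: hx; case: (leP 1 (1 + t)) => h /andP[h1 h2].
    by rewrite !ger0_norm; move: h h1 h2; lra0.
  by rewrite ler0_norm ?ler0_norm; move: h h1 h2; lra0.
have -> : x^-1 - 1 + (x - 1) = (x - 1) ^+ 2 / x by field; rewrite gt_eqF.
rewrite normrM (gtr0_norm (x := x^-1)) ?invr_gt0 // ler_pdivrMr // normrX.
have a1 : `|x - 1| ^+ 2 <= `|t| ^+ 2 by rewrite ler_sqr ?nnegrE.
have := ler_wpM2l (sqr_ge0 `|t|) x4.
by move: a1; lra0.
Qed.

(** With [z = p + iq] this is [log |1 - z| = - Re (z + z^2 / 2) + O(|z|^3)], in real coordinates. *)
Lemma ln_1B (p q d : R) : 0 <= d -> d <= 1 / 2 -> p ^+ 2 + q ^+ 2 = d ^+ 2 ->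
  `|ln ((1 - p) ^+ 2 + q ^+ 2) / 2 + p + (p ^+ 2 - q ^+ 2) / 2| <= 40 * d ^+ 3.
Proof.
move=> d0 d1 pq.
have pd : `|p| <= d by apply: normr_le_sqr => //; have := sqr_ge0 q; move: pq; lra0.
pose t := - 2 * p + d ^+ 2.
have e1 : (1 - p) ^+ 2 + q ^+ 2 = 1 + t by rewrite /t -pq; ring.
have t34 : - (3 / 4) <= t.
  have : (1 / 2) ^+ 2 <= (1 - p) ^+ 2.
    rewrite ler_sqr ?nnegrE; move: pd d1 d0; rewrite ler_norml => h1 h2 h3; case/andP: h1; move: h2 h3; lra0.
  by have := sqr_ge0 q; move: e1; lra0.
have td : `|t| <= 5 / 2 * d.
  apply: le_trans (ler_normD _ _) _; rewrite normrM normrN (ger0_norm (ler0n _ 2)).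
  rewrite (ger0_norm (sqr_ge0 d)).
  have : d ^+ 2 <= 1 / 2 * d by rewrite expr2 ler_wpM2r.
  by move: pd; lra0.
have T := ln_taylor2 t34; rewrite e1.
have -> : ln (1 + t) / 2 + p + (p ^+ 2 - q ^+ 2) / 2 =
   (ln (1 + t) - t + t ^+ 2 / 2) / 2 + (p * d ^+ 2 - d ^+ 4 / 4).
  have q2 : q ^+ 2 = d ^+ 2 - p ^+ 2 by rewrite -pq; ring.
  by rewrite q2 /t; field.
apply: le_trans (ler_normD _ _) _.
have h1 : `|(ln (1 + t) - t + t ^+ 2 / 2) / 2| <= 32 * d ^+ 3.
  rewrite normrM (ger0_norm (x := 2^-1)) ?invr_ge0 // ler_pdivrMr //.
  apply: le_trans T _.
  have : `|t| ^+ 3 <= (5 / 2 * d) ^+ 3 by rewrite lerXn2r ?nnegrE // mulr_ge0.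
  have : 0 <= d ^+ 3 by rewrite exprn_ge0.
  by rewrite exprMn; lra0.
have h2 : `|p * d ^+ 2 - d ^+ 4 / 4| <= 2 * d ^+ 3.
  have d3 : 0 <= d ^+ 3 by rewrite exprn_ge0.
  have : `|p * d ^+ 2| <= d ^+ 3.
    by rewrite normrM (ger0_norm (sqr_ge0 d)) (exprS d 2) ler_wpM2r // sqr_ge0.
  have : `|d ^+ 4 / 4| <= d ^+ 3.
    rewrite ger0_norm; last by rewrite divr_ge0 // exprn_ge0.
    have : d ^+ 4 <= d ^+ 3 by rewrite (exprS d 3) ler_piMl //; move: d1; lra0.
    by move: d3; lra0.
  by have := ler_normB (p * d ^+ 2) (d ^+ 4 / 4); lra0.
have d3 : 0 <= d ^+ 3 by rewrite exprn_ge0.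
by move: h1 h2 d3; lra0.
Qed.

End LogExpansion.

Section ComplexModulus.
Context {R : realType}.
Implicit Types (z w : R[i]).
Local Notation Re := complex.Re.
Local Notation Im := complex.Im.

Lemma cmodE z : cmod z = Num.sqrt (Re z ^+ 2 + Im z ^+ 2).
Proof. by case: z. Qed.

Lemma cmod_ge0 z : 0 <= cmod z.
Proof. by rewrite cmodE sqrtr_ge0. Qed.

Lemma sqr_cmod z : cmod z ^+ 2 = Re z ^+ 2 + Im z ^+ 2.
Proof. by rewrite cmodE sqr_sqrtr // addr_ge0 ?sqr_ge0. Qed.

Lemma cmodM z w : cmod (z * w) = cmod z * cmod w.
Proof. exact: ComplexField.Normc.normcM. Qed.

Lemma cmodV z : cmod z^-1 = (cmod z)^-1.
Proof. exact: ComplexField.Normc.normcV. Qed.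

Lemma cmod0 : cmod 0 = 0 :> R.
Proof. exact: ComplexField.Normc.normc0. Qed.

Lemma cmod1 : cmod 1 = 1 :> R.
Proof. exact: ComplexField.Normc.normc1. Qed.

Lemma cmodD z w : cmod (z + w) <= cmod z + cmod w.
Proof. exact: le_normcD. Qed.

Lemma cmodN z : cmod (- z) = cmod z.
Proof. exact: normcN. Qed.

Lemma cmod_gt0 z : (0 < cmod z) = (z != 0).
Proof.
rewrite lt_neqAle cmod_ge0 andbT eq_sym; congr negb; apply/eqP/eqP => [|->].
  exact: ComplexField.Normc.eq0_normc.
exact: cmod0.
Qed.

Lemma cmodX z n : cmod (z ^+ n) = cmod z ^+ n.
Proof. by elim: n => [|n IH]; rewrite ?expr0 ?cmod1 // !exprS cmodM IH. Qed.

Lemma cmod_nat n : cmod (n%:R : R[i]) = n%:R.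
Proof.
rewrite -(rmorph_nat (real_complex R)) cmodE /= expr0n addr0 sqrtr_sqr ger0_norm //.
Qed.

Lemma ReD z w : Re (z + w) = Re z + Re w.
Proof. by case: z => ? ?; case: w. Qed.

Lemma ReN z : Re (- z) = - Re z.
Proof. by case: z. Qed.

Lemma Re_sum (I : finType) (F : I -> R[i]) : Re (\sum_i F i) = \sum_i Re (F i).
Proof. exact: (big_morph (fun z => Re z) ReD (erefl _)). Qed.

Lemma Re_natM n z : Re (n%:R * z) = n%:R * Re z.
Proof. by rewrite !mulr_natl; elim: n => [|n IH]; rewrite ?mulr0n // !mulrS ReD IH. Qed.

(** Written in the shape of [kk] with [e = 0], so that polynomials and smoothed potentials compare
    term by term. At [z = 0] its value is 0 by the convention for [ln], hence the conditions of
    nonvanishing below. *)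
Definition lnm z : R := ln (Re z ^+ 2 + Im z ^+ 2) / 2.

Lemma ln_cmod z : ln (cmod z) = lnm z.
Proof.
have [->|z0] := eqVneq z 0.
  by rewrite cmod0 /lnm /= expr0n addr0 !ln0 // mul0r.
have c0 : 0 < cmod z by rewrite cmod_gt0.
by rewrite /lnm -sqr_cmod lnXn // mulr2n; field.
Qed.

Lemma expR_lnm z : z != 0 -> expR (lnm z) = cmod z.
Proof. by move=> z0; rewrite -ln_cmod lnK // posrE cmod_gt0. Qed.

Lemma lnm_prod (I : finType) (F : I -> R[i]) (k : I -> nat) :
  (forall i, k i != 0%N -> F i != 0) ->
  lnm (\prod_i F i ^+ k i) = \sum_i (k i)%:R * lnm (F i).
Proof.
move=> F0; suff [] : lnm (\prod_i F i ^+ k i) = \sum_i (k i)%:R * lnm (F i) /\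
   \prod_i F i ^+ k i != 0 by [].
elim/big_rec2: _ => [|i y1 y2 _ [IH n0]].
  by rewrite -ln_cmod cmod1 ln1; split => //; exact: oner_neq0.
have f0 : F i ^+ k i != 0.
  by rewrite expf_eq0 negb_and -leqNgt leqn0; have [//|/F0 ->] := eqVneq (k i) 0%N; rewrite ?orbT.
split; last by rewrite mulf_neq0.
rewrite -ln_cmod cmodM lnM ?posrE ?cmod_gt0 // !ln_cmod IH; congr (_ + _).
have [->|k0] := eqVneq (k i) 0%N; first by rewrite expr0 mul0r -ln_cmod cmod1 ln1.
by rewrite -!ln_cmod cmodX lnXn ?cmod_gt0 ?F0 // mulr_natl.
Qed.

Lemma deriv_prod_at (I : finType) (zeta : I -> R[i]) (k : I -> nat) (x : R[i]) :
  (forall i, k i != 0%N -> x - zeta i != 0) ->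
  (\prod_i ('X - (zeta i)%:P) ^+ k i)^`().[x] =
  (\sum_i (k i)%:R / (x - zeta i)) * (\prod_i ('X - (zeta i)%:P) ^+ k i).[x].
Proof.
move=> h; elim: (index_enum I) => [|i r IH].
  by rewrite !big_nil -polyC1 derivC horner0 mul0r.
have key : (('X - (zeta i)%:P) ^+ k i)^`().[x] =
    (k i)%:R / (x - zeta i) * (('X - (zeta i)%:P) ^+ k i).[x].
  have [->|/h k0] := eqVneq (k i) 0%N; first by rewrite expr0 -polyC1 derivC horner0 !mul0r.
  case: (k i) => [|n]; first by rewrite expr0 -polyC1 derivC horner0 !mul0r.
  rewrite deriv_exp derivXsubC mul1r /= hornerMn !horner_exp !hornerE exprS.
  by rewrite mulrA divfK // mulr_natl.
by rewrite !big_cons derivM hornerD !hornerM IH key; ring.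
Qed.

End ComplexModulus.

Section PolyExpansion.
Context {R : realType}.
Implicit Types (z w : R[i]).
Local Notation Re := complex.Re.
Local Notation Im := complex.Im.

Lemma prodXsubC_at (I : finType) (zeta : I -> R[i]) (k : I -> nat) z :
  (\prod_i ('X - (zeta i)%:P) ^+ k i).[z] = \prod_i (z - zeta i) ^+ k i.
Proof. by rewrite horner_prod; apply: eq_bigr => i _; rewrite horner_exp !hornerE. Qed.

Lemma lnm_1B z : cmod z <= 1 / 2 -> `|lnm (1 - z) + Re (z + z ^+ 2 / 2)| <= 40 * cmod z ^+ 3.
Proof.
case: z => p q hz.
have := ln_1B (cmod_ge0 _) hz (esym (sqr_cmod _)).
rewrite (_ : (2 : R[i])^-1 = (2^-1 : R)%:C%C); last by rewrite fmorphV rmorph_nat.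
rewrite /lnm expr2 /= sub0r sqrrN; congr (`|_| <= _).
by rewrite -addrA; congr (_ + (_ + _)); ring.
Qed.

Lemma lnmM z w : z != 0 -> w != 0 -> lnm (z * w) = lnm z + lnm w.
Proof. by move=> z0 w0; rewrite -!ln_cmod cmodM lnM ?posrE ?cmod_gt0. Qed.

(** The same [a], the normalized logarithmic derivative at 0, governs both [T'(0)] and the linear
    part of [log |T|]: a uniform estimate of [log |T|] thereby controls a derivative. As the roots
    stay at distance [rho], the cubic remainder per root is uniform. *)
Lemma poly_expansion (I : finType) (zeta : I -> R[i]) (k : I -> nat) (rho : R) :
  0 < rho -> (forall i, k i != 0%N -> rho <= cmod (zeta i)) -> (0 < \sum_i k i)%N ->
  exists a b : R[i],
  [/\ (\prod_i ('X - (zeta i)%:P) ^+ k i).[0] != 0,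
      (\prod_i ('X - (zeta i)%:P) ^+ k i)^`().[0] =
        (\sum_i k i)%:R * a * (\prod_i ('X - (zeta i)%:P) ^+ k i).[0]
    & forall z, cmod z <= rho / 2 -> (\prod_i ('X - (zeta i)%:P) ^+ k i).[z] != 0 /\
      `|lnm (\prod_i ('X - (zeta i)%:P) ^+ k i).[z] - lnm (\prod_i ('X - (zeta i)%:P) ^+ k i).[0]
        - (\sum_i k i)%:R * Re (a * z + b * z ^+ 2)|
      <= (\sum_i k i)%:R * (40 * (cmod z / rho) ^+ 3)].
Proof.
move=> r0 hk N0; set N := (\sum_i k i)%N in N0 *.
have Nn : (N%:R : R[i]) != 0 by rewrite pnatr_eq0 -lt0n.
have zn i : k i != 0%N -> zeta i != 0.
  by move=> /hk h; rewrite -cmod_gt0; apply: lt_le_trans h.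
have sub z i : cmod z <= rho / 2 -> k i != 0%N -> z - zeta i != 0.
  move=> hz /hk h; rewrite subr_eq0; apply/eqP => e; move: h; rewrite -e leNgt; apply/negP/negPn.
  by move: hz r0; lra0.
have c0 : cmod (0 : R[i]) <= rho / 2 by rewrite cmod0; move: r0; lra0.
exists (- (\sum_i (k i)%:R / zeta i) / N%:R), (- (\sum_i (k i)%:R / zeta i ^+ 2) / N%:R / 2).
have nz z : cmod z <= rho / 2 -> (\prod_i ('X - (zeta i)%:P) ^+ k i).[z] != 0.
  move=> hz; rewrite prodXsubC_at; apply/prodf_neq0 => i _.
  by rewrite expf_eq0 negb_and -leqNgt leqn0; have [//|/(sub z i hz) ->] := eqVneq (k i) 0%N; rewrite ?orbT.
split; first exact: nz.
  rewrite deriv_prod_at; last by move=> i ki; exact: sub.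
  congr (_ * _); rewrite mulrC divfK // -sumrN; apply: eq_bigr => i _.
  by rewrite sub0r invrN mulrN.
move=> z hz; split; first exact: nz.
rewrite !prodXsubC_at !lnm_prod; try by move=> i ki; exact: sub.
have E : N%:R * (- (\sum_i (k i)%:R / zeta i) / N%:R * z
     + - (\sum_i (k i)%:R / zeta i ^+ 2) / N%:R / 2 * z ^+ 2) =
   - \sum_i (k i)%:R * (z / zeta i + (z / zeta i) ^+ 2 / 2).
  set S1 := \sum_i _ / zeta i; set S2 := \sum_i _ / _ ^+ 2.
  have -> : N%:R * (- S1 / N%:R * z + - S2 / N%:R / 2 * z ^+ 2) = - (S1 * z + S2 * (z ^+ 2 / 2)).
    by field.
  congr (- _); rewrite !mulr_suml -big_split /=; apply: eq_bigr => i _.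
  by rewrite exprMn exprVn; ring.
rewrite -Re_natM E ReN Re_sum opprK -sumrB -big_split /=.
apply: le_trans (ler_norm_sum _ _ _) _.
rewrite natr_sum mulr_suml; apply: ler_sum => i _.
rewrite Re_natM -mulrBr -mulrDr normrM ger0_norm //.
have [->|ki] := eqVneq (k i) 0%N; first by rewrite !mul0r.
rewrite ler_wpM2l //.
have zi := zn i ki; have ci : 0 < cmod (zeta i) by rewrite cmod_gt0.
have xz : cmod (z / zeta i) <= cmod z / rho.
  by rewrite cmodM cmodV ler_wpM2l ?cmod_ge0 // lef_pV2 ?posrE // hk.
have x12 : cmod (z / zeta i) <= 1 / 2.
  by apply: le_trans xz _; rewrite ler_pdivrMr //; move: hz; lra0.
have -> : lnm (z - zeta i) - lnm (0 - zeta i) = lnm (1 - z / zeta i).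
  have e : z - zeta i = (0 - zeta i) * (1 - z / zeta i) by field.
  have n1 := sub z i hz ki; have n2 := sub 0 i c0 ki.
  rewrite e lnmM //; first by rewrite addrC addKr.
  by apply: contra n1 => /eqP w0; rewrite e w0 mulr0.
apply: le_trans (lnm_1B x12) _.
by rewrite ler_wpM2l // lerXn2r ?nnegrE ?cmod_ge0 // (le_trans _ xz) ?cmod_ge0.
Qed.

(* Integer masses are multiplicities of zeros of a polynomial. *)
Lemma round_weights N (m : int -> int -> R) (K w : R) :
  (forall a b, 0 <= m a b) -> 0 < bsum N m -> 0 <= K -> 0 < w ->
  exists n : int -> int -> nat,
  [/\ forall a b, m a b = 0 -> n a b = 0%N, 0 < bsum N (fun a b => (n a b)%:R : R)
    & forall k : int -> int -> R, (forall a b, `|k a b| <= K) ->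
      `|bsum N (fun a b => (n a b)%:R * k a b) / bsum N (fun a b => (n a b)%:R)
        - bsum N (fun a b => m a b * k a b) / bsum N m| <= w].
Proof.
move=> m0 W0 K0 w0; set W := bsum N m in W0 *.
pose c : R := N.*2.+1%:R ^+ 2.
have c0 : 0 <= c by rewrite sqr_ge0.
(* Truncation to integers costs at most one unit in each of the [c] cells. The weights are scaled by
   [Q] until their total exceeds [2 * c * K / w], which makes the relative error at most [w]. *)
pose B := c + 2 * c * K / w + 1.
have B1 : 0 <= 2 * c * K / w by rewrite divr_ge0 ?(ltW w0) // !mulr_ge0.
pose Q := (Num.bound (B / W))%:R : R.
have QW : B < Q * W.
  by rewrite -ltr_pdivrMr // /Q archi_boundP // divr_ge0 ?(ltW W0) // /B; move: c0 B1; lra0.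
have Q0 : 0 <= Q by rewrite /Q.
pose n a b := Num.truncn (Q * m a b).
have nle a b : 0 <= Q * m a b - (n a b)%:R <= 1.
  have /andP[h1 h2] := truncn_itv (mulr_ge0 Q0 (m0 a b)).
  by apply/andP; split; rewrite ?subr_ge0 // lerBlDl -natr1 in h2 *; exact: ltW.
have Wn : Q * W - c <= bsum N (fun a b => (n a b)%:R) <= Q * W.
  rewrite /W -bsumZ; apply/andP; split; last first.
    by apply: le_bsum => a b _ _; case/andP: (nle a b); rewrite subr_ge0.
  rewrite -[c]mulr1 -(bsum_cst N 1) -bsumB; apply: le_bsum => a b _ _.
  by case/andP: (nle a b) => _; lra0.
case/andP: Wn; set Z := bsum N _ => Z1 Z2.
have Z0 : 0 < Z by move: Z1 QW B1; rewrite /B; lra0.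
exists n; split => //.
  by move=> a b e; rewrite /n e mulr0 truncn0.
move=> k hk.
pose D := bsum N (fun a b => (Q * m a b - (n a b)%:R) * k a b).
have DK : `|D| <= c * K.
  apply: le_trans (ler_norm_bsum _ _) _; rewrite -bsum_cst; apply: le_bsum => a b _ _.
  case/andP: (nle a b) => h1 h2; rewrite normrM ger0_norm //.
  by apply: le_trans (ler_pM h1 (normr_ge0 _) h2 (hk a b)) _; rewrite mul1r.
set V := bsum N (fun a b => m a b * k a b).
have VK : `|V / W| <= K.
  rewrite normrM normfV (gtr0_norm W0) ler_pdivrMr // /W -bsumZ.
  apply: le_trans (ler_norm_bsum _ _) _; apply: le_bsum => a b _ _.
  rewrite normrM (ger0_norm (m0 a b)) mulrC ler_wpM2r //; exact: hk.
have Vn : bsum N (fun a b => (n a b)%:R * k a b) = Q * V - D.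
  by rewrite /V /D -bsumZ -bsumB; apply: eq_bsum => a b _ _; ring.
have -> : bsum N (fun a b => (n a b)%:R * k a b) / Z - V / W =
   (V / W * (Q * W - Z) - D) / Z.
  by rewrite Vn; field; rewrite !gt_eqF.
rewrite normrM normfV (gtr0_norm Z0) ler_pdivrMr //.
apply: le_trans (ler_normB _ _) _; rewrite normrM.
have h1 : `|Q * W - Z| <= c by rewrite ger0_norm; move: Z1 Z2; lra0.
have h2 := ler_pM (normr_ge0 _) (normr_ge0 _) VK h1.
have h3 : 2 * c * K <= w * Z.
  rewrite [leRHS]mulrC -ler_pdivrMr //; move: Z1 QW B1; rewrite /B; lra0.
by move: h2 h3 DK; lra0.
Qed.

Lemma bsum_pair N (F : int -> int -> R) :
  bsum N F = \sum_(p : 'I_N.*2.+1 * 'I_N.*2.+1) F (p.1%:Z - N%:Z) (p.2%:Z - N%:Z).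
Proof. by rewrite /bsum /zsum pair_bigA. Qed.

End PolyExpansion.

Section PolyPotential.
Context {R : realType}.
Local Notation Re := complex.Re.
Local Notation Im := complex.Im.

Lemma normr_Re_le (z : R[i]) : `|Re z| <= cmod z.
Proof.
by apply: normr_le_sqr (cmod_ge0 _) _; rewrite sqr_cmod lerDl sqr_ge0.
Qed.

Lemma normr_Im_le (z : R[i]) : `|Im z| <= cmod z.
Proof.
by apply: normr_le_sqr (cmod_ge0 _) _; rewrite sqr_cmod lerDr sqr_ge0.
Qed.

(** The roots are lattice points with rounded multiplicities. Since [log |z|] lies below its
    smoothing, the upper estimate holds on the whole box, even next to roots. The lower one is
    needed only near 0: there all roots are at distance at least [rho / 2], and the smoothing costs
    at most a multiple of [e / rho ^+ 2], whence the third term of [w1]. The constant [B] disappears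
    on subtracting the value at 0. *)
Lemma poly_potential (U : R -> R -> R) (R0 rho B : R) :
  0 < rho -> rho <= R0 -> U 0 0 = 0 ->
  (forall w, 0 < w -> exists (se h : R) (N : nat) (m : int -> int -> R),
    [/\ 0 < se, se <= w, 0 < h, forall a b, 0 <= m a b & 0 < bsum N m] /\
    [/\ forall x y, `|x| <= R0 -> `|y| <= R0 ->
       `|bsum N (fun a b => m a b * kk (se ^+ 2) (h * a%:~R - x) (h * b%:~R - y)) / bsum N m
         - (U x y + B)| <= w
     & forall a b, `|h * a%:~R| < rho -> `|h * b%:~R| < rho -> m a b = 0]) ->
  forall w, 0 < w -> exists (I : finType) (zeta : I -> R[i]) (k : I -> nat),
  let T := \prod_i ('X - (zeta i)%:P) ^+ k i in let N := (\sum_i k i)%N in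
  [/\ (0 < N)%N, forall i, k i != 0%N -> rho <= cmod (zeta i),
    forall x y, `|x| <= R0 -> `|y| <= R0 -> T.[(x +i* y)%C] != 0 ->
      lnm T.[(x +i* y)%C] - lnm T.[0] <= N%:R * (U x y + w)
  & forall x y, `|x| <= rho / 4 -> `|y| <= rho / 4 ->
      N%:R * (U x y - w) <= lnm T.[(x +i* y)%C] - lnm T.[0]].
Proof.
move=> r0 rR U0 pot w w0.
pose w1 := Num.min (Num.min 1 (w / 8)) (w * rho ^+ 2 / 64).
have w10 : 0 < w1.
  by rewrite !lt_min ltr01 !divr_gt0 //= ?mulr_gt0 ?exprn_gt0.
have w11 : w1 <= 1 by rewrite !ge_min lexx.
have w18 : w1 <= w / 8 by rewrite !ge_min lexx orbT.
have w1r : w1 <= w * rho ^+ 2 / 64 by rewrite !ge_min lexx !orbT.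
have [se [h [N [m [[se0 sw h0 m0 W0] [apx supp]]]]]] := pot w1 w10.
set e := se ^+ 2 in apx.
have e0 : 0 < e by rewrite exprn_gt0.
have e1 : e <= 1 by rewrite expr_le1 ?(ltW se0) // (le_trans sw).
have ew : e <= w * rho ^+ 2 / 64.
  apply: le_trans w1r; apply: (le_trans _ sw); rewrite /e expr2 ger_pMr //.
  exact: le_trans sw w11.
have R00 : 0 <= R0 := le_trans (ltW r0) rR.
pose D := h * N%:R + R0.
pose K := `|ln e| + `|ln (2 * D ^+ 2 + 1)|.
have K0 : 0 <= K by rewrite addr_ge0.
pose kz x y (a b : int) := if (`|a| <= N)%N && (`|b| <= N)%N then kk e (h * a%:~R - x) (h * b%:~R - y) else 0.
have kzB x y : `|x| <= R0 -> `|y| <= R0 -> forall a b, `|kz x y a b| <= K.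
  move=> hx hy a b; rewrite /kz; case: ifP => [/andP[ha hb]|_]; last by rewrite normr0.
  have idN c : (`|c| <= N)%N -> `|h * c%:~R| <= h * N%:R.
    by move=> hc; rewrite normr_idx // ler_pM2l // ler_nat.
  apply: kk_bound => //; apply: le_trans (ler_normB _ _) _; rewrite lerD //; exact: idN.
have [n [n0 Z0 nk]] := round_weights m0 W0 K0 w10.
pose V x y := bsum N (fun a b => (n a b)%:R * kk e (h * a%:~R - x) (h * b%:~R - y)).
set Z := bsum N _ in Z0 nk.
have apn x y : `|x| <= R0 -> `|y| <= R0 -> `|V x y / Z - (U x y + B)| <= 2 * w1.
  move=> hx hy; have := nk _ (kzB x y hx hy).
  have -> : bsum N (fun a b => (n a b)%:R * kz x y a b) = V x y.
    by apply: eq_bsum => a b ha hb; rewrite /kz ha hb.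
  have -> : bsum N (fun a b => m a b * kz x y a b) =
      bsum N (fun a b => m a b * kk e (h * a%:~R - x) (h * b%:~R - y)).
    by apply: eq_bsum => a b ha hb; rewrite /kz ha hb.
  have := apx x y hx hy; set q := bsum N _ / bsum N m => a1 a2.
  have -> : V x y / Z - (U x y + B) = (V x y / Z - q) + (q - (U x y + B)) by ring.
  by apply: le_trans (ler_normD _ _) _; move: a1 a2; lra0.
have R0' : `|0 : R| <= R0 by rewrite normr0.
have dif x y : `|x| <= R0 -> `|y| <= R0 -> `|V x y - V 0 0 - Z * U x y| <= Z * (w / 2).
  move=> hx hy; have a1 := apn x y hx hy; have a2 := apn 0 0 R0' R0'.
  have -> : V x y - V 0 0 - Z * U x y = Z * ((V x y / Z - (U x y + B)) - (V 0 0 / Z - (U 0 0 + B))).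
    by rewrite U0; field; rewrite gt_eqF.
  rewrite normrM (gtr0_norm Z0) ler_wpM2l ?(ltW Z0) //.
  by apply: le_trans (ler_normB _ _) _; move: a1 a2 w18; lra0.
pose I : finType := ('I_N.*2.+1 * 'I_N.*2.+1)%type.
pose ia (p : I) : int := p.1%:Z - N%:Z; pose ib (p : I) : int := p.2%:Z - N%:Z.
pose zeta (p : I) : R[i] := ((h * (ia p)%:~R) +i* (h * (ib p)%:~R))%C.
pose k (p : I) := n (ia p) (ib p).
have VE x y : V x y = \sum_p (k p)%:R * kk e (h * (ia p)%:~R - x) (h * (ib p)%:~R - y).
  by rewrite /V bsum_pair.
have ZE : Z = (\sum_p k p)%:R by rewrite /Z bsum_pair natr_sum.
exists I, zeta, k; cbv zeta.
have kp p : k p != 0%N -> (rho <= `|h * (ia p)%:~R|) || (rho <= `|h * (ib p)%:~R|).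
  move=> kp0; rewrite !leNgt -negb_and; apply: contra kp0 => /andP[h1 h2].
  by apply/eqP; apply: n0; exact: supp.
have zT x y p : (\prod_i ('X - (zeta i)%:P) ^+ k i).[(x +i* y)%C] != 0 -> k p != 0%N ->
    (x +i* y)%C - zeta p != 0.
  rewrite prodXsubC_at => nz kp0; apply: contra nz => /eqP z0.
  by rewrite (bigD1 p) //= z0 expr0n (negbTE kp0) mul0r.
have sq x y p : lnm ((x +i* y)%C - zeta p) =
    ln ((h * (ia p)%:~R - x) ^+ 2 + (h * (ib p)%:~R - y) ^+ 2) / 2.
  by rewrite /lnm /=; congr (ln _ / 2); ring.
have upper x y : (\prod_i ('X - (zeta i)%:P) ^+ k i).[(x +i* y)%C] != 0 ->
    lnm (\prod_i ('X - (zeta i)%:P) ^+ k i).[(x +i* y)%C] <= V x y.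
  move=> nz; rewrite prodXsubC_at lnm_prod; last by move=> p; exact: zT.
  rewrite VE; apply: ler_sum => p _.
  have [->|kp0] := eqVneq (k p) 0%N; first by rewrite !mul0r.
  rewrite ler_wpM2l // sq /kk ler_pM2r ?invr_gt0 // ler_ln ?posrE ?kk_arg_gt0 //.
    by rewrite lerDl ltW.
  have := zT _ _ _ nz kp0; rewrite -cmod_gt0 => c0.
  have : 0 < cmod ((x +i* y)%C - zeta p) ^+ 2 by rewrite exprn_gt0.
  by rewrite sqr_cmod /= => c1; apply: lt_le_trans c1 _; rewrite le_eqVlt; apply/orP; left; apply/eqP; ring.
have lower x y : `|x| <= rho / 4 -> `|y| <= rho / 4 ->
    (\prod_i ('X - (zeta i)%:P) ^+ k i).[(x +i* y)%C] != 0 /\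
    V x y - Z * (w / 4) <= lnm (\prod_i ('X - (zeta i)%:P) ^+ k i).[(x +i* y)%C].
  move=> hx hy.
  have far p : k p != 0%N -> rho ^+ 2 / 4 <= (h * (ia p)%:~R - x) ^+ 2 + (h * (ib p)%:~R - y) ^+ 2.
    move=> /kp.
    have aux (a b c d : R) : rho <= `|a| -> `|b| <= rho / 4 -> rho ^+ 2 / 4 <= (a - b) ^+ 2 + (c - d) ^+ 2.
      move=> ha hb; have : rho / 2 <= `|a - b|.
        by have := ler_normD (a - b) b; rewrite subrK; move: ha hb r0; lra0.
      have r2 : 0 <= rho / 2 by move: r0; lra0.
      move=> /(le_norm_sqr r2); have := sqr_ge0 (c - d); rewrite expr_div_n; lra0.
    case/orP => hh; first exact: aux hh hx.
    by rewrite addrC; exact: aux hh hy.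
  have nz : (\prod_i ('X - (zeta i)%:P) ^+ k i).[(x +i* y)%C] != 0.
    rewrite prodXsubC_at; apply/prodf_neq0 => p _.
    rewrite expf_eq0 negb_and -leqNgt leqn0.
    have [//|kp0] := eqVneq (k p) 0%N; apply/eqP => z0; have := far p kp0.
    have : cmod ((x +i* y)%C - zeta p) ^+ 2 = 0 by rewrite z0 cmod0 expr0n.
    rewrite sqr_cmod /= => c0.
    have -> : (h * (ia p)%:~R - x) ^+ 2 + (h * (ib p)%:~R - y) ^+ 2 = 0 by rewrite -c0; ring.
    by rewrite leNgt divr_gt0 // exprn_gt0.
  split => //; rewrite prodXsubC_at lnm_prod; last by move=> p; exact: zT.
  rewrite VE ZE natr_sum mulr_suml -sumrB; apply: ler_sum => p _; rewrite -mulrBr.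
  have [->|kp0] := eqVneq (k p) 0%N; first by rewrite !mul0r.
  rewrite ler_wpM2l // sq /kk lerBlDl -lerBlDr -mulrBl ler_pdivrMr //.
  have fp := far p kp0; set A := _ + _ in fp *.
  have A0 : 0 < A by apply: lt_le_trans fp; rewrite divr_gt0 // exprn_gt0.
  apply: le_trans (lnB_le _ A0) _; first by rewrite addr_gt0.
  rewrite addrAC subrr add0r ler_pdivrMr //.
  have : w / 4 * 2 * (rho ^+ 2 / 4) <= w / 4 * 2 * A by rewrite ler_wpM2l //; move: w0; lra0.
  by move: ew; have := mulr_gt0 w0 (exprn_gt0 2 r0); lra0.
have r4 : `|0 : R| <= rho / 4 by rewrite normr0 divr_ge0 // ltW.
have [nz0 low0] := lower 0 0 r4 r4; have up0 := upper 0 0 nz0.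
rewrite -(ltr0n R) -ZE; split => //.
- move=> p /kp /orP[] h1; apply: le_trans h1 _.
    exact: (normr_Re_le (zeta p)).
  exact: (normr_Im_le (zeta p)).
- move=> x y hx hy nz; have := upper x y nz; have := dif x y hx hy.
  rewrite ler_norml => /andP[_]; have := mulr_gt0 Z0 w0.
  rewrite -[0 : R[i]]/((0 : R) +i* 0)%C; move: low0; lra0.
- move=> x y hx hy; have [_] := lower x y hx hy.
  have hx' : `|x| <= R0 by move: hx rR r0; lra0.
  have hy' : `|y| <= R0 by move: hy rR r0; lra0.
  have := dif x y hx' hy'; rewrite ler_norml => /andP[+ _]; have := mulr_gt0 Z0 w0.
  rewrite -[0 : R[i]]/((0 : R) +i* 0)%C; move: up0; lra0.
Qed.

End PolyPotential.

(** * A polynomial whose modulus on K is largest at 0 *)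

Section Touching.
Context {R : realType}.
Local Notation Re := complex.Re.
Local Notation Im := complex.Im.

Lemma size_prod_exp_XsubC (I : finType) (zeta : I -> R[i]) (k : I -> nat) :
  size (\prod_i ('X - (zeta i)%:P) ^+ k i) = (\sum_i k i).+1.
Proof.
suff [] : size (\prod_i ('X - (zeta i)%:P) ^+ k i) = (\sum_i k i).+1 /\
   \prod_i ('X - (zeta i)%:P) ^+ k i \is monic by [].
elim/big_rec2: _ => [|i n p _ [IH mp]]; first by rewrite size_poly1 monic1.
have me : ('X - (zeta i)%:P) ^+ k i \is monic by rewrite monic_exp // monicXsubC.
split; last by rewrite rpredM.
by rewrite size_monicM // -?size_poly_eq0 ?IH // size_exp_XsubC addSn addnS.
Qed.

Lemma cmod_le_sum (x y : R) : cmod (x +i* y)%C <= `|x| + `|y|.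
Proof.
rewrite -ler_sqr ?nnegrE ?cmod_ge0 ?addr_ge0 // sqr_cmod /= sqrrD !real_normK ?num_real //.
by have := mulr_ge0 (normr_ge0 x) (normr_ge0 y); lra0.
Qed.

(* The values of a real quadratic form without constant term at (+-s, 0),
   (0, +-s) and +-(s, s) determine its coefficients. *)
Lemma coef_bounds (a1 a2 b1 b2 M w s : R) : 0 < s -> 0 < M -> w <= M * s ^+ 3 ->
  (forall x y, `|x| <= s -> `|y| <= s ->
     `|a1 * x - a2 * y + b1 * (x ^+ 2 - y ^+ 2) - 2 * b2 * x * y|
       <= w + M * cmod (x +i* y)%C ^+ 3) ->
  [/\ `|a1| <= 2 * M * s ^+ 2, `|a2| <= 2 * M * s ^+ 2, `|b1| <= 2 * M * s
    & `|b2| <= 5 * M * s].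
Proof.
move=> s0 M0 ws H.
have ss : `|s| <= s by rewrite ger0_norm // ltW.
have ns : `|- s| <= s by rewrite normrN.
have z0 : `|0 : R| <= s by rewrite normr0 ltW.
have s3 : 0 < s ^+ 3 by rewrite exprn_gt0.
have cm (x y : R) : cmod (x +i* y)%C ^+ 3 <= (`|x| + `|y|) ^+ 3.
  by rewrite lerXn2r ?nnegrE ?cmod_ge0 ?addr_ge0 // cmod_le_sum.
have up (x y r : R) : `|x| <= s -> `|y| <= s -> (`|x| + `|y|) ^+ 3 <= r * s ^+ 3 ->
   `|a1 * x - a2 * y + b1 * (x ^+ 2 - y ^+ 2) - 2 * b2 * x * y| <= (1 + r) * (M * s ^+ 3).
  move=> hx hy hr; apply: le_trans (H _ _ hx hy) _.
  have := ler_wpM2l (ltW M0) (le_trans (cm x y) hr); move: ws; lra0.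
have ns1 : `|s| = s by rewrite gtr0_norm.
have h1 := up s 0 1 ss z0; have h2 := up (- s) 0 1 ns z0.
have h3 := up 0 s 1 z0 ss; have h4 := up 0 (- s) 1 z0 ns.
have h5 := up s s 8 ss ss; have h6 := up (- s) (- s) 8 ns ns.
rewrite !normrN ns1 normr0 ?addr0 ?add0r mul1r in h1 h2 h3 h4 h5 h6.
have {}h1 := h1 (lexx _); have {}h2 := h2 (lexx _); have {}h3 := h3 (lexx _); have {}h4 := h4 (lexx _).
have e8 : (s + s) ^+ 3 <= 8 * s ^+ 3 by rewrite le_eqVlt; apply/orP; left; apply/eqP; ring.
have {}h5 := h5 e8; have {}h6 := h6 e8.
have fin (v q : R) (n : nat) : `|v * s ^+ n| <= q * s ^+ n -> `|v| <= q.
  by rewrite normrM normrX ns1 ler_pM2r // exprn_gt0.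
split; [apply: (fin _ _ 1%N)|apply: (fin _ _ 1%N)|apply: (fin _ _ 2%N)|apply: (fin _ _ 2%N)].
- move: h1 h2; rewrite !ler_norml expr1 => /andP[p1 p2] /andP[p3 p4].
  by apply/andP; split; move: p1 p2 p3 p4; lra0.
- move: h3 h4; rewrite !ler_norml expr1 => /andP[p1 p2] /andP[p3 p4].
  by apply/andP; split; move: p1 p2 p3 p4; lra0.
- move: h1 h2; rewrite !ler_norml => /andP[p1 p2] /andP[p3 p4].
  by apply/andP; split; move: p1 p2 p3 p4; lra0.
- move: h5 h6; rewrite !ler_norml => /andP[p1 p2] /andP[p3 p4].
  by apply/andP; split; move: p1 p2 p3 p4; have := mulr_gt0 M0 s3; lra0.
Qed.

Lemma Re_quadratic (a1 a2 b1 b2 x y : R) :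
  Re ((a1 +i* a2)%C * (x +i* y)%C + (b1 +i* b2)%C * (x +i* y)%C ^+ 2) =
  a1 * x - a2 * y + b1 * (x ^+ 2 - y ^+ 2) - 2 * b2 * x * y.
Proof. by rewrite expr2 /=; ring. Qed.

(* The quantity bounded here is the value at (x', y') = omega (x, y) of the
   expansion of log|T|, with omega the unit complex number that makes the
   gradient of log|T o omega| at the origin normal. *)
Lemma rotated_quadratic_le0 (nx ny A c C0 a1 a2 b1 b2 E x y o1 o2 : R) :
  nx ^+ 2 + ny ^+ 2 = 1 -> 0 < A -> 0 < c -> 0 <= C0 -> 16 * A * C0 <= c ->
  cmod (a1 +i* a2)%C <= 2 * A ->
  (o1 +i* o2)%C * (a1 +i* a2)%C = (cmod (a1 +i* a2)%C)%:C%C * (nx -i* ny)%C ->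
  cmod ((o1 +i* o2)%C - 1) <= 1 / 64 -> cmod (o1 +i* o2)%C = 1 ->
  cmod ((b1 +i* b2)%C - c%:C%C * (nx -i* ny)%C ^+ 2) <= c / 32 ->
  E <= c / 16 * cmod (x +i* y)%C ^+ 2 ->
  `|x * nx + y * ny| <= C0 * (x * ny - y * nx) ^+ 2 -> C0 * cmod (x +i* y)%C <= 1 / 4 ->
  Re ((a1 +i* a2)%C * ((o1 +i* o2)%C * (x +i* y)%C)
     + (b1 +i* b2)%C * ((o1 +i* o2)%C * (x +i* y)%C) ^+ 2) + E <= 0.
Proof.
move=> n1 A0 c0 C00 AC aA oa o1' om hb hE hY hX.
set a := (a1 +i* a2)%C in aA oa *; set o := (o1 +i* o2)%C in oa o1' om *.
set b := (b1 +i* b2)%C in hb *; set z := (x +i* y)%C in hE hX *.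
set nb := (nx -i* ny)%C in oa hb.
set X := x * ny - y * nx in hY; set Y := x * nx + y * ny in hY.
have cn : cmod nb = 1 by rewrite cmodE /= sqrrN n1 sqrtr1.
have zX : cmod z ^+ 2 = X ^+ 2 + Y ^+ 2.
  rewrite sqr_cmod /= -[LHS]mulr1 -n1 /X /Y; ring.
have E1 : a * (o * z) + b * (o * z) ^+ 2 = (cmod a)%:C%C * (nb * z) + c%:C%C * (nb * z) ^+ 2
   + (c%:C%C * nb ^+ 2 * (o - 1) * (o + 1) * z ^+ 2 + (b - c%:C%C * nb ^+ 2) * o ^+ 2 * z ^+ 2).
  by rewrite mulrA [a * o]mulrC oa; ring.
rewrite E1 !ReD.
have -> : Re ((cmod a)%:C%C * (nb * z)) = cmod a * Y by rewrite /nb /z /Y /=; ring.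
have -> : Re (c%:C%C * (nb * z) ^+ 2) = c * (Y ^+ 2 - X ^+ 2).
  by rewrite /nb /z /Y /X expr2 /=; ring.
have Z0 := sqr_ge0 (cmod z).
have r1 : Re (c%:C%C * nb ^+ 2 * (o - 1) * (o + 1) * z ^+ 2) <= c / 32 * cmod z ^+ 2.
  apply: le_trans (ler_norm _) _; apply: le_trans (normr_Re_le _) _.
  rewrite !(cmodX, cmodM) cn expr1n mulr1 ler_wpM2r //.
  have -> : cmod c%:C%C = c by rewrite cmodE /= expr0n addr0 sqrtr_sqr gtr0_norm.
  have o2' : cmod (o + 1) <= 2.
    by apply: le_trans (cmodD _ _) _; rewrite om cmod1.
  have := ler_pM (cmod_ge0 _) (cmod_ge0 _) o1' o2'.
  by move/(ler_wpM2l (ltW c0)); rewrite mulrA; lra0.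
have r2 : Re ((b - c%:C%C * nb ^+ 2) * o ^+ 2 * z ^+ 2) <= c / 32 * cmod z ^+ 2.
  apply: le_trans (ler_norm _) _; apply: le_trans (normr_Re_le _) _.
  by rewrite !(cmodX, cmodM) om expr1n mulr1 ler_wpM2r.
have X0 := sqr_ge0 X.
have Xz : X ^+ 2 <= cmod z ^+ 2 by rewrite zX lerDl sqr_ge0.
have aY : cmod a * Y <= c / 8 * X ^+ 2.
  apply: le_trans (ler_norm _) _; rewrite normrM (ger0_norm (cmod_ge0 _)).
  apply: le_trans (ler_pM (cmod_ge0 _) (normr_ge0 _) aA hY) _.
  by rewrite mulrA ler_wpM2r //; move: AC; lra0.
have Y2 : Y ^+ 2 <= X ^+ 2 / 16.
  have h1 : Y ^+ 2 <= (C0 * X ^+ 2) ^+ 2 by apply: sqr_le_norm.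
  have h2 : (C0 * cmod z) ^+ 2 <= (1 / 4) ^+ 2.
    by rewrite ler_sqr ?nnegrE // mulr_ge0 // cmod_ge0.
  have h3 : (C0 * X ^+ 2) ^+ 2 <= (C0 * cmod z) ^+ 2 * X ^+ 2.
    have -> : (C0 * X ^+ 2) ^+ 2 = C0 ^+ 2 * X ^+ 2 * X ^+ 2 by ring.
    have -> : (C0 * cmod z) ^+ 2 = C0 ^+ 2 * cmod z ^+ 2 by ring.
    by rewrite ler_wpM2r // ler_wpM2l // sqr_ge0.
  have := ler_wpM2r X0 h2; move: h1 h3; lra0.
rewrite zX in hE r1 r2.
have cX : 0 <= c * X ^+ 2 by rewrite mulr_ge0 // ltW.
have := ler_wpM2l (ltW c0) Y2.
by move: hE r1 r2 aY cX; lra0.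
Qed.

(** The rotation is [o = nb * conj a / |a|], with [nb] the conjugate normal and [a] the linear
    coefficient, so that [o * a = |a| * nb] and the linear part of [log |T (o z)|] is [|a|] times
    the height. On K near 0 the expansion is then nonpositive by [rotated_quadratic_le0]. On the
    rest of K the slack [eta] is shared between the displacement caused by [o] and the approximation
    error [w]. *)
Lemma touching_poly (nx ny A c C0 rho R0 rK : R) (U : R -> R -> R) (K : R -> R -> Prop) :
  nx ^+ 2 + ny ^+ 2 = 1 -> 0 < A -> 0 < c -> 0 <= C0 -> 16 * A * C0 <= c ->
  0 < rho -> rho <= R0 -> 0 < rK ->
  (forall x y, `|x| <= rho / 4 -> `|y| <= rho / 4 ->
     U x y = A * (x * nx + y * ny) + c * ((x * nx + y * ny) ^+ 2 - (x * ny - y * nx) ^+ 2)) ->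
  ucont_on R0 U ->
  (forall x y, K x y -> `|x| <= R0 / 2 /\ `|y| <= R0 / 2) ->
  (forall x y, K x y -> `|x| <= rK -> `|y| <= rK ->
     `|x * nx + y * ny| <= C0 * (x * ny - y * nx) ^+ 2) ->
  (forall s, 0 < s -> exists2 eta, 0 < eta & forall x y, K x y ->
     (s < `|x|) || (s < `|y|) -> U x y <= - eta) ->
  (forall w, 0 < w -> exists (I : finType) (zeta : I -> R[i]) (k : I -> nat),
  let T := \prod_i ('X - (zeta i)%:P) ^+ k i in let N := (\sum_i k i)%N in
  [/\ (0 < N)%N, forall i, k i != 0%N -> rho <= cmod (zeta i),
    forall x y, `|x| <= R0 -> `|y| <= R0 -> T.[(x +i* y)%C] != 0 ->
      lnm T.[(x +i* y)%C] - lnm T.[0] <= N%:R * (U x y + w)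
  & forall x y, `|x| <= rho / 4 -> `|y| <= rho / 4 ->
      N%:R * (U x y - w) <= lnm T.[(x +i* y)%C] - lnm T.[0]]) ->
  forall eps, 0 < eps -> eps <= 1 -> exists (T : {poly R[i]}) (N : nat),
  [/\ (0 < N)%N, size T = N.+1, forall x y, K x y -> cmod T.[(x +i* y)%C] <= 1,
      cmod T.[0] = 1 & N%:R * (A * (1 - eps)) <= cmod T^`().[0]].
Proof.
move=> n1 A0 c0 C00 AC r0 rR rK0 Unear uc KR Kn Kf pot eps eps0 eps1.
pose M := 40 / rho ^+ 3.
have M0 : 0 < M by rewrite divr_gt0 // exprn_gt0.
have R0p : 0 < R0 := lt_le_trans r0 rR.
pose s1 := Num.min (Num.min (rho / 4) rK) (Num.min (c / (32 * M)) (1 / (8 * (C0 + 1)))).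
have C1 : 0 < 8 * (C0 + 1) by move: C00; lra0.
have M32 : 0 < 32 * M by rewrite mulr_gt0.
have s10 : 0 < s1 by rewrite !lt_min rK0 !divr_gt0.
have s1a : s1 <= rho / 4 by rewrite !ge_min lexx.
have s1b : s1 <= rK by rewrite !ge_min lexx orbT.
have s1c : M * s1 <= c / 32.
  have : s1 <= c / (32 * M) by rewrite !ge_min lexx !orbT.
  by rewrite ler_pdivlMr //; lra0.
have s1d : C0 * s1 <= 1 / 8.
  have : s1 <= 1 / (8 * (C0 + 1)) by rewrite !ge_min lexx !orbT.
  by rewrite ler_pdivlMr //; move: s10; lra0.
have [eta eta0 Keta] := Kf _ s10.
have eta2 : 0 < eta / 2 by rewrite divr_gt0.
have [d d0 hd] := uc _ eta2.
(* The four terms keep, in this order: the quadratic coefficient within [c / 32], the loss in the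
   derivative below [A * eps], [o] within 1/64 of 1, and the displacement of K under the rotation
   below [d]. *)
pose q := Num.min (Num.min (c / 32 / 10) (A * eps / 4)) (Num.min (A / 32 / 32) (A * d / (64 * R0))).
have R64 : 0 < 64 * R0 by rewrite mulr_gt0.
have q0 : 0 < q.
  have p1 : 0 < c / 32 / 10 by rewrite !divr_gt0.
  have p2 : 0 < A * eps / 4 by rewrite divr_gt0 // mulr_gt0.
  have p3 : 0 < A / 32 / 32 by rewrite !divr_gt0.
  have p4 : 0 < A * d / (64 * R0) by rewrite divr_gt0 // mulr_gt0.
  by rewrite !lt_min p1 p2 p3 p4.
pose s := Num.min (Num.min 1 (rho / 4)) (q / M).
have s0 : 0 < s.
  have p1 : 0 < rho / 4 by rewrite divr_gt0.
  have p2 : 0 < q / M by apply: divr_gt0.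
  by rewrite !lt_min ltr01 p1 p2.
have sr : s <= rho / 4 by rewrite !ge_min lexx orbT.
have s11 : s <= 1 by rewrite !ge_min lexx.
have Ms : M * s <= q.
  have : s <= q / M by rewrite ge_min lexx orbT.
  by rewrite ler_pdivlMr // [s * M]mulrC.
have Ms2 : M * s ^+ 2 <= q.
  by apply: le_trans Ms; rewrite ler_wpM2l ?(ltW M0) // expr2 ger_pMr.
have q1 : q <= c / 32 / 10 by rewrite !ge_min lexx.
have q2 : q <= A * eps / 4 by rewrite !ge_min lexx orbT.
have q3 : q <= A / 32 / 32 by rewrite !ge_min lexx !orbT.
have q4 : q * (64 * R0) <= A * d.
  by rewrite -ler_pdivlMr // !ge_min lexx !orbT.
have Ms3 : 0 < M * s ^+ 3 by rewrite mulr_gt0 // exprn_gt0.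
pose w := Num.min (M * s ^+ 3) (eta / 2).
have w0 : 0 < w by rewrite lt_min Ms3 eta2.
have wM : w <= M * s ^+ 3 by rewrite ge_min lexx.
have we : w <= eta / 2 by rewrite ge_min lexx orbT.
have [I [zeta [k]]] := pot w w0; cbv zeta.
set T := \prod_i _; set N := (\sum_i k i)%N => -[N0 hz up lo].
have [a [b [T0 dT exT]]] := poly_expansion r0 hz N0.
rewrite -/T -/N in T0 dT exT.
have Nr : 0 < N%:R :> R by rewrite ltr0n.
have EM (z : R[i]) : 40 * (cmod z / rho) ^+ 3 = M * cmod z ^+ 3.
  by rewrite /M expr_div_n; ring.
have small x y : `|x| <= rho / 4 -> `|y| <= rho / 4 -> cmod (x +i* y)%C <= rho / 2.
  by move=> hx hy; apply: le_trans (cmod_le_sum _ _) _; move: hx hy; lra0.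
case: a b dT exT => a1 a2 [b1 b2] dT exT.
pose u1 := a1 - A * nx; pose u2 := a2 + A * ny.
pose v1 := b1 - c * (nx ^+ 2 - ny ^+ 2); pose v2 := b2 + 2 * c * nx * ny.
have HC x y : `|x| <= s -> `|y| <= s ->
  `|u1 * x - u2 * y + v1 * (x ^+ 2 - y ^+ 2) - 2 * v2 * x * y| <= w + M * cmod (x +i* y)%C ^+ 3.
  move=> hx hy.
  have hx4 : `|x| <= rho / 4 := le_trans hx sr; have hy4 : `|y| <= rho / 4 := le_trans hy sr.
  have hxR : `|x| <= R0 by move: hx4 rR r0; lra0.
  have hyR : `|y| <= R0 by move: hy4 rR r0; lra0.
  have [nz e1] := exT _ (small _ _ hx4 hy4).
  rewrite Re_quadratic EM in e1.
  have e2 := up _ _ hxR hyR nz; have e3 := lo _ _ hx4 hy4.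
  set l := lnm _ - lnm _ in e1 e2 e3.
  rewrite Unear // in e2 e3.
  set Q := _ - 2 * b2 * x * y in e1.
  set Qu := A * _ + _ in e2 e3.
  have -> : u1 * x - u2 * y + v1 * (x ^+ 2 - y ^+ 2) - 2 * v2 * x * y = Q - Qu.
    by rewrite /Q /Qu /u1 /u2 /v1 /v2; ring.
  rewrite -(ler_pM2l Nr) -{1}(gtr0_norm Nr) -normrM.
  move: e1; rewrite !ler_norml => /andP[p1 p2].
  by apply/andP; split; move: p1 p2 e2 e3; lra0.
have [U1 U2 V1 V2] := coef_bounds s0 M0 wM HC.
have {}U1 : `|u1| <= 2 * q by move: U1 Ms2; lra0.
have {}U2 : `|u2| <= 2 * q by move: U2 Ms2; lra0.
have {}V1 : `|v1| <= 2 * q by move: V1 Ms; lra0.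
have {}V2 : `|v2| <= 5 * q by move: V2 Ms; lra0.
pose nb : R[i] := (nx -i* ny)%C; pose a : R[i] := (a1 +i* a2)%C; pose b : R[i] := (b1 +i* b2)%C.
have cn : cmod nb = 1 by rewrite cmodE /= sqrrN n1 sqrtr1.
have cA : cmod A%:C%C = A by rewrite cmodE /= expr0n addr0 sqrtr_sqr gtr0_norm.
have aE : a = A%:C%C * nb + (u1 +i* u2)%C by rewrite /a /u1 /u2 /nb /=; congr (_ +i* _)%C; ring.
have cu : cmod (u1 +i* u2)%C <= 4 * q by apply: le_trans (cmod_le_sum _ _) _; move: U1 U2; lra0.
have aA : cmod a <= A + 4 * q.
  by rewrite aE; apply: le_trans (cmodD _ _) _; rewrite cmodM cA cn mulr1 lerD2l.
have Aa : A - 4 * q <= cmod a.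
  have := cmodD a (- (u1 +i* u2)%C); rewrite {1}aE addrK cmodM cA cn mulr1 cmodN.
  by move: cu; lra0.
have a0 : 0 < cmod a by move: Aa q3 A0; lra0.
pose o : R[i] := nb * a^*%C / (cmod a)%:C%C.
have ca : cmod (cmod a)%:C%C = cmod a by rewrite cmodE /= expr0n addr0 sqrtr_sqr gtr0_norm.
have cconj (z : R[i]) : cmod z^*%C = cmod z by case: z => z1 z2; rewrite !cmodE /= sqrrN.
have om : cmod o = 1 by rewrite !cmodM cmodV ca cconj cn mul1r divff // gt_eqF.
have an0 : (cmod a)%:C%C != 0 :> R[i] by rewrite -cmod_gt0 ca.
have conjE (z : R[i]) : z * z^*%C = (cmod z ^+ 2)%:C%C.
  by rewrite sqr_cmod; case: z => z1 z2 /=; congr (_ +i* _)%C; ring.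
have oa : o * a = (cmod a)%:C%C * nb.
  have -> : o * a = nb * (a * a^*%C) / (cmod a)%:C%C by rewrite /o; ring.
  by rewrite conjE rmorphXn /=; field.
have nbn : nb * nb^*%C = 1 by rewrite conjE cn expr1n.
have o1E : (o - 1) * (cmod a)%:C%C = (A - cmod a)%:C%C + nb * (u1 +i* u2)%C^*%C.
  have ac : a^*%C = A%:C%C * nb^*%C + (u1 +i* u2)%C^*%C.
    by rewrite /a /nb /u1 /u2 /=; congr (_ +i* _)%C; ring.
  by rewrite mulrBl mul1r /o divfK // ac mulrDr mulrCA nbn mulr1 rmorphB /=; ring.
have o1 : cmod (o - 1) <= 16 * q / A.
  have h1 : cmod ((o - 1) * (cmod a)%:C%C) <= 8 * q.
    rewrite o1E; apply: le_trans (cmodD _ _) _.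
    have -> : cmod (A - cmod a)%:C%C = `|A - cmod a| by rewrite cmodE /= expr0n addr0 sqrtr_sqr.
    rewrite cmodM cn mul1r cconj.
    have : `|A - cmod a| <= 4 * q by rewrite ler_norml; apply/andP; split; move: aA Aa; lra0.
    by move: cu; lra0.
  rewrite cmodM ca in h1; rewrite ler_pdivlMr //.
  have h2 : A / 2 <= cmod a by move: Aa q3 A0; lra0.
  by have := ler_wpM2l (cmod_ge0 (o - 1)) h2; move: h1; lra0.
have o64 : cmod (o - 1) <= 1 / 64.
  by apply: le_trans o1 _; rewrite ler_pdivrMr //; move: q3; lra0.
have oC : o = (Re o +i* Im o)%C by case: (o).
pose S := T.[0]^-1 *: (T \Po (o *: 'X)).
have o0 : o != 0 by rewrite -cmod_gt0 om.
have T0i : T.[0]^-1 != 0 by rewrite invr_eq0.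
have SE z : S.[z] = T.[0]^-1 * T.[o * z] by rewrite /S hornerZ horner_comp hornerZ hornerX.
exists S, N; split => //.
- rewrite size_scale // size_comp_poly2 ?size_prod_exp_XsubC //.
  by rewrite size_scale // size_polyX.
- move=> x y Kxy; rewrite SE; set z := (x +i* y)%C.
  have [->|nz] := eqVneq (T.[o * z]) 0; first by rewrite mulr0 cmod0.
  suff H : lnm T.[o * z] - lnm T.[0] <= 0.
    rewrite cmodM cmodV -!expR_lnm // -expRN -expRD.
    by rewrite expR_le1; move: H; lra0.
  have [x2 y2] := KR _ _ Kxy.
  have coz : cmod (o * z) = cmod z by rewrite cmodM om mul1r.
  have zR : cmod z <= R0 by apply: le_trans (cmod_le_sum _ _) _; move: x2 y2; lra0.
  have ozC : o * z = (Re (o * z) +i* Im (o * z))%C by case: (o * z).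
  have [far|] := boolP ((s1 < `|x|) || (s1 < `|y|)).
    have Ux := Keta _ _ Kxy far.
    have dz : cmod (z - o * z) < d.
      have -> : z - o * z = - ((o - 1) * z) by ring.
      rewrite cmodN cmodM.
      have : cmod (o - 1) * cmod z <= 16 * q / A * R0 by apply: ler_pM; rewrite ?cmod_ge0.
      move/le_lt_trans; apply; rewrite mulrAC ltr_pdivrMr // [ltRHS]mulrC.
      by move: q4; have := mulr_gt0 A0 d0; lra0.
    have xR : `|x| <= R0 by move: x2 R0p; lra0.
    have yR : `|y| <= R0 by move: y2 R0p; lra0.
    have dx : `|x - Re (o * z)| < d.
      by apply: le_lt_trans dz; have := normr_Re_le (z - o * z); rewrite ReD ReN.
    have dy : `|y - Im (o * z)| < d.
      apply: le_lt_trans dz; have := normr_Im_le (z - o * z).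
      by case: (o * z) => ? ?.
    have := hd _ _ _ _ xR yR dx dy; rewrite ler_norml => /andP[h1 _].
    have r1 : `|Re (o * z)| <= R0 by apply: le_trans (normr_Re_le _) _; rewrite coz.
    have r2 : `|Im (o * z)| <= R0 by apply: le_trans (normr_Im_le _) _; rewrite coz.
    have nz' := nz; rewrite ozC in nz'; have := up _ _ r1 r2 nz'; rewrite -ozC.
    move=> /le_trans; apply; rewrite mulr_ge0_le0 //.
    by move: h1 Ux we; lra0.
  rewrite negb_or -!leNgt => /andP[xs ys].
  have zs : cmod z <= 2 * s1 by apply: le_trans (cmod_le_sum _ _) _; move: xs ys; lra0.
  have zr : cmod (o * z) <= rho / 2 by rewrite coz; move: zs s1a; lra0.
  have [_] := exT _ zr; rewrite EM coz ler_norml => /andP[_].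
  set l := lnm _ - lnm _; set Q := Re _ => hl.
  have MZ : M * cmod z ^+ 3 <= c / 16 * cmod z ^+ 2.
    rewrite exprS mulrA ler_wpM2r ?sqr_ge0 //.
    by have := ler_wpM2l (ltW M0) zs; move: s1c; lra0.
  have a2A : cmod a <= 2 * A by move: aA q3 A0; lra0.
  have hb : cmod ((b1 +i* b2)%C - c%:C%C * (nx -i* ny)%C ^+ 2) <= c / 32.
    have -> : (b1 +i* b2)%C - c%:C%C * (nx -i* ny)%C ^+ 2 = (v1 +i* v2)%C.
      by rewrite expr2 /v1 /v2 /=; congr (_ +i* _)%C; ring.
    by apply: le_trans (cmod_le_sum _ _) _; move: V1 V2 q1 c0; lra0.
  have Yb : `|x * nx + y * ny| <= C0 * (x * ny - y * nx) ^+ 2.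
    by apply: Kn => //; [move: xs|move: ys]; move: s1b; lra0.
  have Cz : C0 * cmod z <= 1 / 4.
    by have := ler_wpM2l C00 zs; move: s1d; lra0.
  have := @rotated_quadratic_le0 nx ny A c C0 a1 a2 b1 b2 (M * cmod z ^+ 3) x y (Re o) (Im o)
    n1 A0 c0 C00 AC a2A.
  rewrite -oC => /(_ oa o64 om hb MZ Yb Cz); rewrite -/z -/Q => hQ.
  have := ler_wpM2l (ltW Nr) hQ; move: hl; lra0.
- by rewrite SE mulr0 mulVf // cmod1.
- have -> : S^`().[0] = N%:R * a * o.
    rewrite /S derivZ deriv_comp derivZ derivX !(hornerZ, hornerM, horner_comp, hornerX, hornerC).
    by rewrite mulr0 dT -/a mulr1; field.
  rewrite cmodM om mulr1 cmodM cmod_nat ler_wpM2l //.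
  by move: Aa q2; lra0.
Qed.

End Touching.

(** * Green's function near a smooth point *)

Section Assembly.
Context {R : realType}.
Implicit Types (g : R -> R -> R) (K : R -> R -> Prop).

(** The only form in which harmonicity is used: a mesh threshold uniform over the points of a
    bounded box that keep a given distance from K. *)
Definition harmonic_off K g := forall rho d eta : R, 0 < d -> 0 < eta ->
  exists2 h0, 0 < h0 & forall h, 0 < h -> h < h0 -> forall x y, `|x| <= rho -> `|y| <= rho ->
    (forall kx ky, K kx ky -> d <= `|x - kx| \/ d <= `|y - ky|) ->
    `|dlap h g x y| <= eta * h ^+ 2.

Definition flat_at0 K (nx ny C0 rK : R) := forall x y, K x y -> `|x| <= rK -> `|y| <= rK ->
  `|x * nx + y * ny| <= C0 * (x * ny - y * nx) ^+ 2.

(** Rescaling by [r = W / ka] brings the point to distance [ka = nu / 8], whose square is exactly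
    [mu / 64] for [mu = nu ^+ 2]. In these coordinates K is confined to a parabola of curvature of
    order [C0 * r], below the level [bot'] when [r] is small, so [sharp_harnack] applies. The losses
    are [(1 - mu) * (1 - nu) >= 1 - 2 * nu]. *)
Lemma cone_estimate g K (nx ny C0 rK L nu eta : R) :
  nx ^+ 2 + ny ^+ 2 = 1 -> 0 < L -> 0 <= C0 -> 0 < rK -> 0 < nu -> nu <= 1 -> 0 < eta -> eta <= 1 ->
  (forall x y, 0 <= g x y) -> (forall rho, ucont_on rho g) -> (forall rho, bounded_on rho g) ->
  harmonic_off K g -> flat_at0 K nx ny C0 rK ->
  (forall e, 0 < e -> exists2 t0, 0 < t0 & forall t, 0 < t -> t < t0 ->
     (L - e) * t <= g (t * nx) (t * ny)) ->
  exists2 r0, 0 < r0 & forall x y W, 0 < W -> W < r0 -> W ^+ 2 = x ^+ 2 + y ^+ 2 ->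
     eta * W <= x * nx + y * ny -> (1 - 2 * nu) * L * (x * nx + y * ny) <= g x y.
Proof.
move=> n1 L0 C00 rK0 nu0 nu1 eta0 eta1 g0 gc gb gh flat gL.
pose mu := nu ^+ 2; pose ka := nu / 8; pose y0 := eta * ka / 2.
have mu0 : 0 < mu by rewrite exprn_gt0.
have mu1 : mu <= 1 by rewrite expr_le1 // ltW.
have mun : mu <= nu by rewrite /mu expr2 ger_pMr.
have ka0 : 0 < ka by rewrite divr_gt0.
have y00 : 0 < y0 by rewrite divr_gt0 // mulr_gt0.
have hp : harnack_params nx ny mu y0 by split.
have b0 := bot'_gt0 hp; set b := bot' mu y0 in b0.
have L5 := Lam_ge hp; have L'5 := Lam'_ge hp.
set l := Lam' mu in L'5.
have l1 : 1 <= l + 1 by move: L5 L'5; lra0.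
have nuL : 0 < nu * L by rewrite mulr_gt0.
have [t0 t00 ht] := gL _ nuL.
pose r1 := Num.min t0 (Num.min (rK / (l + 1)) (b / (16 * (C0 + 1) * (l + 1) ^+ 2))).
have l0 : 0 < l + 1 by move: l1; lra0.
have D0 : 0 < 16 * (C0 + 1) * (l + 1) ^+ 2.
  by rewrite mulr_gt0 ?exprn_gt0 // mulr_gt0 //; move: C00; lra0.
have r10 : 0 < r1.
  have p1 : 0 < rK / (l + 1) by apply: divr_gt0.
  have p2 : 0 < b / (16 * (C0 + 1) * (l + 1) ^+ 2) by apply: divr_gt0.
  by rewrite !lt_min t00 p1 p2.
exists (ka * r1); first by rewrite mulr_gt0.
move=> x y W W0 Wr W2 hY.
pose r := W / ka.
have rr0 : 0 < r by rewrite divr_gt0.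
have rr1 : r < r1 by rewrite ltr_pdivrMr // mulrC.
move: rr1; rewrite !lt_min => /andP[rt /andP[rk rb]].
rewrite ltr_pdivlMr // in rk; rewrite ltr_pdivlMr // in rb.
pose gr (x y : R) := g (r * x) (r * y).
have grc e : 0 < e -> exists2 d, 0 < d & forall x y x' y' : R, `|x| <= 2 -> `|y| <= 2 ->
     `|x - x'| < d -> `|y - y'| < d -> `|gr x y - gr x' y'| <= e.
  move=> e0; have [d d0 hd] := gc (r * 2) e e0.
  exists (d / r); first by rewrite divr_gt0.
  have nr v : `|r * v| = r * `|v| by rewrite normrM (gtr0_norm rr0).
  have sm v v' : `|v - v'| < d / r -> `|r * v - r * v'| < d.
    by rewrite -mulrBr nr ltr_pdivlMr // mulrC.
  move=> a b' a' b'' h1 h2 h3 h4; apply: hd; [| |exact: sm|exact: sm].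
    by rewrite nr ler_pM2l.
  by rewrite nr ler_pM2l.
have [Bg Bg0 hBg] := gb (r * l).
have grB a a' : inQ' nx ny mu y0 a a' -> gr a a' <= Bg.
  move=> /and3P[_ /ltW h1 /ltW h2]; apply: le_trans (ler_norm _) _.
  by apply: hBg; rewrite normrM (gtr0_norm rr0) ler_pM2l.
have grh e : 0 < e -> exists2 h0, 0 < h0 & forall h, 0 < h -> h < h0 ->
     forall a a', inQ' nx ny mu y0 a a' -> `|dlap h gr a a'| <= e * h ^+ 2.
  move=> e0; have d0 : 0 < r * b / 4 by rewrite divr_gt0 // mulr_gt0.
  have e'0 : 0 < e / r ^+ 2 by rewrite divr_gt0 // exprn_gt0.
  have [h0 h00 hh] := gh (r * l) _ _ d0 e'0.
  exists (h0 / r); first by rewrite divr_gt0.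
  move=> h hpos; rewrite ltr_pdivlMr // => hlt a a' /and3P[q1 q2 q3].
  have -> : dlap h gr a a' = dlap (h * r) g (r * a) (r * a').
    by rewrite /dlap /gr !mulrDr !mulrN ![r * h]mulrC.
  have -> : e * h ^+ 2 = e / r ^+ 2 * (h * r) ^+ 2 by field; rewrite gt_eqF.
  apply: hh => //; first by rewrite mulr_gt0.
  - by rewrite normrM (gtr0_norm rr0) ler_pM2l // ltW.
  - by rewrite normrM (gtr0_norm rr0) ler_pM2l // ltW.
  move=> kx ky Kk; have [?|n1'] := leP (r * b / 4) `|r * a - kx|; first by left.
  have [?|n2'] := leP (r * b / 4) `|r * a' - ky|; first by right.
  exfalso.
  have b1 : b <= 1.
    have s1 := slope_le hp; have s2 := slope_gt0 hp.
    have y1 : y0 <= 1.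
      have ka1 : ka <= 1 by rewrite /ka; move: nu1; lra0.
      have ek : eta * ka <= 1 * 1 by apply: ler_pM; rewrite ?(ltW ka0) ?(ltW eta0).
      by rewrite /y0; move: ek; lra0.
    have b2 : bot y0 * slope mu <= 1 / 4 * (1 / 4).
      by apply: ler_pM; rewrite ?(ltW (bot_gt0 hp)) ?(ltW s2) // /bot; move: y1; lra0.
    have y2 : y0 ^+ 2 <= 1 by rewrite expr_le1 // ltW.
    have := ler_pM (ltW (shift_gt0 hp)) (sqr_ge0 y0) b2 y2.
    by rewrite /b /bot' /shift; lra0.
  have sz (v v' : R) : `|v| < l -> `|r * v - v'| < r * b / 4 -> `|v'| <= r * (l + 1).
    move=> hv hv'; have := ler_normB (r * v) (r * v - v').
    have -> : r * v - (r * v - v') = v' by ring.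
    rewrite normrM (gtr0_norm rr0).
    have := ltW hv; rewrite -(ler_pM2l rr0); have := ler_wpM2l (ltW rr0) b1.
    by move: hv' rr0; lra0.
  have k1 := sz _ _ q2 n1'; have k2 := sz _ _ q3 n2'.
  have k1' : `|kx| <= rK by apply: le_trans k1 (ltW rk).
  have k2' : `|ky| <= rK by apply: le_trans k2 (ltW rk).
  have := flat _ _ Kk k1' k2'.
  have A : adj (r * b / 4) (r * a) (r * a') kx ky by split; exact: ltW.
  have := nrm_lip n1 A; rewrite /nrm.
  have nle (u v : R) : u ^+ 2 + v ^+ 2 = 1 -> `|u| <= 1.
    by move=> uv; apply: normr_le_sqr => //; have := sqr_ge0 v; rewrite expr1n; move: uv; lra0.
  have nx1 : `|nx| <= 1 := nle _ _ n1.
  have ny1 : `|ny| <= 1 by apply: (nle ny nx); rewrite addrC.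
  have X2 : (kx * ny - ky * nx) ^+ 2 <= (2 * (r * (l + 1))) ^+ 2.
    apply: sqr_le_norm; apply: le_trans (ler_normB _ _) _; rewrite !normrM.
    have := ler_pM (normr_ge0 _) (normr_ge0 _) k1 ny1.
    have := ler_pM (normr_ge0 _) (normr_ge0 _) k2 nx1; lra0.
  have CX : C0 * (kx * ny - ky * nx) ^+ 2 <= r * b / 4.
    apply: le_trans (ler_wpM2l C00 X2) _.
    have : r * (r * (16 * (C0 + 1) * (l + 1) ^+ 2)) <= r * b by rewrite ler_pM2l // ltW.
    have : 0 <= r ^+ 2 * (l + 1) ^+ 2 by rewrite mulr_ge0 ?sqr_ge0.
    lra0.
  have q1' : r * b < r * nrm nx ny a a' by rewrite ltr_pM2l.
  rewrite !ler_norml => /andP[_ c1] /andP[_ c2].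
  by move: CX q1' c1 c2; have := mulr_gt0 rr0 b0; rewrite /nrm; lra0.
have wz : (x / r) ^+ 2 + (y / r) ^+ 2 <= mu / 64.
  rewrite !expr_div_n -mulrDl -W2 /r le_eqVlt; apply/orP; left; apply/eqP.
  by rewrite /mu /ka; field; rewrite !gt_eqF.
have Yz : nrm nx ny (x / r) (y / r) = (x * nx + y * ny) / r by rewrite /nrm; ring.
have Yw : 2 * y0 <= nrm nx ny (x / r) (y / r).
  rewrite Yz ler_pdivlMr //; apply: le_trans hY.
  by rewrite /y0 /r le_eqVlt; apply/orP; left; apply/eqP; field; rewrite gt_eqF.
have gr0 a a' : 0 <= gr a a' by exact: g0.
have := sharp_harnack hp gr0 grc grB grh wz Yw.
rewrite Yz {2}/gr ![r * (_ / r)]mulrC !divfK ?gt_eqF //.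
move=> /(le_trans _); apply.
have := ht r rr0 rt; rewrite -/(gr nx ny) => gn.
have Y0 : 0 <= x * nx + y * ny by apply: le_trans hY; rewrite mulr_ge0 ?ltW.
rewrite (_ : (1 - mu) * gr nx ny * ((x * nx + y * ny) / r) = ((1 - mu) * gr nx ny / r) * (x * nx + y * ny)); last by ring.
rewrite ler_wpM2r // ler_pdivlMr //.
have m1 : 0 <= 1 - mu by move: mu1; lra0.
apply: le_trans (ler_wpM2l m1 gn).
rewrite [leRHS](_ : _ = (1 - mu) * (1 - nu) * (L * r)); last by ring.
rewrite -[leLHS]mulrA ler_wpM2r //; first by rewrite mulr_ge0 // ltW.
have := mulr_ge0 (ltW mu0) (ltW nu0); move: mun; lra0.
Qed.

End Assembly.

Section GreenTouching.
Context {R : realType}.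
Implicit Types (g : R -> R -> R) (K : R -> R -> Prop).

Definition hyperbolic (nx ny A c x y : R) : R :=
  A * (x * nx + y * ny) + c * ((x * nx + y * ny) ^+ 2 - (x * ny - y * nx) ^+ 2).

(** Exactly 0, and not merely [o(h ^+ 2)]: the glued function therefore carries no mass near 0, and
    the polynomial gets no root there. *)
Lemma dlap_hyperbolic nx ny A c h x y : dlap h (hyperbolic nx ny A c) x y = 0 :> R.
Proof. by rewrite /dlap /hyperbolic; ring. Qed.

Lemma nrm_pair_sqr (nx ny x y : R) : nx ^+ 2 + ny ^+ 2 = 1 ->
  x ^+ 2 + y ^+ 2 = (x * nx + y * ny) ^+ 2 + (x * ny - y * nx) ^+ 2.
Proof. by move=> n1; rewrite -[LHS]mulr1 -n1; ring. Qed.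

Lemma normal_le1 (nx ny : R) : nx ^+ 2 + ny ^+ 2 = 1 -> `|nx| <= 1 /\ `|ny| <= 1.
Proof.
move=> n1; have := sqr_ge0 nx; have := sqr_ge0 ny => p q.
by split; apply: normr_le_sqr => //; rewrite expr1n; move: p q n1; lra0.
Qed.

Lemma hyperbolic_ucont nx ny A c rho : nx ^+ 2 + ny ^+ 2 = 1 ->
  ucont_on rho (hyperbolic nx ny A c).
Proof.
move=> /normal_le1[nx1 ny1] w w0.
pose K := 2 * `|A| + `|c| * (16 * `|rho| + 16) + 1.
have K0 : 0 < K.
  by have := normr_ge0 A; have := mulr_ge0 (normr_ge0 c) (normr_ge0 rho); have := normr_ge0 c; rewrite /K; lra0.
exists (Num.min 1 (w / K)); first by rewrite lt_min ltr01 divr_gt0.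
move=> x y x' y' hx hy; rewrite !lt_min => /andP[x1 x2] /andP[y1 y2].
pose d := Num.max `|x - x'| `|y - y'|.
have dx : `|x - x'| <= d by rewrite le_max lexx.
have dy : `|y - y'| <= d by rewrite le_max lexx orbT.
have d1 : d <= 1 by rewrite ge_max !ltW.
have dw : d <= w / K by rewrite ge_max !ltW.
have d0 : 0 <= d := le_trans (normr_ge0 _) dx.
have lin (u v p q : R) : `|u| <= 1 -> `|v| <= 1 -> forall e, `|p| <= e -> `|q| <= e ->
    `|p * u + q * v| <= 2 * e.
  move=> u1 v1 e pe qe; apply: le_trans (ler_normD _ _) _; rewrite !normrM.
  have := ler_pM (normr_ge0 _) (normr_ge0 _) pe u1.
  have := ler_pM (normr_ge0 _) (normr_ge0 _) qe v1; lra0.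
pose Y x y : R := x * nx + y * ny; pose X x y : R := x * ny + y * - nx.
have nx1' : `|- nx| <= 1 by rewrite normrN.
have hxr : `|x| <= `|rho| by apply: le_trans hx (ler_norm _).
have hyr : `|y| <= `|rho| by apply: le_trans hy (ler_norm _).
have YE : Y x y - Y x' y' = (x - x') * nx + (y - y') * ny by rewrite /Y; ring.
have XE : X x y - X x' y' = (x - x') * ny + (y - y') * - nx by rewrite /X; ring.
have Yd : `|Y x y - Y x' y'| <= 2 * d by rewrite YE; exact: lin.
have Xd : `|X x y - X x' y'| <= 2 * d by rewrite XE; exact: lin.
have Yb : `|Y x y| <= 2 * `|rho| by exact: lin.
have Xb : `|X x y| <= 2 * `|rho| by exact: lin.
have sq (a b : R) : `|a| <= 2 * `|rho| -> `|a - b| <= 2 * d ->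
    `|a ^+ 2 - b ^+ 2| <= (4 * `|rho| + 4) * (2 * d).
  move=> ha hb; have -> : a ^+ 2 - b ^+ 2 = (2 * a - (a - b)) * (a - b) by ring.
  rewrite normrM ler_pM //; apply: le_trans (ler_normB _ _) _.
  by rewrite normrM (ger0_norm (ler0n _ 2)); move: ha hb d1; lra0.
have -> : hyperbolic nx ny A c x y - hyperbolic nx ny A c x' y' =
    A * (Y x y - Y x' y') + c * ((Y x y ^+ 2 - Y x' y' ^+ 2) - (X x y ^+ 2 - X x' y' ^+ 2)).
  by rewrite /hyperbolic /Y /X; ring.
apply: le_trans (ler_normD _ _) _; rewrite !normrM.
have s1 := sq _ _ Yb Yd; have s2 := sq _ _ Xb Xd.
have s3 : `|(Y x y ^+ 2 - Y x' y' ^+ 2) - (X x y ^+ 2 - X x' y' ^+ 2)| <= (16 * `|rho| + 16) * d.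
  by apply: le_trans (ler_normB _ _) _; move: s1 s2; lra0.
apply: (@le_trans _ _ (K * d)).
  have := ler_wpM2l (normr_ge0 A) Yd; have := ler_wpM2l (normr_ge0 c) s3.
  by rewrite /K; move: d0; lra0.
by rewrite mulrC -ler_pdivlMr.
Qed.

Lemma hyperbolic_bounded nx ny A c rho : nx ^+ 2 + ny ^+ 2 = 1 ->
  bounded_on rho (hyperbolic nx ny A c).
Proof.
move=> /normal_le1[nx1 ny1].
exists (`|A| * (2 * `|rho|) + `|c| * (8 * `|rho| ^+ 2)).
  by rewrite addr_ge0 // mulr_ge0 // mulr_ge0 // sqr_ge0.
move=> x y hx hy.
have hxr : `|x| <= `|rho| by apply: le_trans hx (ler_norm _).
have hyr : `|y| <= `|rho| by apply: le_trans hy (ler_norm _).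
have l1 : `|x * nx + y * ny| <= 2 * `|rho|.
  apply: le_trans (ler_normD _ _) _; rewrite !normrM.
  have := ler_pM (normr_ge0 _) (normr_ge0 _) hxr nx1.
  have := ler_pM (normr_ge0 _) (normr_ge0 _) hyr ny1; lra0.
have l2 : `|x * ny - y * nx| <= 2 * `|rho|.
  apply: le_trans (ler_normB _ _) _; rewrite !normrM.
  have := ler_pM (normr_ge0 _) (normr_ge0 _) hxr ny1.
  have := ler_pM (normr_ge0 _) (normr_ge0 _) hyr nx1; lra0.
rewrite /hyperbolic; apply: le_trans (ler_normD _ _) _; rewrite !normrM.
apply: lerD; first by rewrite ler_wpM2l.
rewrite ler_wpM2l //; apply: le_trans (ler_normB _ _) _.
rewrite !(ger0_norm (sqr_ge0 _)); have := sqr_le_norm l1; have := sqr_le_norm l2.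
have -> : (2 * `|rho|) ^+ 2 = 4 * `|rho| ^+ 2 by ring.
lra0.
Qed.

(* With W = |(x, y)| in [r / 2, 2 r] and s = Y / W the sine of the angle to the
   tangent, the barrier at (x, y) is W (A s + c W (2 s ^ 2 - 1)). *)
Lemma hyperbolic_barrier g (nx ny L e r0 r : R) :
  nx ^+ 2 + ny ^+ 2 = 1 -> 0 < L -> 0 < e -> e <= 1 / 4 -> 0 < r -> 2 * r < r0 ->
  (forall x y W, 0 < W -> W < r0 -> W ^+ 2 = x ^+ 2 + y ^+ 2 ->
     e / 64 * W <= x * nx + y * ny -> (1 - e / 4) * L * (x * nx + y * ny) <= g x y) ->
  exists2 kappa, 0 < kappa & barrier g (hyperbolic nx ny ((1 - e) * L) (e / 4 * L / (2 * r))) r kappa.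
Proof.
move=> n1 L0 e0 e4 r0' rr cone.
pose kappa := r / 2 * L * (e / 64) * (e / 64).
have e64 : 0 < e / 64 by rewrite divr_gt0.
have k0 : 0 < kappa by rewrite /kappa; do 3! apply: mulr_gt0 => //; apply: divr_gt0.
exists kappa => // x y hx hy hr.
have W20 : 0 <= x ^+ 2 + y ^+ 2 by rewrite addr_ge0 ?sqr_ge0.
pose W := Num.sqrt (x ^+ 2 + y ^+ 2).
have W2 : W ^+ 2 = x ^+ 2 + y ^+ 2 by rewrite sqr_sqrtr.
have W0 : 0 <= W by exact: sqrtr_ge0.
have r2 : 0 <= r / 2 by rewrite divr_ge0 // ltW.
have Wlo : r / 2 <= W.
  rewrite -ler_sqr ?nnegrE // W2.
  by have := sqr_ge0 x; have := sqr_ge0 y; case/orP: hr => /(le_norm_sqr r2); lra0.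
have Whi : W <= 2 * r.
  rewrite -ler_sqr ?nnegrE ?mulr_ge0 ?(ltW r0') // W2.
  have := sqr_le_norm (ltW hx); have := sqr_le_norm (ltW hy); have := sqr_ge0 r.
  by rewrite exprMn; lra0.
have Wp : 0 < W by apply: lt_le_trans Wlo; rewrite divr_gt0.
rewrite /hyperbolic.
set Y := x * nx + y * ny; set X := x * ny - y * nx.
have XE : X ^+ 2 = W ^+ 2 - Y ^+ 2 by rewrite W2 (nrm_pair_sqr x y n1) -/Y -/X; ring.
pose s := Y / W.
have YE : Y = s * W by rewrite /s divfK // gt_eqF.
pose v := W / (2 * r).
have r20 : 0 < 2 * r by rewrite mulr_gt0.
have v1 : v <= 1 by rewrite ler_pdivrMr // mul1r.
have v4 : 1 / 4 <= v by rewrite ler_pdivlMr //; move: Wlo; lra0.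
have HE : (1 - e) * L * Y + e / 4 * L / (2 * r) * (Y ^+ 2 - X ^+ 2) =
   W * L * ((1 - e) * s + e / 4 * v * (2 * s ^+ 2 - 1)).
  rewrite XE YE /v; field; rewrite gt_eqF //.
rewrite HE.
have s2 : s ^+ 2 <= 1.
  rewrite /s expr_div_n ler_pdivrMr ?exprn_gt0 // mul1r W2 (nrm_pair_sqr x y n1) -/Y.
  by rewrite lerDl sqr_ge0.
have s1 : -1 <= s <= 1.
  by rewrite -ler_norml; apply: normr_le_sqr => //; rewrite expr1n.
case/andP: s1 => s1 s1'.
have WL : 0 < W * L by rewrite mulr_gt0.
have kW (t : R) : e / 64 * (e / 64) <= t -> kappa <= W * L * t.
  move=> ht; have h1 : r / 2 * L <= W * L by rewrite ler_wpM2r // ltW.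
  apply: (@le_trans _ _ (W * L * (e / 64 * (e / 64)))).
    by rewrite /kappa -mulrA ler_wpM2r // mulr_ge0 // ltW.
  by rewrite ler_wpM2l // ltW.
have ee : e / 64 * (e / 64) <= e / 64 by rewrite ger_pMr //; move: e4; lra0.
have v0 : 0 <= v by apply: le_trans v4; rewrite divr_ge0.
have e40 : 0 <= e / 4 by apply: divr_ge0 => //; exact: ltW.
have ev : 0 <= e / 4 * v by exact: (mulr_ge0 e40 v0).
have ev1 : e / 4 * v <= e / 4 by rewrite ler_piMr.
have ev4 : e / 16 <= e / 4 * v.
  by have := ler_wpM2l (ltW e0) v4; lra0.
(* For [s >= e / 64] the cone estimate applies, and [3 / 4 * e * s] minus the quadratic term, at
   most [e / 4 * s], leaves [e / 2 * s]. For smaller [s] the function itself is negative: the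
   quadratic term contributes at most [- e / 32] against a linear term below [e / 64], except when
   [s <= - (1 / 2)], where the linear term decides. *)
have [sb|sl] := leP (e / 64) s.
  right; have Yb : e / 64 * W <= Y by rewrite YE ler_wpM2r.
  have := cone x y W Wp (le_lt_trans Whi rr) W2 Yb; rewrite -/Y YE => hg.
  rewrite lerBrDr; apply: le_trans hg.
  have s0 : 0 < s := lt_le_trans e64 sb.
  have key : e / 64 * (e / 64) <= (1 - e / 4) * s - ((1 - e) * s + e / 4 * v * (2 * s ^+ 2 - 1)).
    have h1 : e / 4 * v * (2 * s ^+ 2 - 1) <= e / 4 * s.
      have h2 : 2 * s ^+ 2 - 1 <= s.
        have : 0 <= (1 - s) * (2 * s + 1) by rewrite mulr_ge0 //; move: s1' s0; lra0.
        lra0.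
      have h3 := ler_wpM2l ev h2.
      by apply: le_trans h3 _; rewrite ler_wpM2r // ltW.
    have h4 : e / 64 * (e / 64) <= e / 2 * s.
      by apply: ler_pM; rewrite ?(ltW e64) //; move: e0; lra0.
    by move: h1 h4; lra0.
  have := kW _ key; lra0.
left.
have key : e / 64 * (e / 64) <= - ((1 - e) * s + e / 4 * v * (2 * s ^+ 2 - 1)).
  apply: le_trans ee _.
  have [s0|s0] := leP 0 s.
    have sm : s <= 1 / 4 by move: sl e4; lra0.
    have ss : s ^+ 2 <= 1 / 4.
      by rewrite expr2; apply: le_trans (ler_pM s0 s0 sm sm) _; lra0.
    have h1 : e / 16 * (1 / 2) <= e / 4 * v * (1 - 2 * s ^+ 2).
      apply: ler_pM => //; first by rewrite divr_ge0 // ltW.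
      by move: ss; lra0.
    have h2 : (1 - e) * s <= s by rewrite ler_piMl //; move: e0; lra0.
    by move: h1 h2 sl e0; lra0.
  have [sh|sh] := leP s (- (1 / 2)).
    have h1 : e / 4 * v * (2 * s ^+ 2 - 1) <= e / 4 * (- s).
      have h2 : 2 * s ^+ 2 - 1 <= - s.
        have : 0 <= (1 + s) * (1 - 2 * s) by rewrite mulr_ge0 //; move: s1 s0; lra0.
        lra0.
      have h3 := ler_wpM2l ev h2.
      by apply: le_trans h3 _; rewrite ler_wpM2r //; move: s0; lra0.
    have h4 : (1 - 5 / 4 * e) * (1 / 2) <= (1 - 5 / 4 * e) * (- s).
      by rewrite ler_wpM2l //; move: e4 sh; lra0.
    by move: h1 h4 e4 e0; lra0.
  have ss : s ^+ 2 <= 1 / 4.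
    have : `|s| <= 1 / 2 by rewrite ler_norml; apply/andP; split; move: s0 sh; lra0.
    by move=> /sqr_le_norm; rewrite (_ : (1 / 2) ^+ 2 = 1 / 4 :> R); [lra0 | field].
  have h1 : e / 16 * (1 / 2) <= e / 4 * v * (1 - 2 * s ^+ 2).
    apply: ler_pM => //; first by rewrite divr_ge0 // ltW.
    by move: ss; lra0.
  have h2 : (1 - e) * s <= 0 by rewrite mulr_ge0_le0 //; [move: e4; lra0 | exact: ltW].
  by move: h1 h2 e0; lra0.
by have := kW _ key; rewrite mulrN; lra0.
Qed.

Lemma harmonic_away K g rho d eta :
  (forall rho, ucont_on rho g) -> (forall x y, K x y -> g x y = 0) -> harmonic_off K g ->
  0 < d -> 0 < eta -> exists2 h0, 0 < h0 & forall h, 0 < h -> h < h0 ->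
  forall x y, `|x| <= rho -> `|y| <= rho -> d <= g x y -> `|dlap h g x y| <= eta * h ^+ 2.
Proof.
move=> gc gK gh d0 eta0.
have d2 : 0 < d / 2 by rewrite divr_gt0.
have [d' d'0 hd] := gc rho _ d2.
have [h0 h00 hh] := gh rho _ _ d'0 eta0; exists h0 => // h hp hlt x y hx hy dg.
apply: hh => // kx ky kk.
have [|h1] := leP d' `|x - kx|; first by left.
have [|h2] := leP d' `|y - ky|; first by right.
have := hd _ _ _ _ hx hy h1 h2; rewrite (gK _ _ kk) subr0 => h3.
by have := ler_norm (g x y); move: h3 dg d0; lra0.
Qed.

(** With [e = eps / 4] the losses are a factor [1 - e] in the slope, [1 / (1 + e)] from the
    normalization of the mass and [1 - e] in [touching_poly]; together
    [(1 - e) ^+ 2 / (1 + e) >= 1 - 4 * e]. *)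
Lemma green_touching g K (nx ny C0 rK L Rk M r1 eps : R) :
  nx ^+ 2 + ny ^+ 2 = 1 -> 0 < L -> 0 <= C0 -> 0 < rK ->
  (forall x y, 0 <= g x y) -> (forall x y, K x y -> g x y = 0) ->
  (forall rho, ucont_on rho g) -> (forall rho, bounded_on rho g) ->
  harmonic_off K g -> flat_at0 K nx ny C0 rK -> K 0 0 ->
  (forall x y, r1 <= x ^+ 2 + y ^+ 2 -> g x y <= ln (x ^+ 2 + y ^+ 2) / 2 + M) ->
  (forall x y, K x y -> `|x| <= Rk /\ `|y| <= Rk) ->
  (forall e, 0 < e -> exists2 t0, 0 < t0 & forall t, 0 < t -> t < t0 ->
     (L - e) * t <= g (t * nx) (t * ny)) ->
  0 < eps -> eps <= 1 -> exists (T : {poly R[i]}) (N : nat),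
  [/\ (0 < N)%N, size T = N.+1, forall x y, K x y -> cmod T.[(x +i* y)%C] <= 1,
      cmod T.[0] = 1 & N%:R * (L * (1 - eps)) <= cmod T^`().[0]].
Proof.
move=> n1 L0 C00 rK0 g0 gK gc gb gh flat K0 growth Kb gL eps0 eps1.
pose e := eps / 4.
have e0 : 0 < e by rewrite divr_gt0.
have e4 : e <= 1 / 4 by rewrite ler_wpM2r.
have nu0 : 0 < e / 8 by rewrite divr_gt0.
have eta0 : 0 < e / 64 by rewrite divr_gt0.
have nu1 : e / 8 <= 1 by move: e4; lra0.
have eta1 : e / 64 <= 1 by move: e4; lra0.
have [r0 r00 cone] := cone_estimate n1 L0 C00 rK0 nu0 nu1 eta0 eta1 g0 gc gb gh flat gL.
have D0 : 0 < 8 * (C0 + 1) by move: C00; lra0.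
pose r := Num.min rK (Num.min (r0 / 4) (e / 16 / (8 * (C0 + 1)))).
have rp : 0 < r.
  have p1 : 0 < r0 / 4 by rewrite divr_gt0.
  have p2 : 0 < e / 16 / (8 * (C0 + 1)) by apply: divr_gt0 => //; rewrite divr_gt0.
  by rewrite !lt_min rK0 p1 p2.
have [rrK rr0 rC] : [/\ r <= rK, 2 * r < r0 & r * (8 * (C0 + 1)) <= e / 16].
  split; first by rewrite ge_min lexx.
    have : r <= r0 / 4 by rewrite !ge_min lexx !orbT.
    by move: r00; lra0.
  by rewrite -ler_pdivlMr // !ge_min lexx !orbT.
(* The barrier dictates the product [c * r]; the bound [r * (8 * (C0 + 1)) <= e / 16] then makes [c]
   exceed [16 * A * C0]. *)
pose A := (1 - e) * L; pose c := e / 4 * L / (2 * r).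
have e1 : 0 < 1 - e by move: e4; lra0.
have A0 : 0 < A by apply: mulr_gt0.
have r20 : 0 < 2 * r by rewrite mulr_gt0.
have c0 : 0 < c by apply: divr_gt0 => //; apply: mulr_gt0 => //; rewrite divr_gt0.
have AL : A <= L by rewrite ler_piMl // ?(ltW L0) //; move: e0; lra0.
have rC0 : 0 <= r * C0 by rewrite mulr_ge0 // ltW.
have cA : 16 * A * C0 <= c.
  have h1 : 16 * A * C0 <= 16 * L * C0 by rewrite ler_wpM2r // ler_wpM2l.
  apply: (le_trans h1); rewrite /c ler_pdivlMr //.
  have h2 : 8 * (r * C0) <= e / 16 by move: rC rp; lra0.
  have := ler_wpM2r (ltW L0) h2; lra0.
have C0r : C0 * (2 * r) <= 1 / 4 by move: rC e4 rp rC0; lra0.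
have cone' x y W : 0 < W -> W < r0 -> W ^+ 2 = x ^+ 2 + y ^+ 2 ->
   e / 64 * W <= x * nx + y * ny -> (1 - e / 4) * L * (x * nx + y * ny) <= g x y.
  move=> h1 h2 h3 h4; have := cone _ _ _ h1 h2 h3 h4.
  by rewrite (_ : 2 * (e / 8) = e / 4) //; field.
have [kappa k0 bar] := hyperbolic_barrier n1 L0 e0 e4 rp rr0 cone'.
rewrite -/A -/c in bar; set hq := hyperbolic nx ny A c in bar.
have hqc rho : ucont_on rho hq by exact: hyperbolic_ucont.
have hqb rho : bounded_on rho hq by exact: hyperbolic_bounded.
have hq0 : hq 0 0 = 0 by rewrite /hq /hyperbolic; ring.
pose delta := Num.min 1 kappa.
have d0 : 0 < delta by rewrite lt_min ltr01 k0.
have d1 : delta <= 1 by rewrite ge_min lexx.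
have dk : delta <= kappa by rewrite ge_min lexx orbT.
have d40 : 0 < delta / 4 by rewrite divr_gt0.
have [rho1 rh0 [rhr near]] : exists2 rho1, 0 < rho1 & rho1 <= r /\
    forall x y, `|x| < rho1 -> `|y| < rho1 -> g x y <= delta / 4 /\ - (delta / 4) <= hq x y.
  have [t1 t10 h1] := gc 0 _ d40; have [t2 t20 h2] := hqc 0 _ d40.
  exists (Num.min r (Num.min t1 t2)); first by rewrite lt_min rp lt_min t10 t20.
  split; first by rewrite ge_min lexx.
  move=> x y; rewrite lt_min => /andP[_]; rewrite lt_min => /andP[x1 x2].
  rewrite lt_min => /andP[_]; rewrite lt_min => /andP[y1 y2].
  have := h1 0 0 x y; have := h2 0 0 x y.
  rewrite normr0 lexx !sub0r !normrN hq0 (gK _ _ K0) !sub0r !normrN.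
  move=> /(_ isT isT x2 y2) q2 /(_ isT isT x1 y1) q1.
  by move: q1 q2; rewrite !ler_norml => /andP[_ ->] /andP[-> _].
have Rk0 : 0 <= Rk by have [+ _] := Kb _ _ K0; rewrite normr0.
pose R0 := 2 * (Rk + r + 1).
have rR0 : r <= R0 by rewrite /R0; move: Rk0 rp; lra0.
have R00 : 0 < R0 by apply: lt_le_trans rR0.
have harm rho d eta (d'0 : 0 < d) (eta'0 : 0 < eta) := @harmonic_away K g rho d eta gc gK gh d'0 eta'0.
have e1' : e <= 1 by move: e4; lra0.
have dhq h x y : dlap h hq x y = 0 by exact: dlap_hyperbolic.
have [s [B [s0 sR pot]]] := potential bar rp rR0 d0 d1 dk e0 e1' rh0 rhr g0 gc hqc gb hqb dhq harm
  growth near.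
have sz x y : `|x| <= R0 -> `|y| <= R0 -> s * (x ^+ 2 + y ^+ 2) <= delta / 8.
  move=> hx hy; apply: (le_trans _ sR); rewrite ler_pM2l //.
  have := sqr_le_norm hx; have := sqr_le_norm hy.
  have h : R0 ^+ 2 <= (R0 + 2) ^+ 2 by rewrite ler_sqr ?nnegrE; move: R00; lra0.
  by move: h; lra0.
have te0 : 0 < 1 + e by move: e0; lra0.
pose U x y := uloc g hq r s delta x y / (1 + e).
have near_mid x y : `|x| < rho1 -> `|y| < rho1 -> uloc g hq r s delta x y = hq x y.
  move=> hx hy; have [ng nh] := near _ _ hx hy.
  rewrite /uloc /glue ifT; last by rewrite /box; apply/andP; split; [move: hx|move: hy]; move: rhr; lra0.
  apply: max_l; rewrite /mid ge_max; apply/andP; split; last by move: nh d0; lra0.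
  have hR := le_trans rhr rR0.
  have := sz x y (le_trans (ltW hx) hR) (le_trans (ltW hy) hR); move: ng nh d0; lra0.
have U00 : U 0 0 = 0 by rewrite /U near_mid ?normr0 // hq0 mul0r.
have rh20 : 0 < rho1 / 2 by rewrite divr_gt0.
have rhR : rho1 / 2 <= R0 by move: rhr rR0 rh0; lra0.
have pot' w : 0 < w -> exists (se h : R) (N : nat) (m : int -> int -> R),
    [/\ 0 < se, se <= w, 0 < h, forall a b, 0 <= m a b & 0 < bsum N m] /\
    [/\ forall x y, `|x| <= R0 -> `|y| <= R0 ->
       `|bsum N (fun a b => m a b * kk (se ^+ 2) (h * a%:~R - x) (h * b%:~R - y)) / bsum N m
         - (U x y + B / (1 + e))| <= w
     & forall a b, `|h * a%:~R| < rho1 / 2 -> `|h * b%:~R| < rho1 / 2 -> m a b = 0].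
  move=> w0; have [se [h [N [m [p1 [p2 p3]]]]]] := pot _ w0.
  exists se, h, N, m; split=> //; split=> // x y hx hy.
  by have := p2 _ _ hx hy; rewrite /U -mulrDl.
have PP := poly_potential rh20 rhR U00 pot'.
have Ae0 : 0 < A / (1 + e) by apply: divr_gt0.
have ce0 : 0 < c / (1 + e) by apply: divr_gt0.
have cAe : 16 * (A / (1 + e)) * C0 <= c / (1 + e).
  rewrite ler_pdivlMr // (_ : _ * (1 + e) = 16 * A * C0) //; field; exact: lt0r_neq0.
have Unear x y : `|x| <= rho1 / 2 / 4 -> `|y| <= rho1 / 2 / 4 -> U x y =
   A / (1 + e) * (x * nx + y * ny) +
   c / (1 + e) * ((x * nx + y * ny) ^+ 2 - (x * ny - y * nx) ^+ 2).
  move=> hx hy; rewrite /U near_mid; [|by move: hx rh0; lra0|by move: hy rh0; lra0].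
  by rewrite /hq /hyperbolic; field; exact: lt0r_neq0.
have Uc : ucont_on R0 U.
  move=> w w0; have w0' : 0 < w * (1 + e) by apply: mulr_gt0.
  have [d d0' hd] := uloc_ucont bar rp (ltW s0) d0 dk (ltW R00) (gc R0) (hqc R0) w0'.
  exists d => // x y x' y' h1 h2 h3 h4; rewrite /U -mulrBl normrM normfV (gtr0_norm te0).
  by rewrite ler_pdivrMr //; exact: hd.
have KR x y : K x y -> `|x| <= R0 / 2 /\ `|y| <= R0 / 2.
  by move=> /Kb[hx hy]; rewrite /R0; split; [move: hx|move: hy]; move: rp; lra0.
have flatr x y : K x y -> `|x| <= r -> `|y| <= r ->
     `|x * nx + y * ny| <= C0 * (x * ny - y * nx) ^+ 2.
  by move=> k hx hy; apply: flat => //; apply: le_trans rrK.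
(* On K, g vanishes, so [mid] is [- (delta / 2)]. Inside the small box flatness gives
   [|Y| <= |X| / 4], hence [- c * X ^+ 2] outweighs the two terms in [Y]. *)
have Kfar t : 0 < t -> exists2 eta, 0 < eta & forall x y, K x y ->
     (t < `|x|) || (t < `|y|) -> U x y <= - eta.
  move=> t0; have ct : 0 < c * t ^+ 2 / 4 by rewrite divr_gt0 // mulr_gt0 // exprn_gt0.
  exists (Num.min (delta / 2) (c * t ^+ 2 / 4) / (1 + e)).
    by apply: divr_gt0 => //; rewrite lt_min ct andbT divr_gt0.
  move=> x y k far; rewrite /U -mulNr ler_pM2r ?invr_gt0 //.
  have [xR yR] := KR _ _ k.
  have md : mid g s delta x y <= - Num.min (delta / 2) (c * t ^+ 2 / 4).
    apply: (@le_trans _ _ (- (delta / 2))); last by rewrite lerN2 ge_min lexx.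
    rewrite /mid ge_max lexx andbT (gK _ _ k).
    have R2 : R0 / 2 <= R0 by move: R00; lra0.
    by have := sz x y (le_trans xR R2) (le_trans yR R2); move: d0; lra0.
  rewrite /uloc /glue; case: ifPn => // /andP[bx by'].
  rewrite ge_max md andbT.
  apply: (@le_trans _ _ (- (c * t ^+ 2 / 4))); last by rewrite lerN2 ge_min lexx orbT.
  have := flatr _ _ k (ltW bx) (ltW by'); rewrite /hq /hyperbolic.
  have E := nrm_pair_sqr x y n1.
  have [nx1 ny1] := normal_le1 n1.
  have X2r : `|x * ny - y * nx| <= 2 * r.
    apply: (le_trans (ler_normB _ _)); rewrite !normrM.
    have := ler_pM (normr_ge0 _) (normr_ge0 _) (ltW bx) ny1.
    have := ler_pM (normr_ge0 _) (normr_ge0 _) (ltW by') nx1; lra0.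
  move: E X2r; set Y := x * nx + y * ny; set X := x * ny - y * nx => E X2r YX.
  have Y4 : `|Y| <= `|X| / 4.
    apply: (le_trans YX); rewrite -(real_normK (num_real X)).
    have h1 := ler_wpM2l C00 X2r.
    have h2 : C0 * `|X| <= 1 / 4 by move: h1 C0r; lra0.
    have := ler_wpM2r (normr_ge0 X) h2; lra0.
  have Y2 : Y ^+ 2 <= X ^+ 2 / 16.
    have := sqr_le_norm Y4; rewrite exprMn (real_normK (num_real X)).
    rewrite (_ : 4^-1 ^+ 2 = 1 / 16 :> R); last by field.
    lra0.
  have Xt : t ^+ 2 / 2 <= X ^+ 2.
    have : t ^+ 2 <= x ^+ 2 + y ^+ 2.
      by have := sqr_ge0 x; have := sqr_ge0 y; case/orP: far => /ltW /(le_norm_sqr (ltW t0)); lra0.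
    by rewrite E; move: Y2 (sqr_ge0 t); lra0.
  have AY : A * Y <= A * (C0 * X ^+ 2).
    by rewrite ler_pM2l //; apply: (le_trans (ler_norm _)).
  have h3 := ler_wpM2r (sqr_ge0 X) cA.
  have h4 := ler_wpM2l (ltW c0) Y2.
  have h5 := ler_wpM2l (ltW c0) Xt.
  by move: AY h3 h4 h5 ct; lra0.
have [T [N [N0 sT TK T0 dT]]] := touching_poly n1 Ae0 ce0 C00 cAe rh20 rhR rp Unear Uc KR
  flatr Kfar PP e0 e1'.
exists T, N; split=> //; apply: (le_trans _ dT); rewrite ler_pM2l ?ltr0n //.
have -> : A / (1 + e) * (1 - e) = L * ((1 - e) ^+ 2) / (1 + e).
  by rewrite /A; field; exact: lt0r_neq0.
rewrite ler_pdivlMr // -mulrA ler_pM2l //.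
have -> : eps = 4 * e by rewrite /e; field.
by have := sqr_ge0 e; move: e0; lra0.
Qed.

End GreenTouching.

(** * Extraction of real estimates from the hypotheses *)

Section Covers.
Context {R : realType}.
Implicit Types (f g : R -> R -> R).

(** Compactness as a uniform threshold: if near each point [P e] holds for all small [e], one
    threshold serves the whole segment. Continuity on boxes, minima and distances to arcs are all
    obtained from it. *)
Lemma segment_cover (a b : R) (P : R -> R -> Prop) :
  (forall t, a <= t <= b -> exists2 d, 0 < d & forall e s, 0 < e -> e < d -> `|s - t| < d -> P e s) ->
  exists2 d, 0 < d & forall e t, 0 < e -> e < d -> a <= t <= b -> P e t.
Proof.
move=> hP; have /compact_near_coveringP cov := @segment_compact R a b.
have [|d /= d0 hd] := cov R (0^'+) P _.
  move=> t; rewrite /= in_itv /= => /hP[d d0 hd].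
  exists (ball t d, [set e | 0 < e /\ e < d]) => /=; last first.
    by move=> [s e] /= [ts [e0 ed]]; apply: hd => //; rewrite distrC.
  split; first exact: nbhsx_ballx.
  exists d => //= e /=; rewrite sub0r normrN => ed e0; split=> //.
  exact: le_lt_trans (ler_norm _) ed.
exists d => // e t e0 ed tab; apply: (hd e _ e0).
  by rewrite /= sub0r normrN gtr0_norm.
by rewrite /= in_itv.
Qed.

(** Two nested uses of [segment_cover]; in the inner one the parameter is also the width of the
    vertical strip on which the conclusion holds. *)
Lemma box_cover (rho : R) (P : R -> R -> R -> Prop) :
  (forall x y, `|x| <= rho -> `|y| <= rho -> exists2 d, 0 < d & forall e x' y', 0 < e -> e < d ->
     `|x' - x| < d -> `|y' - y| < d -> P e x' y') ->
  exists2 d, 0 < d & forall e x y, 0 < e -> e < d -> `|x| <= rho -> `|y| <= rho -> P e x y.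
Proof.
move=> hP.
have [x hx|d d0 hd] := @segment_cover (- rho) rho (fun e x => forall y, `|y| <= rho -> P e x y).
  rewrite -ler_norml in hx.
  have [y hy|d d0 hd] := @segment_cover (- rho) rho
      (fun e y => forall e' x', 0 < e' -> e' < e -> `|x' - x| < e -> P e' x' y).
    rewrite -ler_norml in hy.
    have [d d0 hd] := hP x y hx hy; exists d => // e y' e0 ed yy e' x' e'0 e'e xx.
    by apply: hd => //; [exact: lt_trans ed|exact: lt_trans ed].
  have d20 : 0 < d / 2 by rewrite divr_gt0.
  have d2d : d / 2 < d by move: d0; lra.
  exists (d / 2) => // e x' e0 ed xx y hy.
  by apply: (hd (d / 2)) => //; rewrite -ler_norml.
exists d => // e x y e0 ed hx hy; apply: hd => //; by rewrite -ler_norml.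
Qed.

Definition cont_at f x y := forall w, 0 < w -> exists2 d, 0 < d &
  forall x' y', `|x' - x| < d -> `|y' - y| < d -> `|f x' y' - f x y| <= w.

Lemma cont_ucont f : (forall x y, cont_at f x y) -> forall rho, ucont_on rho f.
Proof.
move=> fc rho w w0.
have [x y hx hy|d d0 hd] := @box_cover rho (fun e x y => forall x' y',
    `|x - x'| < e -> `|y - y'| < e -> `|f x y - f x' y'| <= w).
  have w2 : 0 < w / 2 by rewrite divr_gt0.
  have [d d0 hd] := fc x y _ w2; exists (d / 2); first by rewrite divr_gt0.
  move=> e x1 y1 e0 ed x1x y1y x' y' xx yy.
  have tri (a b c : R) : `|b - a| < d / 2 -> `|b - c| < e -> `|c - a| < d.
    move=> h1 h2; have := ler_normB (b - a) (b - c).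
    by rewrite opprB addrC addrA subrK; move: h1 h2 ed; lra0.
  have q1 : `|f x1 y1 - f x y| <= w / 2 by apply: hd; [move: x1x|move: y1y]; move: d0; lra0.
  have q2 : `|f x' y' - f x y| <= w / 2 by apply: hd; [exact: tri xx|exact: tri yy].
  have := ler_normB (f x1 y1 - f x y) (f x' y' - f x y).
  by rewrite opprB addrA subrK; move: q1 q2; lra0.
have d20 : 0 < d / 2 by rewrite divr_gt0.
have d2d : d / 2 < d by move: d0; lra0.
by exists (d / 2) => // x y x' y' hx hy; apply: hd.
Qed.

Lemma cont_bounded f : (forall x y, cont_at f x y) -> forall rho, bounded_on rho f.
Proof.
move=> fc rho.
have [x y hx hy|d d0 hd] := @box_cover rho (fun e x y => `|f x y| * e <= 1).
  have [d d0 hd] := fc x y _ ltr01.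
  have D0 : 0 < `|f x y| + 1 by have := normr_ge0 (f x y); lra0.
  exists (Num.min d (`|f x y| + 1)^-1); first by rewrite lt_min d0 invr_gt0.
  move=> e x' y' e0; rewrite !lt_min => /andP[_ e1] /andP[xx _] /andP[yy _].
  have := hd _ _ xx yy => h1.
  have h2 : `|f x' y'| <= `|f x y| + 1.
    by have := ler_normD (f x' y' - f x y) (f x y); rewrite subrK; move: h1; lra0.
  apply: (le_trans (ler_pM (normr_ge0 _) (ltW e0) h2 (ltW e1))).
  by rewrite divff // gt_eqF.
have d20 : 0 < d / 2 by rewrite divr_gt0.
have d2d : d / 2 < d by move: d0; lra0.
exists (d / 2)^-1; first by rewrite invr_ge0 ltW.
by move=> x y hx hy; rewrite -[leRHS]mul1r ler_pdivlMr // hd.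
Qed.

(** If the infimum were not attained, each point would have a positive gap above it; a uniform gap
    from [box_cover] contradicts the definition of the infimum. *)
Lemma box_min f (rho : R) : 0 <= rho -> (forall x y, cont_at f x y) ->
  exists x0 y0, [/\ `|x0| <= rho, `|y0| <= rho &
    forall x y, `|x| <= rho -> `|y| <= rho -> f x0 y0 <= f x y].
Proof.
move=> rho0 fc; have [B B0 hB] := cont_bounded fc rho.
pose E := [set - f p.1 p.2 | p in [set p : R * R | `|p.1| <= rho /\ `|p.2| <= rho]].
have supE : has_sup E.
  split; first by exists (- f 0 0); exists (0, 0); rewrite /= ?normr0.
  exists B => _ [[x y] [/= hx hy] <-]; apply: le_trans (hB _ _ hx hy).
  by rewrite -normrN ler_norm.
have ub x y : `|x| <= rho -> `|y| <= rho -> - sup E <= f x y.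
  by move=> hx hy; rewrite lerNl; apply: ub_le_sup => //; [case: supE|exists (x, y)].
have [[x0 [y0 [hx hy h]]]|no] := pselect (exists x0 y0, [/\ `|x0| <= rho, `|y0| <= rho &
    f x0 y0 = - sup E]).
  by exists x0, y0; split=> // x y; rewrite h; exact: ub.
have [x y hx hy|d d0 hd] := @box_cover rho (fun e x y => `|x| <= rho -> `|y| <= rho ->
    - sup E + e <= f x y).
  have gap : 0 < f x y + sup E.
    rewrite lt_neqAle -lerBlDr sub0r ub // andbT eq_sym; apply/eqP => h.
    by apply: no; exists x, y; split=> //; apply/eqP; rewrite -addr_eq0 h.
  have gap2 : 0 < (f x y + sup E) / 2 by rewrite divr_gt0.
  have [d d0 hd] := fc x y _ gap2.
  exists (Num.min d ((f x y + sup E) / 2)); first by rewrite lt_min d0.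
  move=> e x' y' e0; rewrite !lt_min => /andP[_ e1] /andP[xx _] /andP[yy _] _ _.
  by have := hd _ _ xx yy; rewrite ler_norml => /andP[h1 h2]; move: e1 h1; lra0.
have d20 : 0 < d / 2 by rewrite divr_gt0.
have d2d : d / 2 < d by move: d0; lra0.
have [_ [[x y] [/= hx hy] <-]] := sup_adherent d20 supE.
by have := hd _ _ _ d20 d2d hx hy hx hy; lra.
Qed.

Lemma is_derive1_affine (p : R -> R) (dp x c t : R) : is_derive (x + c * t) 1 p dp ->
  is_derive t 1 (fun s => p (x + c * s)) (c * dp).
Proof.
move=> h1; have h2 : is_derive t (1 : R) (fun s : R => x + c * s) c.
  by apply: is_derive_eq; rewrite /GRing.scale /=; ring.
by have := is_derive1_comp (g := fun s => x + c * s) h1 h2; rewrite mulrC.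
Qed.

(** The even combination [p (x + t) + p (x - t) - A * t ^+ 2] is compared with plus and minus
    [w * t ^+ 2] through the sign of the derivative in [t]. Two mean value arguments suffice, and
    [ddp] need only be close to [A]. *)
Lemma second_difference (p dp ddp : R -> R) (x h A w : R) : 0 < h ->
  (forall t, `|t - x| <= h -> is_derive t 1 p (dp t)) ->
  (forall t, `|t - x| <= h -> is_derive t 1 dp (ddp t)) ->
  (forall t, `|t - x| <= h -> `|ddp t - A| <= w) ->
  `|p (x + h) + p (x - h) - 2 * p x - A * h ^+ 2| <= w * h ^+ 2.
Proof.
move=> h0 hp hdp hA.
have dpE t : 0 <= t -> t <= h -> `|dp (x + t) - dp (x - t) - A * (2 * t)| <= w * (2 * t).
  move=> t0 th; pose q s := dp s - A * s.
  have h1 s : Num.min (x - t) (x + t) <= s <= Num.max (x - t) (x + t) -> `|s - x| <= h.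
    rewrite min_l ?max_r; [|move: t0; lra0|move: t0; lra0].
    by move=> /andP[s1 s2]; rewrite ler_norml; apply/andP; split; move: s1 s2 th; lra0.
  have := @lipschitz_of_derive R q (fun s => ddp s - A) (x - t) (x + t) w.
  have -> : q (x + t) - q (x - t) = dp (x + t) - dp (x - t) - A * (2 * t) by rewrite /q; ring.
  have -> : x + t - (x - t) = 2 * t by ring.
  rewrite [`|2 * t|]ger0_norm; last by rewrite mulr_ge0.
  apply=> s /h1 hs; last exact: hA.
  have hs1 := hdp _ hs.
  by apply: is_derive_eq; rewrite /GRing.scale /= mulr1.
have main (sg : R) : `|sg| = 1 ->
    sg * (p (x + h) + p (x - h) - 2 * p x - A * h ^+ 2) <= w * h ^+ 2.
  move=> sg1.
  pose f t := sg * (p (x + t) + p (x - t) - A * t ^+ 2) - w * t ^+ 2.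
  pose df t := sg * (dp (x + t) - dp (x - t) - A * (2 * t)) - w * (2 * t).
  have fd t : 0 <= t <= h -> is_derive t 1 f (df t).
    move=> /andP[t0 th].
    have xp : `|x + t - x| <= h by rewrite [x + t]addrC addrK ger0_norm.
    have xm : `|x - t - x| <= h by rewrite addrAC subrr add0r normrN ger0_norm.
    have dpl : is_derive t 1 (fun s => p (x + s)) (dp (x + t)).
      have := @is_derive1_affine p (dp (x + t)) x 1 t; rewrite !mul1r => /(_ (hp _ xp)).
      by under eq_fun do rewrite mul1r.
    have dmi : is_derive t 1 (fun s => p (x - s)) (- dp (x - t)).
      have := @is_derive1_affine p (dp (x - t)) x (-1) t; rewrite !mulN1r => /(_ (hp _ xm)).
      by under eq_fun do rewrite mulN1r.
    by apply: is_derive_eq; rewrite /df /GRing.scale /=; ring.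
  have [t|t|t] := @MVT_segment R f df 0 h (ltW h0).
  - by rewrite in_itv /= => /andP[t1 t2]; apply: fd; rewrite !ltW.
  - by apply: derivable_within_continuous => y; rewrite in_itv /= => y1; have [] := fd y y1.
  rewrite in_itv /= subr0 => /andP[t0 th] E.
  have : df t * h <= 0.
    rewrite pmulr_lle0 // /df subr_le0; apply: (le_trans (ler_norm _)).
    by rewrite normrM sg1 mul1r; exact: dpE.
  by rewrite -E /f !addr0 subr0 expr0n /= !mulr0; lra.
by rewrite ler_norml; apply/andP; split; [have := main (-1)|have := main 1];
   rewrite ?normrN normr1 => /(_ erefl); lra.
Qed.

End Covers.

Section ComplexTopology.
Context {R : realType}.

Lemma norm_cmod (z : R[i]) : `|z| = (cmod z)%:C%C.
Proof. by []. Qed.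

Lemma nbhs_cmod (z : R[i]) (P : set R[i]) : nbhs (z : R[i]^o) P ->
  exists2 d : R, 0 < d & forall z', cmod (z' - z) < d -> P z'.
Proof.
move=> /nbhs_ballP[[d di] /=]; rewrite ltcE /= => /andP[/eqP di0 d0]; rewrite di0 => hd.
exists d => // z' hz; apply: hd; rewrite -ball_normE /=.
have : (cmod (z - z'))%:C%C < d%:C%C by rewrite ltcR -opprB cmodN.
by rewrite -norm_cmod.
Qed.

Lemma cont_cmod (g : R[i] -> R) (z : R[i]) : {for z, continuous (g : R[i]^o -> R)} ->
  forall w, 0 < w -> exists2 d, 0 < d & forall z', cmod (z' - z) < d -> `|g z' - g z| < w.
Proof.
move=> /cvgrPdist_lt h w w0; have /nbhs_cmod[d d0 hd] := h w w0.
by exists d => // z' /hd /=; rewrite distrC.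
Qed.

Lemma deriv_withinP (A : set R) (f : R -> R[i]) (t : R) (d : R[i]) :
  has_deriv_within A f t d -> forall w, 0 < w -> exists2 e, 0 < e &
    forall s, A s -> `|s - t| < e -> cmod (f s - f t - d * (s - t)%:C%C) <= w * `|s - t|.
Proof.
move=> /cvgrPdist_lt h w w0.
have w0' : (0 : R[i]) < w%:C%C by rewrite ltcR.
have [e /= e0 he] := h _ w0'; exists e => // s As st.
have [->|sn] := eqVneq s t.
  by rewrite !subrr mulr0 subr0 normr0 mulr0 /cmod ComplexField.Normc.normc0.
have st0 : s - t != 0 by rewrite subr_eq0.
have := he s; rewrite /ball /= distrC => /(_ st sn As).
rewrite norm_cmod ltcR => h1.
have -> : f s - f t - d * (s - t)%:C%C = - (d - (f s - f t) / (s - t)%:C%C) * (s - t)%:C%C.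
  have : (s - t)%:C%C != 0 by rewrite (fmorph_eq0 (real_complex R)).
  by move: (s - t)%:C%C => u u0; field.
rewrite cmodM cmodN; have -> : cmod (s - t)%:C%C = `|s - t|.
  by rewrite cmodE /= expr0n addr0 sqrtr_sqr.
by rewrite ler_wpM2r // ltW.
Qed.

Section Coordinates.
Variables (u : R[i] -> R) (D : set R[i]).
Hypothesis C1 : C1_on D u.
Local Notation ux x y := (partial_x u (x +i* y)%C).
Local Notation uy x y := (partial_y u (x +i* y)%C).

Lemma C1_is_derive_x x y : D (x +i* y)%C -> is_derive x 1 (fun x => u (x +i* y)%C) (ux x y).
Proof.
move=> /C1[h _ _ _]; have /= := h => h'; apply: DeriveDef => //.
by rewrite /partial_x derive1E.
Qed.

Lemma C1_is_derive_y x y : D (x +i* y)%C -> is_derive y 1 (fun y => u (x +i* y)%C) (uy x y).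
Proof.
move=> /C1[_ h _ _]; have /= := h => h'; apply: DeriveDef => //.
by rewrite /partial_y derive1E.
Qed.

Lemma cmod_box (x y : R) d : `|x| < d / 2 -> `|y| < d / 2 -> cmod (x +i* y)%C < d.
Proof.
move=> hx hy; have d0 : 0 < d by have := normr_ge0 x; move: hx; lra0.
rewrite -ltr_sqr ?nnegrE ?cmod_ge0 ?(ltW d0) // sqr_cmod /=.
have := sqr_le_norm (ltW hx); have := sqr_le_norm (ltW hy).
have : 0 < d ^+ 2 by rewrite exprn_gt0.
by rewrite expr_div_n; lra0.
Qed.

Lemma cont_coord (v : R[i] -> R) x y : {for (x +i* y)%C, continuous (v : R[i]^o -> R)} ->
  cont_at (fun x y => v (x +i* y)%C) x y.
Proof.
move=> /cont_cmod hv w w0; have [d d0 hd] := hv _ w0.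
exists (d / 2); first by rewrite divr_gt0.
by move=> x' y' hx hy; apply/ltW/hd; exact: cmod_box.
Qed.

Lemma C1_cont_x x y : D (x +i* y)%C -> cont_at (fun x y => ux x y) x y.
Proof. by move=> /C1[_ _ h _]; exact: cont_coord. Qed.

Lemma C1_cont_y x y : D (x +i* y)%C -> cont_at (fun x y => uy x y) x y.
Proof. by move=> /C1[_ _ _ h]; exact: cont_coord. Qed.

(** [C1_on] asserts continuity of the partial derivatives but not of [u]. They are bounded near the
    point, so [u] is Lipschitz along a horizontal and then a vertical segment. *)
Lemma C1_cont x y d : 0 < d ->
  (forall x' y', `|x' - x| < d -> `|y' - y| < d -> D (x' +i* y')%C) ->
  cont_at (fun x y => u (x +i* y)%C) x y.
Proof.
move=> d0 hD w w0.
have Dz : D (x +i* y)%C by apply: hD; rewrite subrr normr0.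
have [d1 d10 h1] := C1_cont_x Dz ltr01; have [d2 d20 h2] := C1_cont_y Dz ltr01.
pose C := `|ux x y| + `|uy x y| + 1.
have C0 : 0 < C by rewrite /C ltr_wpDl // addr_ge0.
pose e := Num.min (Num.min d (Num.min d1 d2)) (w / (2 * C)).
have e0 : 0 < e by rewrite !lt_min d0 d10 d20 divr_gt0 // mulr_gt0.
have [ed ed1 ed2 ew] : [/\ e <= d, e <= d1, e <= d2 & e <= w / (2 * C)].
  by rewrite !ge_min !lexx !orbT.
exists e => // x' y' hx hy.
have btw (a b t : R) : `|b - a| < e -> Num.min a b <= t <= Num.max a b -> `|t - a| < e.
  case: (leP a b) => ab; rewrite ?ltr_norml => /andP[p1 p2] /andP[q1 q2].
    by apply/andP; split; move: e0 ab p1 p2 q1 q2; lra0.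
  by apply/andP; split; move: e0 ab p1 p2 q1 q2; lra0.
have s1 : `|u (x' +i* y')%C - u (x +i* y')%C| <= C * `|x' - x|.
  apply: (@lipschitz_of_derive R (fun x => u (x +i* y')%C) (fun x => ux x y')) => t /(btw _ _ _ hx) ht.
    by apply: C1_is_derive_x; apply: hD; [exact: lt_le_trans ed|exact: lt_le_trans ed].
  have := h1 t y' (lt_le_trans ht ed1) (lt_le_trans hy ed1).
  have := ler_normD (ux t y' - ux x y) (ux x y); rewrite subrK /C.
  move: `|ux t y' - ux x y| `|ux t y'| `|ux x y| `|uy x y| (normr_ge0 (uy x y)).
  by move=> p1 p2 p3 p4; lra0.
have s2 : `|u (x +i* y')%C - u (x +i* y)%C| <= C * `|y' - y|.
  apply: (@lipschitz_of_derive R (fun y => u (x +i* y)%C) (fun y => uy x y)) => t /(btw _ _ _ hy) ht.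
    by apply: C1_is_derive_y; apply: hD; rewrite ?subrr ?normr0 //; exact: lt_le_trans ed.
  have := h2 x t; rewrite subrr normr0 => /(_ d20 (lt_le_trans ht ed2)).
  have := ler_normD (uy x t - uy x y) (uy x y); rewrite subrK /C.
  move: `|uy x t - uy x y| `|uy x t| `|uy x y| `|ux x y| (normr_ge0 (ux x y)).
  by move=> p1 p2 p3 p4; lra0.
have := ler_normD (u (x' +i* y')%C - u (x +i* y')%C) (u (x +i* y')%C - u (x +i* y)%C).
rewrite addrA subrK => s3.
have Ce : C * e <= w / 2.
  have := ler_wpM2l (ltW C0) ew; rewrite (_ : C * (w / (2 * C)) = w / 2) //.
  by field; rewrite gt_eqF.
have := ler_wpM2l (ltW C0) (ltW hx); have := ler_wpM2l (ltW C0) (ltW hy).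
by move: s1 s2 s3 Ce; lra0.
Qed.

End Coordinates.

Lemma harmonic_dlap (D : set R[i]) (u : R[i] -> R) x y d eta : harmonic_on D u -> 0 < d ->
  (forall x' y', `|x' - x| < d -> `|y' - y| < d -> D (x' +i* y')%C) -> 0 < eta ->
  exists2 e, 0 < e & forall h x' y', 0 < h -> h < e -> `|x' - x| < e -> `|y' - y| < e ->
    `|dlap h (fun x y => u (x +i* y)%C) x' y'| <= eta * h ^+ 2.
Proof.
move=> [[C1 C1x C1y] harm] d0 hD eta0.
have Dz : D (x +i* y)%C by apply: hD; rewrite subrr normr0.
have e20 : 0 < eta / 2 by rewrite divr_gt0.
have [d1 d10 h1] := C1_cont_x C1x Dz e20; have [d2 d20 h2] := C1_cont_y C1y Dz e20.
pose e := Num.min d (Num.min d1 d2).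
have e0 : 0 < e by rewrite !lt_min d0 d10 d20.
have [ed ed1 ed2] : [/\ e <= d, e <= d1 & e <= d2] by rewrite !ge_min !lexx !orbT.
exists (e / 2); first by rewrite divr_gt0.
move=> h x' y' h0 he hx hy.
have near (a b t : R) : `|b - a| < e / 2 -> `|t - b| <= h -> `|t - a| < e.
  by move=> p1 p2; have := ler_normD (t - b) (b - a); rewrite addrA subrK; move: p1 p2 he; lra0.
have hx' : `|x' - x| < e by move: hx e0; lra0.
have hy' : `|y' - y| < e by move: hy e0; lra0.
have sx := @second_difference R (fun x => u (x +i* y')%C) (fun x => partial_x u (x +i* y')%C)
  (fun x => partial_x (partial_x u) (x +i* y')%C) x' h (partial_x (partial_x u) (x +i* y)%C) (eta / 2) h0.
have sy := @second_difference R (fun y => u (x' +i* y)%C) (fun y => partial_y u (x' +i* y)%C)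
  (fun y => partial_y (partial_y u) (x' +i* y)%C) y' h (partial_y (partial_y u) (x +i* y)%C) (eta / 2) h0.
have {}sx : `|u ((x' + h) +i* y')%C + u ((x' - h) +i* y')%C - 2 * u (x' +i* y')%C -
   partial_x (partial_x u) (x +i* y)%C * h ^+ 2| <= eta / 2 * h ^+ 2.
  apply: sx => t /(near _ _ _ hx) ht.
  - by apply: (C1_is_derive_x C1); apply: hD; [exact: lt_le_trans ed|exact: lt_le_trans ed].
  - by apply: (C1_is_derive_x C1x); apply: hD; [exact: lt_le_trans ed|exact: lt_le_trans ed].
  by apply: h1; [exact: lt_le_trans ed1|exact: lt_le_trans ed1].
have {}sy : `|u (x' +i* (y' + h))%C + u (x' +i* (y' - h))%C - 2 * u (x' +i* y')%C -
   partial_y (partial_y u) (x +i* y)%C * h ^+ 2| <= eta / 2 * h ^+ 2.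
  apply: sy => t /(near _ _ _ hy) ht.
  - by apply: (C1_is_derive_y C1); apply: hD; [exact: lt_le_trans ed|exact: lt_le_trans ed].
  - by apply: (C1_is_derive_y C1y); apply: hD; [exact: lt_le_trans ed|exact: lt_le_trans ed].
  by apply: h2; [exact: lt_le_trans ed2|exact: lt_le_trans ed2].
have E := harm _ Dz.
have E2 : partial_y (partial_y u) (x +i* y)%C = - partial_x (partial_x u) (x +i* y)%C.
  by apply/eqP; rewrite -addr_eq0 addrC E.
rewrite E2 in sy; rewrite /dlap.
set a := partial_x _ _ in sx sy.
move: sx sy; rewrite !ler_norml => /andP[p1 p2] /andP[p3 p4].
by apply/andP; split; move: p1 p2 p3 p4; lra0.
Qed.

End ComplexTopology.

Section MinPrinciple.
Context {R : realType}.
Implicit Types (g : R -> R -> R) (K : R -> R -> Prop).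

Lemma cont_at_paraboloid g s x y : cont_at g x y ->
  cont_at (fun x y => g x y - s * (x ^+ 2 + y ^+ 2)) x y.
Proof.
move=> gc w w0; have w2 : 0 < w / 2 by rewrite divr_gt0.
have [d d0 hd] := gc _ w2.
pose C := `|s| * (2 * `|x| + 2 * `|y| + 2) + 1.
have C0 : 0 < C.
  have : 0 <= `|s| * (2 * `|x| + 2 * `|y| + 2).
    by rewrite mulr_ge0 //; have := normr_ge0 x; have := normr_ge0 y; lra0.
  by rewrite /C; lra0.
pose e := Num.min 1 (Num.min d (w / (2 * C))).
have e0 : 0 < e by rewrite !lt_min ltr01 d0 divr_gt0 // mulr_gt0.
have [e1 ed ew] : [/\ e <= 1, e <= d & e <= w / (2 * C)] by rewrite !ge_min !lexx !orbT.
exists e => // x' y' hx hy.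
have hg := hd _ _ (lt_le_trans hx ed) (lt_le_trans hy ed).
have sq (a b : R) : `|a - b| < e -> `|a ^+ 2 - b ^+ 2| <= (2 * `|b| + 1) * e.
  move=> ab; have -> : a ^+ 2 - b ^+ 2 = (2 * b + (a - b)) * (a - b) by ring.
  rewrite normrM; apply: ler_pM => //; last exact: ltW.
  apply: (le_trans (ler_normD _ _)); rewrite normrM (ger0_norm (ler0n _ 2)).
  by move: ab e1; lra0.
have sx := sq _ _ hx; have sy := sq _ _ hy.
have sxy : `|(x' ^+ 2 - x ^+ 2) + (y' ^+ 2 - y ^+ 2)| <= (2 * `|x| + 2 * `|y| + 2) * e.
  by apply: (le_trans (ler_normD _ _)); move: sx sy; lra0.
have sm := ler_wpM2l (normr_ge0 s) sxy.
have Ce : C * e <= w / 2.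
  have := ler_wpM2l (ltW C0) ew; rewrite (_ : C * (w / (2 * C)) = w / 2) //.
  by field; rewrite gt_eqF.
have -> : g x' y' - s * (x' ^+ 2 + y' ^+ 2) - (g x y - s * (x ^+ 2 + y ^+ 2)) =
   (g x' y' - g x y) - s * ((x' ^+ 2 - x ^+ 2) + (y' ^+ 2 - y ^+ 2)) by ring.
apply: (le_trans (ler_normB _ _)); rewrite (normrM s).
by move: hg sm Ce e0; rewrite /C; lra0.
Qed.

(** Nonnegativity is not among the conditions defining Green's function and is derived here. If g
    were negative somewhere, g minus a small paraboloid would have a minimum in the interior at a
    point where g is negative, hence off K. There the Laplacian of g is at least [4 * s * h ^+ 2],
    against the bound [s * h ^+ 2]. *)
Lemma min_principle K g R1 : 0 < R1 -> (forall x y, cont_at g x y) ->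
  (forall x y, K x y -> g x y = 0) -> harmonic_off K g ->
  (forall x y, (R1 <= `|x|) || (R1 <= `|y|) -> 0 <= g x y) -> forall x y, 0 <= g x y.
Proof.
move=> R10 gc gK gh gR x1 y1; rewrite leNgt; apply/negP => neg.
pose v := - g x1 y1; have v0 : 0 < v by rewrite oppr_gt0.
have in1 x y : g x y < 0 -> `|x| < R1 /\ `|y| < R1.
  move=> h; have := gR x y; case: (ltP `|x| R1) => [h1|h1] /=; last by move=> /(_ isT); rewrite leNgt h.
  by case: (ltP `|y| R1) => [h2|h2] //= /(_ isT); rewrite leNgt h.
pose rho := R1 + 1.
have rho0 : 0 < rho by rewrite /rho; move: R10; lra0.
pose s := v / (4 * rho ^+ 2).
have rho2 : 0 < 4 * rho ^+ 2 by rewrite mulr_gt0 // exprn_gt0.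
have s0 : 0 < s by apply: divr_gt0.
have srho x y : `|x| <= rho -> `|y| <= rho -> s * (x ^+ 2 + y ^+ 2) <= v / 2.
  move=> hx hy; have -> : v / 2 = s * (2 * rho ^+ 2).
    by rewrite /s; field; rewrite gt_eqF.
  rewrite ler_pM2l //.
  by have := sqr_le_norm hx; have := sqr_le_norm hy; lra0.
have [x0 [y0 [hx hy hmin]]] := box_min (ltW rho0) (fun x y => @cont_at_paraboloid g s x y (gc x y)).
have [hx1 hy1] := in1 _ _ neg.
have R1rho : R1 <= rho by rewrite /rho; lra0.
have m1 := hmin x1 y1 (ltW (lt_le_trans hx1 R1rho)) (ltW (lt_le_trans hy1 R1rho)).
have n1 : 0 <= s * (x1 ^+ 2 + y1 ^+ 2) by rewrite mulr_ge0 ?(ltW s0) // addr_ge0 // sqr_ge0.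
have g0v : g x0 y0 <= - v / 2 by have := srho _ _ hx hy; move: m1 n1; rewrite /v; lra0.
have [hx0 hy0] : `|x0| < R1 /\ `|y0| < R1 by apply: in1; move: g0v v0; lra0.
have v4 : 0 < v / 4 by rewrite divr_gt0.
have [d d0 hd] := cont_ucont gc rho v4.
have [h0 h00 hh] := gh rho _ _ d0 s0.
pose h := Num.min h0 1 / 2.
have m0 : 0 < Num.min h0 1 by rewrite lt_min h00 ltr01.
have hp : 0 < h by rewrite divr_gt0.
have hlt : h < h0 by have : Num.min h0 1 <= h0; [rewrite ge_min lexx|rewrite /h; move: m0; lra0].
have h1 : h <= 1 by have : Num.min h0 1 <= 1; [rewrite ge_min lexx orbT|rewrite /h; move: m0; lra0].
have away kx ky : K kx ky -> d <= `|x0 - kx| \/ d <= `|y0 - ky|.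
  move=> kk; have [|q1] := leP d `|x0 - kx|; first by left.
  have [|q2] := leP d `|y0 - ky|; first by right.
  have := hd _ _ _ _ hx hy q1 q2; rewrite (gK _ _ kk) subr0.
  by rewrite ler_norml => /andP[q3 _]; move: q3 g0v v0; lra0.
have := hh _ hp hlt _ _ hx hy away; rewrite ler_norml => /andP[_].
have nb (t u : R) : `|t| < R1 -> `|u| <= 1 -> `|t + u| <= rho.
  by move=> q1 q2; apply: (le_trans (ler_normD _ _)); rewrite /rho; move: q1 q2; lra0.
have hh1 : `|h| <= 1 by rewrite gtr0_norm.
have hh2 : `|- h| <= 1 by rewrite normrN.
have a1 := hmin _ _ (nb _ _ hx0 hh1) hy; have a2 := hmin _ _ (nb _ _ hx0 hh2) hy.
have a3 := hmin _ _ hx (nb _ _ hy0 hh1); have a4 := hmin _ _ hx (nb _ _ hy0 hh2).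
have sh : 0 < s * h ^+ 2 by rewrite mulr_gt0 // exprn_gt0.
by rewrite /dlap; move: a1 a2 a3 a4 sh; lra0.
Qed.

End MinPrinciple.

Section GreenCoordinates.
Context {R : realType}.
Variables (K : set R[i]) (g : R[i] -> R) (a b : R).
Hypothesis green : is_green_infty K g.
Hypothesis Kclosed : forall z, ~ K z -> exists2 d, 0 < d & forall z', cmod (z' - z) < d -> ~ K z'.
Hypothesis Kbounded : exists B : R, forall z, K z -> cmod z <= B.

Let f x y := g ((a + x) +i* (b + y))%C.
Let Kf x y := K ((a + x) +i* (b + y))%C.

Lemma complement_box x y : ~ K (x +i* y)%C -> exists2 d, 0 < d &
  forall x' y', `|x' - x| < d -> `|y' - y| < d -> ~ K (x' +i* y')%C.
Proof.
move=> /Kclosed[d d0 hd]; exists (d / 2); first by rewrite divr_gt0.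
by move=> x' y' hx hy; apply: hd; exact: cmod_box.
Qed.

Lemma green_cont x y : cont_at f x y.
Proof.
have raw x' y' : cont_at (fun x y => g (x +i* y)%C) x' y'.
  case: green => [[[C1 _ _] _] _ _ gcK].
  have [k|k] := pselect (K (x' +i* y')%C); first exact/cont_coord/gcK.
  have [d d0 hd] := complement_box k; exact: (C1_cont C1 d0 hd).
move=> w w0; have [d d0 hd] := raw (a + x) (b + y) w w0.
by exists d => // x' y' hx hy; apply: hd; rewrite opprD addrACA subrr add0r.
Qed.

Lemma green_zero x y : Kf x y -> f x y = 0.
Proof. by case: green => _ _ h _; exact: h. Qed.

Lemma green_harmonic : harmonic_off Kf f.
Proof.
move=> rho d eta d0 eta0.
case: green => harm _ _ _.
have [x y hx hy|e e0 he] := @box_cover R rho (fun e x y => forall h, 0 < h -> h < e ->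
    (forall kx ky, Kf kx ky -> d <= `|x - kx| \/ d <= `|y - ky|) ->
    `|dlap h f x y| <= eta * h ^+ 2).
  have [k|k] := pselect (Kf x y).
    exists d => // e x' y' e0 ed xx yy h h0 he away; exfalso.
    by case: (away _ _ k); rewrite leNgt ?xx ?yy.
  have [d' d'0 hd] := complement_box k.
  have [e e0 he] := harmonic_dlap harm d'0 hd eta0.
  exists e => // e' x' y' e'0 e'e xx yy h h0 he' _.
  have := he h (a + x') (b + y') h0 (lt_trans he' e'e).
  have sh (t u v : R) : t + u - (t + v) = u - v by ring.
  rewrite !sh => /(_ xx yy).
  by rewrite /dlap /f !addrA.
have e20 : 0 < e / 2 by rewrite divr_gt0.
have e2e : e / 2 < e by move: e0; lra0.
by exists (e / 2) => // h h0 hlt x y hx hy away; exact: (he (e / 2)).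
Qed.

Lemma green_growth : exists M r1 : R, forall x y, r1 <= x ^+ 2 + y ^+ 2 ->
  f x y <= ln (x ^+ 2 + y ^+ 2) / 2 + M.
Proof.
case: green => _ [M [r hM]] _ _.
pose c := cmod (a +i* b)%C.
pose r1 := `|r| + c + 1.
have c0 : 0 <= c by exact: cmod_ge0.
have r0 := normr_ge0 r.
have r10 : 0 < r1 by rewrite /r1; move: c0 r0; lra0.
exists (ln 2 + M), (r1 ^+ 2) => x y; rewrite -[x ^+ 2 + _](sqr_cmod (x +i* y)%C).
set w := cmod _; have w0 : 0 <= w by exact: cmod_ge0.
rewrite ler_sqr ?nnegrE ?(ltW r10) // => hw.
have wp : 0 < w by apply: lt_le_trans hw.
have E : ((a + x) +i* (b + y))%C = (a +i* b)%C + (x +i* y)%C by [].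
have z1 : cmod ((a + x) +i* (b + y))%C <= 2 * w.
  by rewrite E; have := cmodD (a +i* b)%C (x +i* y)%C; rewrite -/w -/c; move: hw r0; rewrite /r1; lra0.
have z2 : w <= cmod ((a + x) +i* (b + y))%C + c.
  have := cmodD ((a + x) +i* (b + y))%C (- (a +i* b)%C); rewrite cmodN -/c E.
  by rewrite [X in cmod (X - _)]addrC addrK.
have rz : r < cmod ((a + x) +i* (b + y))%C.
  by have := ler_norm r; move: z2 hw; rewrite /r1; lra0.
have zp : 0 < cmod ((a + x) +i* (b + y))%C.
  by move: z2 hw r0; rewrite /r1; lra0.
have := hM _ rz; rewrite ler_norml -/(f x y) => /andP[_ h].
have l1 : ln (cmod ((a + x) +i* (b + y))%C) <= ln 2 + ln w.
  by rewrite -lnM ?posrE // ler_ln ?posrE // mulr_gt0.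
rewrite lnXn // mulr2n; move: h l1; rewrite /f; lra0.
Qed.

Lemma green_ge0 x y : 0 <= f x y.
Proof.
case: green => _ [M [r hM]] _ _.
pose c := cmod (a +i* b)%C.
pose R1 := `|r| + expR M + c + 1.
have c0 : 0 <= c by exact: cmod_ge0.
have r0 := normr_ge0 r; have E0 := expR_gt0 M.
have R10 : 0 < R1 by rewrite /R1; move: c0 r0 E0; lra0.
apply: (@min_principle R Kf f R1) => //; [exact: green_cont|exact: green_zero|exact: green_harmonic|].
move=> {}x {}y hxy.
have hw : R1 <= cmod (x +i* y)%C.
  rewrite -ler_sqr ?nnegrE ?cmod_ge0 ?(ltW R10) // sqr_cmod /=.
  by have := sqr_ge0 x; have := sqr_ge0 y; case/orP: hxy => /(le_norm_sqr (ltW R10)); lra0.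
have z2 : cmod (x +i* y)%C <= cmod ((a + x) +i* (b + y))%C + c.
  have := cmodD ((a + x) +i* (b + y))%C (- (a +i* b)%C); rewrite cmodN -/c.
  have -> // : ((a + x) +i* (b + y))%C - (a +i* b)%C = (x +i* y)%C.
  by apply/eqP; rewrite eq_complex /= ![_ + _ - _]addrAC !subrr !add0r !eqxx.
have rz : r < cmod ((a + x) +i* (b + y))%C.
  by have := ler_norm r; move: z2 hw E0; rewrite /R1; lra0.
have Mz : expR M <= cmod ((a + x) +i* (b + y))%C.
  by move: z2 hw r0; rewrite /R1; lra0.
have zp : 0 < cmod ((a + x) +i* (b + y))%C by apply: lt_le_trans Mz.
have := hM _ rz; rewrite ler_norml => /andP[h _].
have : M <= ln (cmod ((a + x) +i* (b + y))%C) by rewrite -[leLHS]expRK ler_ln ?posrE.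
by rewrite /f; move: h; lra0.
Qed.

Lemma compact_coord : exists Rk, forall x y, Kf x y -> `|x| <= Rk /\ `|y| <= Rk.
Proof.
case: Kbounded => B hB; exists (B + `|a| + `|b|) => x y /hB h.
have B0 : 0 <= B by apply: le_trans h; exact: cmod_ge0.
have E : cmod ((a + x) +i* (b + y))%C ^+ 2 = (a + x) ^+ 2 + (b + y) ^+ 2 by rewrite sqr_cmod.
have c2 : cmod ((a + x) +i* (b + y))%C ^+ 2 <= B ^+ 2 by rewrite ler_sqr ?nnegrE ?cmod_ge0.
have h1 : `|a + x| <= B by apply: normr_le_sqr => //; have := sqr_ge0 (b + y); move: E c2; lra0.
have h2 : `|b + y| <= B by apply: normr_le_sqr => //; have := sqr_ge0 (a + x); move: E c2; lra0.
have t1 := ler_normB (a + x) a; have t2 := ler_normB (b + y) b.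
rewrite [a + x]addrC addrK in t1; rewrite [b + y]addrC addrK in t2.
rewrite [a + x]addrC in h1; rewrite [b + y]addrC in h2.
by split; [have := normr_ge0 b; move: t1 h1|have := normr_ge0 a; move: t2 h2]; lra0.
Qed.

End GreenCoordinates.

(** * Geometry of a twice differentiable arc *)

Section Arcs.
Context {R : realType}.

Lemma is_derive_epsilon (f : R -> R) (t d : R) :
  (forall w, 0 < w -> exists2 e, 0 < e & forall s, `|s - t| < e ->
     `|f s - f t - d * (s - t)| <= w * `|s - t|) -> is_derive t 1 f d.
Proof.
move=> h.
have lim_d : (h^-1 *: ((f \o shift t) (h *: (1 : R)) - f t)) @[h --> 0^'] --> d.
  apply/cvgrPdist_lt => w w0; have w2 : 0 < w / 2 by rewrite divr_gt0.
  have [e e0 he] := h _ w2; exists e => // s /= ; rewrite sub0r normrN => se s0.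
  have := he (s + t); rewrite addrK => /(_ se) hs.
  rewrite /GRing.scale /= mulr1.
  have -> : d - s^-1 * (f (s + t) - f t) = - (s^-1 * (f (s + t) - f t - d * s)).
    by field.
  have s0' : 0 < `|s| by rewrite normr_gt0.
  rewrite normrN normrM normfV mulrC ltr_pdivrMr //.
  apply: (le_lt_trans hs); rewrite ltr_pM2r //; move: w0; lra.
apply: DeriveDef; first by apply/cvg_ex; exists d.
exact: cvg_lim.
Qed.

Lemma fin_min n (P : 'I_n -> R -> Prop) :
  (forall j, exists2 d, 0 < d & forall e, 0 < e -> e < d -> P j e) ->
  exists2 d, 0 < d & forall j, P j d.
Proof.
move=> h.
have : \forall e \near (0 : R)^'+, forall j, P j e.
  apply: filter_forall => j; have [d d0 hd] := h j.
  exists d => // e /=; rewrite sub0r normrN => ed e0; apply: hd => //.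
  exact: le_lt_trans (ler_norm _) ed.
move=> he; have [e [e0 eP]] := filter_ex (filterI (nbhs_right_gt (0 : R)) he).
by exists e.
Qed.

Lemma linear_le (z : R[i]) (u v : R) : `|u| <= 1 -> `|v| <= 1 ->
  `|complex.Re z * u + complex.Im z * v| <= 2 * cmod z.
Proof.
move=> u1 v1; apply: (le_trans (ler_normD _ _)); rewrite !normrM.
have := ler_pM (normr_ge0 _) (normr_ge0 _) (normr_Re_le z) u1.
have := ler_pM (normr_ge0 _) (normr_ge0 _) (normr_Im_le z) v1; lra0.
Qed.

Section OneArc.
Variable G : C2_arc R.
Local Notation lo := (arc_lo G).
Local Notation hi := (arc_hi G).
Local Notation path := (arc_path G).

Lemma arc_cont t : lo <= t <= hi -> forall w, 0 < w -> exists2 d, 0 < d &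
  forall s, lo <= s <= hi -> `|s - t| < d -> cmod (path s - path t) < w.
Proof.
move=> ht w w0; have t_in : t \in `[lo, hi] by rewrite in_itv.
have [e e0 he] := deriv_withinP (arc_has_d1 t_in) ltr01.
set d1 := arc_d1 G t in he.
have D0 : 0 < cmod d1 + 1 by have := cmod_ge0 d1; lra.
exists (Num.min e (w / (cmod d1 + 1))); first by rewrite lt_min e0 divr_gt0.
move=> s hs; rewrite lt_min => /andP[se sw].
have s_in : `[lo, hi]%classic s by rewrite /= in_itv.
have := he s s_in se; rewrite mul1r => h1.
rewrite ltr_pdivlMr // in sw.
have -> : path s - path t = (path s - path t - d1 * (s - t)%:C%C) + d1 * (s - t)%:C%C.
  by rewrite subrK.
apply: (le_lt_trans (cmodD _ _)); rewrite cmodM.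
have -> : cmod (s - t)%:C%C = `|s - t| by rewrite cmodE /= expr0n addr0 sqrtr_sqr.
by apply: le_lt_trans sw; move: h1; lra0.
Qed.

(** By compactness the parameters not within [tau] of [t0] have images at positive distance from
    [z]: the arc cannot come back close to [z]. *)
Lemma arc_away z t0 tau : (forall t, lo <= t <= hi -> path t = z -> `|t - t0| < tau) ->
  exists2 d, 0 < d & forall t, lo <= t <= hi -> `|t - t0| < tau \/ d <= cmod (path t - z).
Proof.
move=> hz.
have [t ht|d d0 hd] := @segment_cover R lo hi (fun e t => lo <= t <= hi ->
    `|t - t0| < tau \/ e <= cmod (path t - z)).
  have [tz|tz] := eqVneq (path t) z.
    have tt := hz _ ht tz.
    exists (tau - `|t - t0|); first by rewrite subr_gt0.
    move=> e s e0 ed st hs; left.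
    by have := ler_normD (s - t) (t - t0); rewrite addrA subrK; move: st; lra0.
  have m0 : 0 < cmod (path t - z) by rewrite cmod_gt0 subr_eq0.
  have m2 : 0 < cmod (path t - z) / 2 by rewrite divr_gt0.
  have [d d0 hd] := arc_cont ht m2.
  exists (Num.min d (cmod (path t - z) / 2)); first by rewrite lt_min d0.
  move=> e s e0; rewrite !lt_min => /andP[_ e1] /andP[st _] hs; right.
  have := hd _ hs st; rewrite -cmodN opprB => h1.
  have := cmodD (path t - path s) (path s - z); rewrite addrA subrK.
  by move: h1 e1; lra0.
have d20 : 0 < d / 2 by rewrite divr_gt0.
have d2d : d / 2 < d by move: d0; lra0.
by exists (d / 2) => // t ht; apply: hd.
Qed.

Lemma arc_closed z : ~ arc_set G z -> exists2 d, 0 < d & forall z', arc_set G z' -> d <= cmod (z' - z).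
Proof.
(* With [tau = 0] the first alternative is void, so all parameters are far. *)
move=> nz; have [t ht tz|d d0 hd] := @arc_away z 0 0.
  by exfalso; apply: nz; exists t => //=; rewrite in_itv.
exists d => // _ [t /= ht <-]; rewrite in_itv /= in ht.
by case: (hd _ ht) => //; rewrite ltNge normr_ge0.
Qed.

Lemma arc_bounded : exists B, forall z, arc_set G z -> cmod z <= B.
Proof.
have [t ht|d d0 hd] := @segment_cover R lo hi (fun e t => lo <= t <= hi -> cmod (path t) * e <= 1).
  have [d d0 hd] := arc_cont ht ltr01.
  have D0 : 0 < cmod (path t) + 1 by have := cmod_ge0 (path t); lra.
  exists (Num.min d (cmod (path t) + 1)^-1); first by rewrite lt_min d0 invr_gt0.
  move=> e s e0; rewrite !lt_min => /andP[_ e1] /andP[st _] hs.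
  have h1 : cmod (path s) <= cmod (path t) + 1.
    by have := cmodD (path s - path t) (path t); rewrite subrK; have := hd _ hs st; lra0.
  apply: (le_trans (ler_pM (cmod_ge0 _) (ltW e0) h1 (ltW e1))).
  by rewrite divff // gt_eqF.
have d20 : 0 < d / 2 by rewrite divr_gt0.
have d2d : d / 2 < d by move: d0; lra0.
exists (d / 2)^-1 => _ [t /= ht <-]; rewrite in_itv /= in ht.
by rewrite -[leRHS]mul1r ler_pdivlMr // hd.
Qed.

(** The normal coordinate [Y] has derivative [O(|t - t0|)], the tangent at [t0] being orthogonal to
    [n], hence [|Y| <= 2 * C1 * |t - t0| ^ 2]. The tangential one satisfies
    [|D| * |t - t0| <= 2 * |X|], with [|D|] the nonzero speed at [t0]. Eliminating [t] gives the
    constant [8 * C1 / |D| ^ 2]. *)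
Lemma arc_flat t0 (n : R[i]) : lo < t0 -> t0 < hi -> cmod n = 1 ->
  (complex.Re (n * (arc_d1 G t0)^*)%C) = 0 ->
  exists C0 tau : R, [/\ 0 <= C0, 0 < tau & forall t, lo <= t <= hi -> `|t - t0| < tau ->
    let z := path t - path t0 in
    `|complex.Re z * complex.Re n + complex.Im z * complex.Im n| <=
      C0 * (complex.Re z * complex.Im n - complex.Im z * complex.Re n) ^+ 2].
Proof.
move=> lot thi n1 dn.
have t0in : t0 \in `[lo, hi] by rewrite in_itv /= !ltW.
have n2 : complex.Re n ^+ 2 + complex.Im n ^+ 2 = 1 by rewrite -sqr_cmod n1 expr1n.
have [nx1 ny1] := normal_le1 n2.
set nx := complex.Re n in n2 nx1 *; set ny := complex.Im n in n2 ny1 *.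
pose p := complex.Re (arc_d1 G t0); pose q := complex.Im (arc_d1 G t0).
have pq : p * nx + q * ny = 0.
  move: dn; rewrite /p /q /nx /ny; case: (arc_d1 G t0) => ? ?; case: (n) => ? ? /= <-; ring.
pose D := p * ny - q * nx.
have D2 : D ^+ 2 = cmod (arc_d1 G t0) ^+ 2.
  by rewrite sqr_cmod -/p -/q (nrm_pair_sqr p q n2) pq expr0n add0r.
have D0 : 0 < `|D|.
  rewrite normr_gt0; apply: contraTneq (arc_d1_neq0 t0in) => D0; rewrite negbK.
  by rewrite -[_ == 0]negbK -cmod_gt0 -(@ltr_pXn2r R 2) ?nnegrE ?cmod_ge0 // -D2 D0 ltxx.
have D8 : 0 < `|D| / 4 by rewrite divr_gt0.
have [e1 e10 h1] := deriv_withinP (arc_has_d1 t0in) D8.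
have [e2 e20 h2] := deriv_withinP (arc_has_d2 t0in) ltr01.
pose C1 := cmod (arc_d2 G t0) + 1.
have C10 : 0 <= C1 by rewrite addr_ge0 // cmod_ge0.
pose tau := Num.min (Num.min e1 e2) (Num.min (t0 - lo) (hi - t0)).
have tau0 : 0 < tau by rewrite !lt_min e10 e20 !subr_gt0 lot.
have [te1 te2 tlo thi'] : [/\ tau <= e1, tau <= e2, tau <= t0 - lo & tau <= hi - t0].
  by rewrite !ge_min !lexx !orbT.
have inside t : `|t - t0| < tau -> lo < t < hi.
  by rewrite ltr_norml => /andP[s1 s2]; apply/andP; split; move: s1 s2 tlo thi'; lra0.
have cR (s : R) : cmod s%:C%C = `|s| by rewrite cmodE /= expr0n addr0 sqrtr_sqr.
have d1_lip t : `|t - t0| < tau -> cmod (arc_d1 G t - arc_d1 G t0) <= C1 * `|t - t0|.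
  move=> tt; have /andP[tl th] := inside _ tt.
  have t_in : `[lo, hi]%classic t by rewrite /= in_itv /= !ltW.
  have := h2 _ t_in (lt_le_trans tt te2); rewrite mul1r.
  have := cmodD (arc_d1 G t - arc_d1 G t0 - arc_d2 G t0 * (t - t0)%:C%C) (arc_d2 G t0 * (t - t0)%:C%C).
  by rewrite subrK cmodM cR /C1; lra0.
pose Y t := complex.Re (path t - path t0) * nx + complex.Im (path t - path t0) * ny.
(* By [pq] subtracting the velocity at [t0] does not change the normal component, and it makes the
   factor [|t - t0|] visible. *)
pose dY t := complex.Re (arc_d1 G t - arc_d1 G t0) * nx + complex.Im (arc_d1 G t - arc_d1 G t0) * ny.
have Yd t : `|t - t0| < tau -> is_derive t 1 Y (dY t).
  move=> tt; apply: is_derive_epsilon => w w0.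
  have /andP[tl th] := inside _ tt.
  have t_in : t \in `[lo, hi] by rewrite in_itv /= !ltW.
  have w2 : 0 < w / 2 by rewrite divr_gt0.
  have [e e0 he] := deriv_withinP (arc_has_d1 t_in) w2.
  have m0 : 0 < tau - `|t - t0| by rewrite subr_gt0.
  exists (Num.min e (tau - `|t - t0|)); first by rewrite lt_min e0.
  move=> s; rewrite lt_min => /andP[se st].
  have st0 : `|s - t0| < tau.
    by have := ler_normD (s - t) (t - t0); rewrite addrA subrK; move: st; lra0.
  have /andP[sl sh] := inside _ st0.
  have s_in : `[lo, hi]%classic s by rewrite /= in_itv /= !ltW.
  have := he s s_in se; set z := path s - path t - _ => hz.
  have -> : Y s - Y t - dY t * (s - t) = complex.Re z * nx + complex.Im z * ny.
    rewrite /Y /dY /z; move: pq; rewrite /p /q.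
    case: (path s) => ? ?; case: (path t) => ? ?; case: (path t0) => ? ?.
    case: (arc_d1 G t) => d e'; case: (arc_d1 G t0) => d' e'' /= pq.
    apply/eqP; rewrite -subr_eq0; apply/eqP.
    by transitivity ((s - t) * (d' * nx + e'' * ny)); [ring|rewrite pq mulr0].
  by have := linear_le z nx1 ny1; move: hz; lra0.
exists (2 * C1 * 16 / 4 / `|D| ^+ 2), tau; split=> //.
  by apply: divr_ge0; [move: C10; lra0|exact: sqr_ge0].
move=> t ht tt; cbv zeta; rewrite -/(Y t).
pose X := complex.Re (path t - path t0) * ny - complex.Im (path t - path t0) * nx.
rewrite -/X.
have btw s : Num.min t0 t <= s <= Num.max t0 t -> `|s - t0| <= `|t - t0|.
  case: (leP t0 t) => ab /andP[p1 p2].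
    by rewrite !ger0_norm; move: ab p1 p2; lra0.
  by rewrite !ler0_norm; move: ab p1 p2; lra0.
have Ybd : `|Y t| <= 2 * C1 * `|t - t0| * `|t - t0|.
  have := @lipschitz_of_derive R Y dY t0 t (2 * C1 * `|t - t0|).
  have -> : Y t0 = 0 by rewrite /Y subrr /= !mul0r addr0.
  rewrite subr0; apply=> s /btw hs; first exact/Yd/(le_lt_trans hs).
  have := linear_le (arc_d1 G s - arc_d1 G t0) nx1 ny1.
  have := d1_lip s (le_lt_trans hs tt); have := ler_wpM2l C10 hs.
  by rewrite /dY; lra0.
have Xbd : `|D| * `|t - t0| <= 2 * `|X|.
  have t_in : `[lo, hi]%classic t by rewrite /= in_itv.
  have := h1 t t_in (lt_le_trans tt te1); set z := path t - path t0 - _ => hz.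
  have ny1' : `|- nx| <= 1 by rewrite normrN.
  have := linear_le z ny1 ny1'.
  have -> : complex.Re z * ny + complex.Im z * - nx = X - D * (t - t0).
    rewrite /X /D /z /p /q; case: (path t) => ? ?; case: (path t0) => ? ?.
    by case: (arc_d1 G t0) => ? ? /=; ring.
  have := ler_normB X (X - D * (t - t0)); rewrite opprB addrC subrK normrM.
  by move: hz; lra0.
have DX := ler_pM (mulr_ge0 (normr_ge0 _) (normr_ge0 _)) (mulr_ge0 (normr_ge0 _) (normr_ge0 _)) Xbd Xbd.
have X2 : `|X| * `|X| = X ^+ 2 by rewrite -normrM -expr2 ger0_norm // sqr_ge0.
apply: (le_trans Ybd).
rewrite (_ : 2 * C1 * 16 / 4 / `|D| ^+ 2 * X ^+ 2 = (2 * C1) * (4 * X ^+ 2) / `|D| ^+ 2); last first.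
  by field; rewrite -normr_eq0 gt_eqF // normr_id.
rewrite ler_pdivlMr ?exprn_gt0 //.
have C20 : 0 <= 2 * C1 by rewrite mulr_ge0.
have := ler_wpM2l C20 DX; rewrite -X2; lra0.
Qed.

End OneArc.
End Arcs.

(** * Polynomials for unions of arcs *)

Section ArcUnion.
Context {R : realType}.
Variables (m : nat) (G : 'I_m -> C2_arc R) (K : set R[i]).
Hypothesis hK : K = \bigcup_(i in [set: 'I_m]) arc_set (G i).

Lemma arcs_closed z : ~ K z -> exists2 d, 0 < d & forall z', cmod (z' - z) < d -> ~ K z'.
Proof.
move=> nz; have [j|d d0 hd] := @fin_min R m (fun j e => forall z', arc_set (G j) z' -> e <= cmod (z' - z)).
  have [|d d0 hd] := @arc_closed R (G j) z; first by move=> h; apply: nz; rewrite hK; exists j.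
  by exists d => // e e0 ed z' /hd; apply: le_trans; exact: ltW.
exists d => // z' hz; rewrite hK => -[j _ /hd]; by rewrite leNgt hz.
Qed.

Lemma arcs_bounded : exists B : R, forall z, K z -> cmod z <= B.
Proof.
have [j|d d0 hd] := @fin_min R m (fun j e => forall z, arc_set (G j) z -> cmod z * e <= 1).
  have [B hB] := arc_bounded (G j).
  have B0 : 0 < `|B| + 1 by have := normr_ge0 B; lra.
  exists (`|B| + 1)^-1; first by rewrite invr_gt0.
  move=> e e0 ed z /hB h.
  have h1 : cmod z <= `|B| + 1 by have := ler_norm B; move: h; lra0.
  apply: (le_trans (ler_pM (cmod_ge0 _) (ltW e0) h1 (ltW ed))).
  by rewrite divff // gt_eqF.
exists d^-1 => z; rewrite hK => -[j _ hz].
by rewrite -[leRHS]mul1r ler_pdivlMr // (hd j).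
Qed.

(** Near the point K consists of one piece of one arc: disjointness keeps the other arcs away,
    injectivity keeps away the rest of the same arc, and the exclusion of endpoints makes [arc_flat]
    applicable. *)
Lemma arcs_flat (hdisj : forall i j, i != j -> arc_set (G i) `&` arc_set (G j) = set0)
    (a b : R) (hend : forall i, ~ arc_endpoint (G i) (a +i* b)%C) (n : R[i]) :
  (exists i, arc_unit_normal (G i) (a +i* b)%C n) ->
  exists C0 rK, [/\ 0 <= C0, 0 < rK &
    flat_at0 (fun x y => K ((a + x) +i* (b + y))%C) (complex.Re n) (complex.Im n) C0 rK].
Proof.
move=> [i [n1 [t0 [t0in t0z dn]]]].
have hi := hend i.
have [t0l t0h] : arc_lo (G i) < t0 /\ t0 < arc_hi (G i).
  move: t0in; rewrite in_itv /= => /andP[l h]; rewrite !lt_neqAle l h !andbT.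
  split; apply/eqP => e; apply: hi; [left|right]; first by rewrite e t0z.
  by rewrite -e t0z.
have [C0 [tau [C00 tau0 hflat]]] := arc_flat t0l t0h n1 dn.
rewrite t0z in hflat.
have [j|d d0 hd] := @fin_min R m (fun j e => forall z, arc_set (G j) z -> cmod (z - (a +i* b)%C) < e ->
    `|complex.Re (z - (a +i* b)%C) * complex.Re n + complex.Im (z - (a +i* b)%C) * complex.Im n| <=
      C0 * (complex.Re (z - (a +i* b)%C) * complex.Im n - complex.Im (z - (a +i* b)%C) * complex.Re n) ^+ 2).
  have [->|ji] := eqVneq j i.
    have [|d d0 hd] := @arc_away R (G i) (a +i* b)%C t0 tau.
      move=> t' ht' tz; suff -> : t' = t0 by rewrite subrr normr0.
      by apply: (arc_inj (c := G i)) => //; rewrite ?in_itv // tz.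
    exists d => // e e0 ed _ [t /= ht <-] te; rewrite in_itv /= in ht.
    case: (hd _ ht) => h; first exact: hflat.
    by move: te; rewrite ltNge (le_trans (ltW ed) h).
  have [|d d0 hd] := @arc_closed R (G j) (a +i* b)%C.
    move=> h; have : (arc_set (G j) `&` arc_set (G i)) (a +i* b)%C.
      by split=> //; exists t0.
    by rewrite hdisj.
  by exists d => // e e0 ed z /hd h1; rewrite ltNge (le_trans (ltW ed) h1).
exists C0, (d / 4); split=> //; first by rewrite divr_gt0.
move=> x y; rewrite hK => -[j _ hz] hx hy.
have E : ((a + x) +i* (b + y))%C - (a +i* b)%C = (x +i* y)%C.
  by apply/eqP; rewrite eq_complex /= ![_ + _ - _]addrAC !subrr !add0r !eqxx.
have := hd j _ hz; rewrite E /=; apply.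
by apply: cmod_box; [move: hx|move: hy]; move: d0; lra0.
Qed.

Lemma touching_at (hdisj : forall i j, i != j -> arc_set (G i) `&` arc_set (G j) = set0)
    (z0 : R[i]) (hz0 : K z0) (hend : forall i, ~ arc_endpoint (G i) z0) (n : R[i])
    (hn : exists i, arc_unit_normal (G i) z0 n)
    (g : R[i] -> R) (hg : is_green_infty K g) : 0 < normal_deriv g z0 n ->
  forall eps, 0 < eps -> eps <= 1 -> exists (T : {poly R[i]}) (N : nat),
  [/\ (0 < N)%N, size T = N.+1, forall z, K z -> cmod T.[z] <= 1,
      cmod T.[z0] = 1 & N%:R * (normal_deriv g z0 n * (1 - eps)) <= cmod T^`().[z0]].
Proof.
set L := normal_deriv g z0 n => L0 eps eps0 eps1.
have radial w : 0 < w -> exists2 t0, 0 < t0 & forall t, 0 < t -> t < t0 ->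
    (L - w) * t <= g (z0 + t%:C%C * n).
  (* A divergent [lim] is the junk value 0, which 0 < L excludes. *)
  move=> w0; have cv : cvg (g (z0 + t%:C%C * n) / t @[t --> 0^'+]).
    have [//|/dvgP h] := pselect (cvg (g (z0 + t%:C%C * n) / t @[t --> 0^'+])).
    by move: L0; rewrite /L /normal_deriv h ltxx.
  move: cv => /cvgrPdist_lt /(_ w w0)[t0 /= t00 ht]; exists t0 => // t tp tt.
  have := ht t; rewrite /= sub0r normrN gtr0_norm // => /(_ tt tp).
  move=> h'; have : `|L - g (z0 + t%:C%C * n) / t| < w by exact: h'.
  rewrite ltr_norml => /andP[_ h].
  have : L - w <= g (z0 + t%:C%C * n) / t by move: h; lra0.
  by rewrite ler_pdivlMr.
case: z0 hz0 hend hn @L L0 radial => a b hz0 hend hn L L0 radial.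
have [C0 [rK [C00 rK0 flat]]] := arcs_flat hdisj hend hn.
have n1 : complex.Re n ^+ 2 + complex.Im n ^+ 2 = 1.
  by case: hn => i [h _]; rewrite -sqr_cmod h expr1n.
have cl := arcs_closed; have bd := arcs_bounded.
have [M [r1 growth]] := green_growth a b hg.
have [Rk hRk] := compact_coord a b bd.
have gc := green_cont a b hg cl.
have K0 : K ((a + 0) +i* (b + 0))%C by rewrite !addr0.
have [|T [N [N0 sT TK T0 dT]]] := green_touching n1 L0 C00 rK0
  (green_ge0 a b hg cl) (green_zero (a := a) (b := b) hg) (cont_ucont gc) (cont_bounded gc)
  (green_harmonic a b hg cl) flat K0 growth hRk _ eps0 eps1.
  move=> e e0; have [t0 t00 ht] := radial _ e0; exists t0 => // t t0' tt.
  apply: (le_trans (ht t t0' tt)); rewrite le_eqVlt; apply/orP; left; apply/eqP; congr g.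
  by case: (n) => ? ?; apply/eqP; rewrite eq_complex /= !mul0r subr0 addr0 !eqxx.
have shz z : (T \Po ('X - (a +i* b)%C%:P)).[z] = T.[z - (a +i* b)%C].
  by rewrite horner_comp hornerXsubC.
exists (T \Po ('X - (a +i* b)%C%:P)), N; split=> //.
- by rewrite size_comp_poly2 // size_XsubC.
- move=> z Kz; rewrite shz.
  have := TK (complex.Re z - a) (complex.Im z - b).
  case: z Kz => x y Kz /=; rewrite ![_ + (_ - _)]addrC !subrK => /(_ Kz).
  by have -> : (x +i* y)%C - (a +i* b)%C = ((x - a) +i* (y - b))%C by [].
- by rewrite shz subrr.
by rewrite deriv_comp derivXsubC mulr1 horner_comp hornerXsubC subrr.
Qed.

End ArcUnion.

(** * From one good polynomial to a sequence with all degrees *)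

Section Sequence.
Context {R : realType}.
Variables (K : set R[i]) (z0 : R[i]) (L : R).
Hypotheses (Kz0 : K z0) (L0 : 0 < L).

Lemma sup_norm_le (p : {poly R[i]}) (b : R) : (forall z, K z -> cmod p.[z] <= b) -> sup_norm K p <= b.
Proof.
move=> h; apply: ge_sup; first by exists (cmod p.[z0]); exists z0.
by move=> _ [z Kz <-]; exact: h.
Qed.

Lemma sup_norm_ge0 (p : {poly R[i]}) : 0 <= sup_norm K p.
Proof.
(* Without a supremum, [sup] has the default value 0. *)
rewrite /sup_norm; have [hs|/sup_out ->//] := pselect (has_sup [set cmod p.[z] | z in K]).
by apply: (le_trans (cmod_ge0 p.[z0])); apply: ub_le_sup; [case: hs|exists z0].
Qed.

Definition almost_optimal (n : nat) (e : R) := exists2 P : {poly R[i]}, size P = n.+1 &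
  n%:R * (1 - e) * sup_norm K P * L <= cmod P^`().[z0].

(** Write [n = k * N + j] with [j < N] and use [T ^+ k * q ^+ j]. The tolerance [e = 3 * w] is spent
    in equal parts: on the derivative of [T], on the growth of [q ^+ j] on K, and on the [j < N]
    missing degrees together with the derivative of [q ^+ j], which cost at most
    [N * L + 1 <= n * w * L] for large [n]. *)
Lemma eventually_almost_optimal (D : R) : (forall z, K z -> cmod (z - z0) <= D) ->
  (forall eps : R, 0 < eps -> eps <= 1 -> exists (T : {poly R[i]}) (N : nat),
  [/\ (0 < N)%N, size T = N.+1, forall z, K z -> cmod T.[z] <= 1,
      cmod T.[z0] = 1 & N%:R * (L * (1 - eps)) <= cmod T^`().[z0]]) ->
  forall e : R, 0 < e -> e <= 1 -> exists n0, forall n, (n0 <= n)%N -> almost_optimal n e.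
Proof.
move=> KD touch e e0 e1; pose w := e / 3.
have w0 : 0 < w by rewrite divr_gt0.
have w3 : w <= 1 / 3 by rewrite /w; lra.
have w1 : w <= 1 by move: w3; lra0.
have [T [N [N0 sT TK T0 dT]]] := touch _ w0 w1.
have NR : 0 < N%:R :> R by rewrite ltr0n.
have D0 : 0 <= D by apply: le_trans (KD _ Kz0); exact: cmod_ge0.
have D1 : 0 < N%:R * (D + 1) by rewrite mulr_gt0 //; move: D0; lra.
pose d := w / (N%:R * (D + 1)).
have d0 : 0 < d by rewrite divr_gt0.
have dD : N%:R * (d * D) <= w.
  have : N%:R * (d * (D + 1)) = w by rewrite /d; field; rewrite !gt_eqF //; move: D0; lra.
  by have := mulr_gt0 NR d0; lra.
have dN : N%:R * d <= 1.
  have : N%:R * (d * (D + 1)) = w by rewrite /d; field; rewrite !gt_eqF //; move: D0; lra.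
  by have := mulr_ge0 (ltW (mulr_gt0 NR d0)) D0; lra.
pose C := (N%:R * L + 1) / (w * L).
have wL : 0 < w * L by rewrite mulr_gt0.
have C0 : 0 <= C by rewrite divr_ge0 // ?(ltW wL) //; have := mulr_gt0 NR L0; lra.
exists (Num.bound C) => n hn.
have nC : C <= n%:R.
  apply: (le_trans (ler_norm _)); apply: (le_trans (ltW (archi_boundP (normr_ge0 C)))).
  by rewrite ger0_norm // ler_nat.
pose k := (n %/ N)%N; pose j := (n %% N)%N.
have jN : (j < N)%N by rewrite ltn_mod.
have kj : n = (k * N + j)%N by exact: divn_eq.
(* q is 1 up to O(d) on K and q(z0) = 1: its powers only fill up the degree. *)
pose q : {poly R[i]} := 1 + d%:C%C *: ('X - z0%:P).
have dC : d%:C%C != 0 :> R[i] by rewrite (fmorph_eq0 (real_complex R)) gt_eqF.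
have sq : size q = 2%N.
  rewrite /q addrC size_polyDl size_scale // size_XsubC // size_poly1 //.
have q0 : q.[z0] = 1 by rewrite /q !hornerE subrr mulr0 addr0.
have dq : q^`() = d%:C%C%:P by rewrite /q derivD derivC add0r derivZ derivXsubC alg_polyC.
have cd : cmod (d%:C%C) = d by rewrite cmodE /= expr0n addr0 sqrtr_sqr gtr0_norm.
have qK z : K z -> cmod q.[z] <= 1 + d * D.
  move=> /KD h; rewrite /q !hornerE; apply: (le_trans (cmodD _ _)); rewrite cmod1 cmodM cd.
  by rewrite lerD2l ler_pM2l.
have T_neq0 : T != 0 by rewrite -size_poly_eq0 sT.
have q_neq0 : q != 0 by rewrite -size_poly_eq0 sq.
have sizeX (p : {poly R[i]}) l s : size p = l.+1 -> size (p ^+ s) = (l * s).+1.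
  move=> sp; have p0 : p != 0 by rewrite -size_poly_eq0 sp.
  rewrite -[LHS]prednK ?size_poly_gt0 ?expf_neq0 //.
  by rewrite size_exp sp.
exists (T ^+ k * q ^+ j).
  rewrite size_mul ?expf_neq0 // (sizeX _ _ _ sT) (sizeX _ _ _ sq) mul1n addnS /= addSn.
  by rewrite kj mulnC.
have dD0 : 0 <= d * D by rewrite mulr_ge0 // ltW.
have sup1 : sup_norm K (T ^+ k * q ^+ j) <= (1 + d * D) ^+ N.
  apply: sup_norm_le => z Kz; rewrite hornerM !horner_exp cmodM !cmodX.
  have h1 : cmod T.[z] ^+ k <= 1 by rewrite exprn_ile1 ?cmod_ge0 // TK.
  have h2 : cmod q.[z] ^+ j <= (1 + d * D) ^+ N.
    apply: (@le_trans _ _ ((1 + d * D) ^+ j)).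
      by rewrite lerXn2r ?nnegrE ?cmod_ge0 ?qK // addr_ge0.
    by rewrite ler_weXn2l // ?lerDl // ltnW.
  by rewrite -[leRHS]mul1r; apply: ler_pM; rewrite ?exprn_ge0 ?cmod_ge0.
have supw : sup_norm K (T ^+ k * q ^+ j) * (1 - w) <= 1.
  have x1 : d * D <= 1.
    have N1 : 1 <= N%:R :> R by rewrite ler1n.
    by have := ler_wpM2r dD0 N1; move: dD w1; lra0.
  (* Bernoulli's inequality; then [(1 + d * D) ^+ N * (1 - w)] is at most the power of
     [1 - (d * D) ^+ 2], hence at most 1. *)
  have h1 : 1 - w <= (1 - d * D) ^+ N.
    have bern s : 1 - s%:R * (d * D) <= (1 - d * D) ^+ s.
      elim: s => [|s IH]; first by rewrite mul0r subr0 expr0.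
      have x10 : 0 <= 1 - d * D by rewrite subr_ge0.
      rewrite exprS; apply: le_trans (ler_wpM2l x10 IH).
      have := mulr_ge0 (mulr_ge0 (ler0n R s) dD0) dD0; rewrite -natr1; lra0.
    by apply: le_trans (bern N); move: dD; lra0.
  have w10 : 0 <= 1 - w by move: w1; lra0.
  apply: (le_trans (ler_pM (sup_norm_ge0 _) w10 sup1 h1)).
  rewrite -exprMn exprn_ile1 //.
    by rewrite mulr_ge0 ?subr_ge0 // addr_ge0.
  by have := mulr_ge0 dD0 dD0; lra0.
have der : cmod (T ^+ k * q ^+ j)^`().[z0] >= k%:R * (N%:R * (L * (1 - w))) - j%:R * d.
  rewrite derivM !deriv_exp !dq hornerD !hornerM !hornerMn !hornerM !horner_exp hornerC q0 !expr1n !mulr1.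
  set u := (X in cmod (X + _)); set v := (X in cmod (_ + X)).
  have hu : cmod u = k%:R * cmod T^`().[z0].
    rewrite /u -mulr_natl !cmodM cmod_nat cmodX T0 expr1n; ring.
  have hv : cmod v = j%:R * d.
    rewrite /v -mulr_natl !cmodM cmod_nat cmodX T0 expr1n cd; ring.
  have := cmodD (u + v) (- v); rewrite addrK cmodN hu hv.
  by have := ler_wpM2l (ler0n R k) dT; lra0.
apply: le_trans der.
set S := sup_norm _ _ in supw *.
have S0 : 0 <= S by exact: sup_norm_ge0.
have we : e = 3 * w by rewrite /w; field.
have n0 : 0 <= n%:R :> R := ler0n _ _.
have kn : n%:R - N%:R <= k%:R * N%:R :> R.
  have : (n <= k * N + N)%N by rewrite {1}kj leq_add2l ltnW.
  by rewrite -(ler_nat R) natrD natrM; lra0.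
have jd : j%:R * d <= 1.
  have : j%:R <= N%:R :> R by rewrite ler_nat ltnW.
  by move=> /(ler_wpM2r (ltW d0)); move: dN; lra0.
have hC : N%:R * L + 1 <= n%:R * (w * L) by rewrite -ler_pdivrMr.
have L1 : 0 <= L * (1 - w) by rewrite mulr_ge0 ?(ltW L0) //; move: w1; lra0.
have a1 := ler_wpM2r L1 kn.
have Sc : (1 - 3 * w) * S <= 1 - 2 * w.
  apply: (@le_trans _ _ ((1 - 2 * w) * (S * (1 - w)))).
    have : 0 <= 2 * w ^+ 2 * S by rewrite mulr_ge0 // mulr_ge0 // sqr_ge0.
    lra0.
  by rewrite -[leRHS]mulr1 ler_wpM2l //; move: w3; lra0.
have nL : 0 <= n%:R * L by rewrite mulr_ge0 // ltW.
have Sd := ler_wpM2l nL Sc.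
have NL : 0 <= N%:R * L * w by rewrite !mulr_ge0 // ltW.
rewrite we; move: a1 jd hC Sd NL; lra0.
Qed.

(** For each [n] the best precision already available is used: [l n] is the largest index [i <= n]
    whose threshold [n0 i] has been passed, and it tends to infinity. *)
Lemma diagonal_choice : (forall e : R, 0 < e -> e <= 1 -> exists n0, forall n, (n0 <= n)%N -> almost_optimal n e) ->
  exists (P : nat -> {poly R[i]}) (eps : nat -> R),
    [/\ forall n, size (P n) = n.+1, eps n @[n --> \oo] --> (0 : R)
      & forall n, n%:R * (1 - eps n) * sup_norm K (P n) * L <= cmod (P n)^`().[z0]].
Proof.
move=> opt.
have inv01 (l : nat) : 0 < l.+1%:R^-1 :> R /\ l.+1%:R^-1 <= 1 :> R.
  by rewrite invr_gt0 ltr0n invf_le1 ?ltr0n // ler1n.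
have [n0 hn0] : exists n0 : nat -> nat, forall l n, (n0 l <= n)%N -> almost_optimal n l.+1%:R^-1.
  have [l|n0 hn0] := @boolp.choice nat nat
      (fun l N => forall n, (N <= n)%N -> almost_optimal n l.+1%:R^-1); last by exists n0.
  by apply: opt; have [] := inv01 l.
pose l n := (\max_(i < n.+1 | (n0 i <= n)%N) i)%N.
have ok n : almost_optimal n (l n).+1%:R^-1.
  rewrite /l; elim/big_ind : _ => [|x y hx hy|i /hn0 //].
    (* When no threshold has been passed, the empty maximum is 0 and the precision is 1: the
       required lower bound is then 0, and any polynomial of degree [n] will do. *)
    exists ('X^n); first by rewrite size_polyXn.
    by rewrite invr1 subrr mulr0 !mul0r cmod_ge0.
  by rewrite /maxn; case: ifP.
have [P hP] : exists P : nat -> {poly R[i]}, forall n, size (P n) = n.+1 /\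
    n%:R * (1 - (l n).+1%:R^-1) * sup_norm K (P n) * L <= cmod (P n)^`().[z0].
  have [n|P hP] := @boolp.choice nat {poly R[i]} (fun n p => size p = n.+1 /\
    n%:R * (1 - (l n).+1%:R^-1) * sup_norm K p * L <= cmod p^`().[z0]); last by exists P.
  by have [p] := ok n; exists p.
exists P, (fun n => (l n).+1%:R^-1); split; [by move=> n; have [] := hP n| |by move=> n; have [] := hP n].
apply/cvgrPdist_lt => w w0.
pose b := Num.bound w^-1.
exists (maxn b (n0 b)) => // n /=; rewrite geq_max => /andP[bn nb].
rewrite sub0r normrN gtr0_norm; last by have [] := inv01 (l n).
have bl : (b <= l n)%N.
  by rewrite /l (@leq_bigmax_cond _ _ (fun i : 'I_n.+1 => (i : nat)) (Ordinal (bn : (b < n.+1)%N))).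
rewrite invf_plt ?posrE ?ltr0n //.
apply: (lt_le_trans (archi_boundP _)); first by rewrite invr_ge0 ltW.
by rewrite ler_nat -/b ltnW.
Qed.

End Sequence.

Theorem theorem2 (R : realType) (m : nat) (G : 'I_m -> C2_arc R)
    (hdisj : forall i j, i != j -> arc_set (G i) `&` arc_set (G j) = set0)
    (K : set R[i]) (hK : K = \bigcup_(i in [set: 'I_m]) arc_set (G i))
    (z0 : R[i]) (hz0 : K z0) (hend : forall i, ~ arc_endpoint (G i) z0)
    (n1 : R[i]) (hn1 : exists i, arc_unit_normal (G i) z0 n1)
    (g : R[i] -> R) (hg : is_green_infty K g) :
  exists (P : nat -> {poly R[i]}) (eps : nat -> R),
    [/\ forall n, size (P n) = n.+1,
        eps n @[n --> \oo] --> (0 : R)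
      & forall n, cmod (deriv (P n)).[z0] >=
          n%:R * (1 - eps n) * sup_norm K (P n) *
          Num.max (normal_deriv g z0 n1) (normal_deriv g z0 (- n1))].
Proof.
set L := Num.max _ _.
(* If the maximum is at most 0, as when both limits diverge and take the default value 0, the right
   side is nonpositive and powers of ['X] suffice. *)
have [Lneg|Lpos] := leP L 0.
  exists (fun n => 'X^n), (fun=> 0); split=> [n||n]; first by rewrite size_polyXn.
    exact: cvg_cst.
  apply: (le_trans _ (cmod_ge0 _)); rewrite subr0 mulr1.
  by rewrite mulr_ge0_le0 // mulr_ge0 // (sup_norm_ge0 hz0).
have hn2 : exists i, arc_unit_normal (G i) z0 (- n1).
  case: hn1 => i [nn [t [t1 t2 t3]]]; exists i; split; first by rewrite cmodN.
  by exists t; split=> //; rewrite mulNr ReN t3 oppr0.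
have [n [hn LE]] : exists n, (exists i, arc_unit_normal (G i) z0 n) /\ L = normal_deriv g z0 n.
  rewrite /L; case: leP => _; first by exists (- n1).
  by exists n1.
rewrite LE in Lpos *.
have [B hB] := arcs_bounded hK.
have KD z : K z -> cmod (z - z0) <= B + cmod z0.
  by move=> /hB h; apply: (le_trans (cmodD _ _)); rewrite cmodN lerD2r.
apply: diagonal_choice.
apply: (eventually_almost_optimal hz0 Lpos KD).
exact: (touching_at hK hdisj hz0 hend hn hg Lpos).
Qed.
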